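(* Let $d\ge 1$, let $T,\Omega\subset\mathbb{R}^d$ be measurable sets of finite Lebesgue measure $|T|,|\Omega|$, and let $0<\epsilon<1$. For $r>0$ let $M^{-}(rT,\Omega,\epsilon)$ denote the maximum number of orthonormal functions $f\in L^2(\mathbb{R}^d)$ satisfying $$\|P_{rT,\Omega}f-f\|^2\le\epsilon .$$ Then, as $r\to\infty$, $$M^{-}(rT,\Omega,\epsilon)\ \ge\ (1-\epsilon)^{-1}\,(2\pi)^{-d}\,|T|\,|\Omega|\,r^d+o(r^d).$$
   Context: The Fourier transform is $Ff(\xi)=(2\pi)^{-d/2}\int_{\mathbb{R}^d}f(t)e^{-i\xi\cdot t}\,dt$ for $f\in L^1(\mathbb{R}^d)\cap L^2(\mathbb{R}^d)$, extended to a unitary operator on $L^2(\mathbb{R}^d)$. For a measurable set $S$, $\chi_S$ is its characteristic function, and $rT=\{rt:t\in T\}$. The time-limiting operator is $D_Tf=\chi_Tf$, the orthogonal projection of $L^2(\mathbb{R}^d)$ onto functions supported in $T$. The band-limiting operator is $B_\Omega f=F^{-1}\chi_\Omega Ff$, the orthogonal projection onto functions whose Fourier transform is supported in $\Omega$. Set $P_{rT,\Omega}=D_{rT}B_\Omega D_{rT}$. The norm is that of $L^2(\mathbb{R}^d)$. The notation $o(r^d)$ denotes a quantity $e(r)$ (depending on $T,\Omega,\epsilon,d$) with $e(r)/r^d\to0$ as $r\to\infty$; the inequality means that it holds for some such $e(r)$. *)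

(* Defs.v *)
From HB Require Import structures.
From mathcomp Require Import all_boot all_order all_algebra.
From mathcomp Require Import complex.
From mathcomp Require Import all_classical all_reals all_analysis.

Set Implicit Arguments.
Unset Strict Implicit.
Unset Printing Implicit Defensive.
Import Order.TTheory GRing.Theory Num.Theory.
Import numFieldNormedType.Exports.

Local Open Scope classical_set_scope.
Local Open Scope ring_scope.
Local Open Scope complex_scope.

Definition rV_display : measure_display -> measure_display.
Proof. exact. Qed.

Section borel_rV.
Variables (R : realType) (n : nat).

Definition rV_coor (i : 'I_n) (x : 'rV[R]_n) : R := x 0 i.

Let rV0 : g_sigma_preimage rV_coor set0.
Proof. exact: sigma_algebra0. Qed.

Let rVC A : g_sigma_preimage rV_coor A -> g_sigma_preimage rV_coor (~` A).
Proof. exact: sigma_algebraC. Qed.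

Let rV_bigcup (F : (set 'rV[R]_n)^nat) :
  (forall i, g_sigma_preimage rV_coor (F i)) ->
  g_sigma_preimage rV_coor (\bigcup_i F i).
Proof. exact: sigma_algebra_bigcup. Qed.

(* The sigma-algebra generated by the coordinates, i.e. the Borel one on R^n. *)
HB.instance Definition _ := @isMeasurable.Build
  (rV_display default_measure_display) 'rV[R]_n (g_sigma_preimage rV_coor) rV0 rVC rV_bigcup.

Lemma measurable_rV_coor i : measurable_fun setT (rV_coor i).
Proof.
move=> _ Y mY; rewrite setTI; apply: sub_sigma_algebra.
by rewrite (bigD1 i)//=; left; exists Y => //; rewrite setTI.
Qed.

Lemma measurable_fun_rV d (T : measurableType d) (f : T -> 'rV[R]_n) :
  (forall i, measurable_fun setT (fun x => f x 0 i)) -> measurable_fun setT f.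
Proof.
move=> mf; apply: (@measurability _ _ _ _ setT f
  (\big[setU/set0]_(i < n) preimage_set_system setT (rV_coor i) measurable)) => //.
move=> _ [A + <-]; move: A.
apply: (big_ind (fun S : set (set 'rV[R]_n) =>
    forall A, S A -> measurable (setT `&` f @^-1` A))) => //.
- by move=> S1 S2 h1 h2 A [/h1|/h2].
- by move=> i _ _ [Y mY <-]; rewrite setTI; exact: (mf i).
Qed.

End borel_rV.

Section lebesgue_borel.
Variable R : realType.

Definition rV_cons n (p : measurableTypeR R * 'rV[R]_n) : 'rV[R]_n.+1 :=
  \row_(i < n.+1) oapp (p.2 0) p.1 (unlift ord0 i).

Definition rV_uncons n (x : 'rV[R]_n.+1) : measurableTypeR R * 'rV[R]_n :=
  (x 0 ord0, \row_(i < n) x 0 (lift ord0 i)).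

Lemma rV_consK n : cancel (@rV_cons n) (@rV_uncons n).
Proof.
case=> a v; rewrite /rV_uncons /rV_cons mxE unlift_none /=; congr pair.
by apply/rowP => i; rewrite !mxE liftK.
Qed.

Lemma measurable_rV_cons n : measurable_fun setT (@rV_cons n).
Proof.
apply: measurable_fun_rV => i; rewrite /rV_cons.
case: (unliftP ord0 i) => [j|] ->.
- rewrite (_ : (fun _ => _) = rV_coor j \o snd); last first.
    by apply/funext => x; rewrite mxE liftK.
  by apply: measurableT_comp => //; exact: measurable_rV_coor.
- rewrite (_ : (fun _ => _) = fst); last first.
    by apply/funext => x; rewrite mxE unlift_none.
  exact: measurable_fst.
Qed.

Lemma measurable_rV_uncons n : measurable_fun setT (@rV_uncons n).
Proof.
apply/measurable_fun_pairP; split.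
  exact: (@measurable_rV_coor R n.+1 ord0).
apply: measurable_fun_rV => i.
rewrite (_ : (fun _ => _) = rV_coor (lift ord0 i)).
  exact: measurable_rV_coor.
by apply/funext => x /=; rewrite mxE.
Qed.

Lemma sigma_finite_prod d1 d2 (T1 : measurableType d1)
    (T2 : measurableType d2) (m1 : {sigma_finite_measure set T1 -> \bar R})
    (m2 : {sigma_finite_measure set T2 -> \bar R}) :
  sigma_finite setT (m1 \x m2)%E.
Proof.
have /sigma_finiteP[F [TF ndF Foo]] := sigma_finiteT m1.
have /sigma_finiteP[G [TG ndG Goo]] := sigma_finiteT m2.
exists (fun n => F n `*` G n).
  rewrite -setXTT TF TG predeqE => -[x y]; split=> [|[n _ []/= ? ?]]; last first.
    by split; exists n.
  move=> [/= [n _ Fnx] [k _ Gky]]; exists (maxn n k) => //; split.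
  - by move: x Fnx; exact/subsetPset/ndF/leq_maxl.
  - by move: y Gky; exact/subsetPset/ndG/leq_maxr.
move=> k; have [? ?] := Foo k; have [? ?] := Goo k.
split; first exact: measurableX.
by rewrite product_measure1E// lte_mul_pinfty// ge0_fin_numE.
Qed.

Section step.
Local Open Scope ereal_scope.
Variables (n : nat) (mu : {sigma_finite_measure set 'rV[R]_n -> \bar R}).

Definition lebesgue_borelS : set 'rV[R]_n.+1 -> \bar R :=
  pushforward ((@lebesgue_measure R) \x mu) (@rV_cons n).

Let mc := @measurable_rV_cons n.

Let borelS0 : lebesgue_borelS set0 = 0.
Proof. exact: measure0. Qed.

Let borelS_ge0 A : 0 <= lebesgue_borelS A.
Proof. exact: measure_ge0. Qed.

Let borelS_sigma_additive : semi_sigma_additive lebesgue_borelS.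
Proof. exact: measure_semi_sigma_additive. Qed.

HB.instance Definition _ := isMeasure.Build _ _ _ lebesgue_borelS
  borelS0 borelS_ge0 borelS_sigma_additive.

Let borelS_sigma_finite : sigma_finite setT lebesgue_borelS.
Proof.
have [F TF mF] := sigma_finite_prod (@lebesgue_measure R) mu.
exists (fun k => @rV_uncons n @^-1` F k).
  by rewrite -preimage_bigcup -TF preimage_setT.
move=> k; have [mFk Fkoo] := mF k; split.
  by rewrite -[X in measurable X]setTI; exact: measurable_rV_uncons.
rewrite /lebesgue_borelS /pushforward.
rewrite (_ : _ @^-1` _ = F k)//.
by apply/seteqP; split=> p /=; rewrite rV_consK.
Qed.

HB.instance Definition _ := Measure_isSigmaFinite.Build _ _ _ lebesgue_borelS
  borelS_sigma_finite.

End step.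

(* Lebesgue measure on the Borel sets of R^n, as the n-fold product measure. *)
Fixpoint lebesgue_borel (n : nat) :
    {sigma_finite_measure set 'rV[R]_n -> \bar R} :=
  match n with
  | 0%N => dirac (0 : 'rV[R]_0)
  | m.+1 => lebesgue_borelS (lebesgue_borel m)
  end.

End lebesgue_borel.

(* R^d equipped with the sigma-algebra of all Lebesgue measurable sets (not only
   the Borel ones): the Caratheodory sigma-algebra of the outer measure induced
   by lebesgue_borel, which is the completion of the Borel one. *)
Definition lebesgue_rV (R : realType) (d : nat) : Type :=
  caratheodory_type ((@lebesgue_borel R d)^*)%mu.

HB.instance Definition _ R d := Measurable.on (lebesgue_rV R d).

Section lebesgue_measure_rV.
Variables (R : realType) (d : nat).

Definition Leb : set (lebesgue_rV R d) -> \bar R :=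
  @completed_measure_extension _ _ R (@lebesgue_borel R d).

HB.instance Definition _ := Measure.on Leb.

Let Leb_sigma_finite : sigma_finite setT Leb.
Proof. exact/completed_measure_extension_sigma_finite/sigma_finiteT. Qed.

HB.instance Definition _ :=
  Measure_isSigmaFinite.Build _ _ _ Leb Leb_sigma_finite.

Definition Lebesgue_measurable (A : set 'rV[R]_d) : Prop :=
  measurable (A : set (lebesgue_rV R d)).

End lebesgue_measure_rV.
Arguments Leb {R d}.

Section L2.
Variables (R : realType) (d : nat).
Local Notation E := 'rV[R]_d.
Local Notation X := (lebesgue_rV R d).
Implicit Types f g h : E -> R[i].

Definition measurableC f : Prop :=
  measurable_fun setT (fun x : X => complex.Re (f x) : R) /\
  measurable_fun setT (fun x : X => complex.Im (f x) : R).

Definition integralC f : R[i] :=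
  (\int[Leb]_x complex.Re (f x)) +i* (\int[Leb]_x complex.Im (f x)).

Definition normL (p : R) f : \bar R :=
  ('N[Leb]_(p%:E)[(fun x : X => (Normc.normc (f x))%:E)])%E.

Definition inL (p : R) f : Prop := measurableC f /\ (normL p f < +oo)%E.

Definition innerL2 f g : R[i] := integralC (fun x => f x * (g x)^*).

Definition dot (x y : E) : R := \sum_(i < d) x 0 i * y 0 i.

Definition expi (a : R) : R[i] := cos a +i* sin a.

Definition fourier_integral f : E -> R[i] := fun xi =>
  ((2 * pi) `^ (- (d%:R / 2)))%:C * integralC (fun t => f t * expi (- dot xi t)).

(* g represents F f: continuous extension to L^2 of the integral formula on
   L^1 \cap L^2.  As elements of L^2 are represented by functions, g is
   determined by f only up to a null set. *)
Definition is_fourier f g : Prop :=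
  [/\ inL 2 f, inL 2 g &
   exists u : nat -> E -> R[i],
     [/\ forall n, inL 1 (u n) /\ inL 2 (u n),
         normL 2 (u n \- f) @[n --> \oo] --> 0%E &
         normL 2 (fourier_integral (u n) \- g) @[n --> \oo] --> 0%E]].

(* Representatives of F f and F^-1 h, for f and h in L^2; the default value 0
   is only used outside L^2. *)
Definition fourier f : E -> R[i] := xget (cst 0) [set g | is_fourier f g].

Definition fourier_inv h : E -> R[i] := xget (cst 0) [set g | is_fourier g h].

Definition chi_mul (S : set E) f : E -> R[i] := fun x => (\1_S x)%:C * f x.

Definition time_limit (T : set E) f := chi_mul T f.

Definition band_limit (Omega : set E) f :=
  fourier_inv (chi_mul Omega (fourier f)).

Definition time_band_limit (T Omega : set E) f :=
  time_limit T (band_limit Omega (time_limit T f)).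

Definition dilate (r : R) (T : set E) : set E := [set r *: t | t in T].

Definition orthonormal n (f : 'I_n -> E -> R[i]) : Prop :=
  (forall i, inL 2 (f i)) /\
  (forall i j, innerL2 (f i) (f j) = (i == j)%:R).

(* The possible numbers of orthonormal f with ||P_{T,Omega} f - f||^2 <= eps. *)
Definition almost_fixed_numbers (T Omega : set E) (eps : R) : set nat :=
  [set n | exists f : 'I_n -> E -> R[i], orthonormal f /\
    forall i,
      (normL 2 (time_band_limit T Omega (f i) \- f i)%R ^+ 2 <= eps%:E)%E].

Definition is_maximum (A : set nat) (m : nat) : Prop :=
  A m /\ forall n, A n -> (n <= m)%N.

Definition is_Mminus (T Omega : set E) (eps : R) (m : nat) : Prop :=
  is_maximum (almost_fixed_numbers T Omega eps) m.

End L2.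

(* Main.v *)
Require Import Defs.
From HB Require Import structures.
From mathcomp Require Import all_boot all_order all_algebra.
From mathcomp Require Import complex.
From mathcomp Require Import all_classical all_reals all_analysis.
From mathcomp Require Import measurable_realfun.
From mathcomp Require Import ring lra.
Set Implicit Arguments.
Unset Strict Implicit.
Unset Printing Implicit Defensive.
Import Order.TTheory GRing.Theory Num.Theory.
Import numFieldNormedType.Exports.
Local Open Scope classical_set_scope.
Local Open Scope ring_scope.

Local Notation Re := complex.Re.
Local Notation Im := complex.Im.
Local Notation "x %:C" := (real_complex _ x) (format "x %:C").
Local Notation "x +i* y" := (Complex x y) : ring_scope.

(* Time-frequency packets.  Cut R^d into cubes of side lam = r l; on each cube the
   exponentials with frequencies in p0 + (2 pi / lam) Z^d are orthonormal.  Averaging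
   over the offsets of the two lattices produces about (2 pi)^-d |T| |Omega| r^d pairs
   (cube, frequency) for which the cube lies almost inside rT and the transform of the
   packet almost inside Omega, so that P_{rT,Omega} nearly fixes the packet.  A
   Hadamard matrix then mixes a fraction 1 - eps of good packets with a fraction eps of
   arbitrary packets of the same family: the defect of every mixture is about eps, and
   the number of functions is multiplied by (1 - eps)^-1.  That a maximum exists
   follows from Bessel's inequality, which bounds the sum of |chi_Omega F chi_rT f_j|^2
   for orthonormal f_j.

   Plancherel is obtained without L^2 completeness: the multiplication formula with an
   exponential damping factor gives |F h| <= |h|; equality holds for indicators since
   translation is continuous in measure, hence on L^1 cap L^2 because the defect
   |h|^2 - |F h|^2 is a nonnegative quadratic form. *)

(** In time the dilation costs nothing: a cube of side [r l] leaves [rT] by the same fraction as the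
    cube of side [l] leaves [T], so [l] is fixed once, by [T] alone. The spread of a packet in
    frequency is of order [1 / (r l)]; hence for large [r] most frequencies of [Omega] are good. The
    number of cubes is about [|T| / l^d], that of frequencies about [|Omega| (r l / 2 pi)^d], and
    [l] cancels in the product. Every single mixture must satisfy the bound, not just their average,
    while nothing is known about the leakage of the bad packets or about cross terms. Coefficients
    of modulus [2^(-p/2)] settle the first point: by orthonormality the bad part of each mixture has
    squared norm equal to its share of the block. The inequality [|z + w|^2 <= (1 + t) |z|^2 + (1 +
    1/t) |w|^2] settles the second: a small [t] hardly enlarges the bad part, and the large factor
    on the good part is paid for by a leakage chosen after [p] and [t]. For this reason the bad
    share is kept strictly below [eps]. *)

Section complex_algebra.
Variable R : realType.
Implicit Types (z w : R[i]) (x y : R).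

(** Squared modulus as a polynomial in the real and imaginary parts, so that identities between
    squared norms close by [ring] and [lra]. *)
Definition sqn z : R := Re z ^+ 2 + Im z ^+ 2.

Lemma ReD z w : Re (z + w) = Re z + Re w. Proof. by case: z w => a b [c e]. Qed.
Lemma ImD z w : Im (z + w) = Im z + Im w. Proof. by case: z w => a b [c e]. Qed.
Lemma ReN z : Re (- z) = - Re z. Proof. by case: z. Qed.
Lemma ImN z : Im (- z) = - Im z. Proof. by case: z. Qed.
Lemma ReM z w : Re (z * w) = Re z * Re w - Im z * Im w.
Proof. by case: z w => a b [c e]. Qed.
Lemma ImM z w : Im (z * w) = Re z * Im w + Im z * Re w.
Proof. by case: z w => a b [c e]. Qed.
Lemma Re_conj z : Re (conjc z) = Re z. Proof. by case: z. Qed.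
Lemma Im_conj z : Im (conjc z) = - Im z. Proof. by case: z. Qed.
Definition ReImE := (ReD, ImD, ReN, ImN, ReM, ImM, Re_conj, Im_conj).

Lemma complexP z w : Re z = Re w -> Im z = Im w -> z = w.
Proof. by case: z w => a b [c e] /= -> ->. Qed.

Lemma sqn_ge0 z : 0 <= sqn z.
Proof. by rewrite addr_ge0 ?sqr_ge0. Qed.

Lemma sqn0 : sqn 0 = 0. Proof. by rewrite /sqn /= expr0n addr0. Qed.

Lemma sqn_normc z : sqn z = Normc.normc z ^+ 2.
Proof. by case: z => a b; rewrite /= sqr_sqrtr// addr_ge0 ?sqr_ge0. Qed.

Lemma sqnM z w : sqn (z * w) = sqn z * sqn w.
Proof. by rewrite /sqn !ReImE; ring. Qed.

Lemma sqn_conj z : sqn (conjc z) = sqn z.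
Proof. by rewrite /sqn !ReImE sqrrN. Qed.

Lemma sqnN z : sqn (- z) = sqn z.
Proof. by rewrite /sqn !ReImE !sqrrN. Qed.

Lemma sqnBC z w : sqn (z - w) = sqn (w - z).
Proof. by rewrite -sqnN opprB. Qed.

Lemma sqn_real x : sqn (x%:C) = x ^+ 2.
Proof. by rewrite /sqn /= expr0n addr0. Qed.

Lemma mul_conj z : z * conjc z = (sqn z)%:C.
Proof. by apply: complexP; rewrite !ReImE /sqn /=; ring. Qed.

(** The difference of the two sides is [t] times the squared modulus of [z - w / t]. With [t] free,
    one summand can be kept almost at its own size while the other pays a large factor. *)
Lemma sqnD_le t z w : 0 < t -> sqn (z + w) <= (1 + t) * sqn z + (1 + t^-1) * sqn w.
Proof.
move=> t0; rewrite -subr_ge0.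
have tn : t != 0 by rewrite gt_eqF.
rewrite (_ : _ - _ = t * sqn (z - (t^-1)%:C * w)).
  by rewrite mulr_ge0 ?sqn_ge0// ltW.
by rewrite /sqn !ReImE /=; field.
Qed.

Lemma sqnD_le2 z w : sqn (z + w) <= 2 * sqn z + 2 * sqn w.
Proof. by have := @sqnD_le 1 z w ltr01; rewrite invr1. Qed.

Lemma normcR_le z : Normc.normc z <= `|Re z| + `|Im z|.
Proof.
rewrite -(@ler_pXn2r _ 2)// ?nnegrE ?addr_ge0//; last by case: z => a b; exact: sqrtr_ge0.
rewrite -sqn_normc /sqn -(real_normK (num_real (Re z))) -(real_normK (num_real (Im z))).
have : 0 <= `|Re z| * `|Im z| by rewrite mulr_ge0.
by rewrite sqrrD; lra.
Qed.

Lemma Re_normc z : `|Re z| <= Normc.normc z.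
Proof.
case: z => a b /=; rewrite -sqrtr_sqr ler_sqrt ?addr_ge0 ?sqr_ge0//.
by rewrite lerDl sqr_ge0.
Qed.
Lemma Im_normc z : `|Im z| <= Normc.normc z.
Proof.
case: z => a b /=; rewrite -sqrtr_sqr ler_sqrt ?addr_ge0 ?sqr_ge0//.
by rewrite lerDr sqr_ge0.
Qed.

Lemma normc_ge0 z : 0 <= Normc.normc z.
Proof. by case: z => a b; exact: sqrtr_ge0. Qed.

Lemma real_complexM x y : (x * y)%:C = x%:C * y%:C.
Proof. by apply: complexP; rewrite !ReImE /=; ring. Qed.
Lemma real_complexD x y : (x + y)%:C = x%:C + y%:C.
Proof. by apply: complexP; rewrite !ReImE /=; ring. Qed.
Lemma real_complexB x y : (x - y)%:C = x%:C - y%:C.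
Proof. by apply: complexP; rewrite !ReImE /=; ring. Qed.

Lemma expiD x y : expi (x + y) = expi x * expi y.
Proof. by apply: complexP; rewrite !ReImE /expi /= ?cosD ?sinD//; ring. Qed.

Lemma expi0 : expi (0 : R) = 1.
Proof. by rewrite /expi cos0 sin0. Qed.

Lemma conj_expi x : conjc (expi x) = expi (- x).
Proof. by apply: complexP; rewrite !ReImE /expi /= ?cosN ?sinN. Qed.

Lemma sqn_expi x : sqn (expi x) = 1.
Proof. by rewrite /sqn /expi /= cos2Dsin2. Qed.

Lemma normc_expi x : Normc.normc (expi x) = 1.
Proof. by rewrite /expi /= cos2Dsin2 sqrtr1. Qed.

Lemma conjcM z w : conjc (z * w) = conjc z * conjc w.
Proof. by apply: complexP; rewrite !ReImE; ring. Qed.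

Lemma conjcD z w : conjc (z + w) = conjc z + conjc w.
Proof. by apply: complexP; rewrite !ReImE; ring. Qed.

Lemma Re_sum I (s : seq I) (P : pred I) (F : I -> R[i]) :
  Re (\sum_(i <- s | P i) F i) = \sum_(i <- s | P i) Re (F i).
Proof.
elim: s => [|i s IH]; first by rewrite !big_nil.
by rewrite !big_cons; case: ifP => _ //; rewrite ReD IH.
Qed.

Lemma normc_real x : Normc.normc x%:C = `|x|.
Proof. by rewrite /= expr0n addr0 sqrtr_sqr. Qed.

Lemma normc_conj z : Normc.normc (conjc z) = Normc.normc z.
Proof. by case: z => a b /=; rewrite sqrrN. Qed.

Lemma normc_prod (I : finType) (F : I -> R[i]) :
  Normc.normc (\prod_i F i) = \prod_i Normc.normc (F i).
Proof.
apply: (big_morph (@Normc.normc R)); first by move=> a b; exact: Normc.normcM.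
exact: Normc.normc1.
Qed.

Lemma normcM_le z w : Normc.normc z * Normc.normc w <= (sqn z + sqn w) / 2.
Proof.
have : 0 <= (Normc.normc z - Normc.normc w) ^+ 2 by apply: sqr_ge0.
by rewrite !sqn_normc sqrrB mulr2n; lra.
Qed.

End complex_algebra.

(** * Measurability and integration of complex functions, by real and imaginary parts *)

Section complex_measurable.
Variables (R : realType) (d : measure_display) (Y : measurableType d).
Implicit Types f g : Y -> R[i].

Definition Cmeas f := measurable_fun setT (fun x => Re (f x)) /\
  measurable_fun setT (fun x => Im (f x)).

Lemma CmeasD f g : Cmeas f -> Cmeas g -> Cmeas (fun x => f x + g x).
Proof.
by move=> [f1 f2] [g1 g2]; split; [under eq_fun do rewrite ReD|under eq_fun do rewrite ImD];
  exact: measurable_funD.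
Qed.

Lemma CmeasN f : Cmeas f -> Cmeas (fun x => - f x).
Proof.
by move=> [f1 f2]; split; [under eq_fun do rewrite ReN|under eq_fun do rewrite ImN];
  exact: measurableT_comp.
Qed.

Lemma CmeasM f g : Cmeas f -> Cmeas g -> Cmeas (fun x => f x * g x).
Proof.
move=> [f1 f2] [g1 g2]; split; [under eq_fun do rewrite ReM|under eq_fun do rewrite ImM].
  by apply: measurable_funB; exact: measurable_funM.
by apply: measurable_funD; exact: measurable_funM.
Qed.

Lemma Cmeas_conj f : Cmeas f -> Cmeas (fun x => conjc (f x)).
Proof.
move=> [f1 f2]; split; [by under eq_fun do rewrite Re_conj|under eq_fun do rewrite Im_conj].
exact: measurableT_comp.
Qed.

Lemma Cmeas_cst (c : R[i]) : Cmeas (cst c).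
Proof. by split; exact: measurable_cst. Qed.

Lemma Cmeas_real (g : Y -> R) : measurable_fun setT g -> Cmeas (fun x => (g x)%:C).
Proof. by move=> mg; split => //=; exact: measurable_cst. Qed.

Lemma Cmeas_indic (S : set Y) : measurable S -> Cmeas (fun x => (\1_S x)%:C).
Proof. by move=> mS; apply: Cmeas_real; exact: measurable_indic. Qed.

Lemma Cmeas_expi (g : Y -> R) : measurable_fun setT g -> Cmeas (fun x => expi (g x)).
Proof.
move=> mg; split => /=.
  by apply: measurableT_comp => //; apply: continuous_measurable_fun; exact: continuous_cos.
by apply: measurableT_comp => //; apply: continuous_measurable_fun; exact: continuous_sin.
Qed.

Lemma Cmeas_prod I (s : seq I) (F : I -> Y -> R[i]) :
  (forall i, Cmeas (F i)) -> Cmeas (fun x => \prod_(i <- s) F i x).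
Proof.
move=> mF; elim: s => [|i s IH].
  by under eq_fun do rewrite big_nil; exact: Cmeas_cst.
by under eq_fun do rewrite big_cons; exact: CmeasM.
Qed.

Lemma measurable_sqn f : Cmeas f -> measurable_fun setT (fun x => sqn (f x)).
Proof. by move=> [f1 f2]; apply: measurable_funD; exact: measurable_funX. Qed.

Lemma measurable_normc f : Cmeas f -> measurable_fun setT (fun x => Normc.normc (f x)).
Proof.
move=> mf; rewrite (_ : (fun x => _) = (fun x => Num.sqrt (sqn (f x)))); last first.
  by apply/funext => x; rewrite /sqn; case: (f x).
have ms : measurable_fun setT (@Num.sqrt R).
  by apply: continuous_measurable_fun; move=> x; exact: (@sqrt_continuous R x).
by apply: (measurableT_comp ms); exact: measurable_sqn.
Qed.

End complex_measurable.

Lemma Cmeas_comp (R : realType) d d' (Y : measurableType d) (Z : measurableType d')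
    (f : Z -> R[i]) (phi : Y -> Z) : measurable_fun setT phi -> Cmeas f ->
  Cmeas (fun x => f (phi x)).
Proof. by move=> mphi [f1 f2]; split; [exact: (measurableT_comp f1 mphi)|exact: (measurableT_comp f2 mphi)]. Qed.

Section complex_integral.
Variables (R : realType) (d : measure_display) (Y : measurableType d).
Variable mu : {measure set Y -> \bar R}.
Implicit Types f g : Y -> R[i].

Definition integ (g : Y -> R) := mu.-integrable setT (EFin \o g).

Lemma integ_measurable (g : Y -> R) : integ g -> measurable_fun setT g.
Proof. by move/measurable_int => /measurable_EFinP. Qed.

Lemma integ_le (g h : Y -> R) : measurable_fun setT g -> integ h ->
  (forall x, `|g x| <= h x) -> integ g.
Proof.
move=> mg ih gh; apply: (@le_integrable _ _ _ mu setT _ (EFin \o g) (EFin \o h)) => //.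
  exact/measurable_EFinP.
by move=> x _ /=; rewrite lee_fin (le_trans (gh x))// ler_norm.
Qed.

Lemma integD (g h : Y -> R) : integ g -> integ h -> integ (fun x => g x + h x).
Proof. by move=> ig ih; have := integrableD measurableT ig ih. Qed.

Lemma integZl (k : R) (g : Y -> R) : integ g -> integ (fun x => k * g x).
Proof. by move=> ig; have := integrableZl measurableT k ig. Qed.

Lemma integN (g : Y -> R) : integ g -> integ (fun x => - g x).
Proof. by move=> ig; have := integrableN ig. Qed.

Lemma integB (g h : Y -> R) : integ g -> integ h -> integ (fun x => g x - h x).
Proof. by move=> ig ih; apply: integD => //; exact: integN. Qed.

Lemma integ0 : integ (cst 0).
Proof. exact: (integrable0 mu setT). Qed.

Lemma integ_sum I (s : seq I) (F : I -> Y -> R) :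
  (forall i, integ (F i)) -> integ (fun x => \sum_(i <- s) F i x).
Proof.
move=> iF; elim: s => [|i s IH].
  by under eq_fun do rewrite big_nil; exact: integ0.
by under eq_fun do rewrite big_cons; exact: integD.
Qed.

Lemma Rintegral_sum I (s : seq I) (F : I -> Y -> R) :
  (forall i, integ (F i)) ->
  \int[mu]_x (\sum_(i <- s) F i x) = \sum_(i <- s) \int[mu]_x F i x.
Proof.
move=> iF; elim: s => [|i s IH].
  under eq_Rintegral do rewrite big_nil.
  by rewrite big_nil Rintegral_cst// mul0r.
under eq_Rintegral do rewrite big_cons.
by rewrite RintegralD// ?big_cons ?IH//; [exact: iF|exact: integ_sum].
Qed.

Lemma ge0_integP (g : Y -> R) : measurable_fun setT g -> (forall x, 0 <= g x) ->
  (\int[mu]_x (g x)%:E < +oo)%E -> integ g.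
Proof.
move=> mg g0 goo; apply/integrableP; split; first exact/measurable_EFinP.
by under eq_integral => x _ do rewrite /= ger0_norm//.
Qed.

Lemma integ_lty (g : Y -> R) : integ g -> (\int[mu]_x (g x)%:E < +oo)%E.
Proof. by move=> ig; exact: (integrable_lty measurableT ig). Qed.

Lemma integ_fineK (g : Y -> R) : integ g ->
  (\int[mu]_x (g x)%:E = (\int[mu]_x g x)%:E)%E.
Proof. by move=> ig; rewrite /Rintegral fineK//; exact: (integrable_fin_num measurableT ig). Qed.

Lemma le_integ (g h : Y -> R) : integ g -> integ h -> (forall x, g x <= h x) ->
  \int[mu]_x g x <= \int[mu]_x h x.
Proof. by move=> ig ih gh; exact: le_Rintegral. Qed.

Definition Cinteg f := integ (fun x => Re (f x)) /\ integ (fun x => Im (f x)).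
Definition Cintegral f : R[i] := (\int[mu]_x Re (f x)) +i* (\int[mu]_x Im (f x)).

Lemma Cinteg_meas f : Cinteg f -> Cmeas f.
Proof. by move=> [/integ_measurable ? /integ_measurable]. Qed.

Lemma Cinteg_le f (h : Y -> R) : Cmeas f -> integ h ->
  (forall x, Normc.normc (f x) <= h x) -> Cinteg f.
Proof.
move=> [m1 m2] ih fh; split; apply: (integ_le _ ih) => // x; apply: le_trans (fh x).
  exact: Re_normc.
exact: Im_normc.
Qed.

Lemma Cinteg_normc f : Cinteg f -> integ (fun x => Normc.normc (f x)).
Proof.
move=> if_; have [i1 i2] := if_.
apply: (@integ_le _ (fun x => `|Re (f x)| + `|Im (f x)|)).
- exact/measurable_normc/Cinteg_meas.
- by apply: integD; exact: integrable_norm.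
- by move=> x; rewrite ger0_norm ?normc_ge0 ?normcR_le.
Qed.

Lemma CintegD f g : Cinteg f -> Cinteg g -> Cinteg (fun x => f x + g x).
Proof.
by move=> [f1 f2] [g1 g2]; split; [under eq_fun do rewrite ReD|under eq_fun do rewrite ImD];
  exact: integD.
Qed.

Lemma CintegN f : Cinteg f -> Cinteg (fun x => - f x).
Proof.
by move=> [f1 f2]; split; [under eq_fun do rewrite ReN|under eq_fun do rewrite ImN];
  exact: integN.
Qed.

Lemma CintegB f g : Cinteg f -> Cinteg g -> Cinteg (fun x => f x - g x).
Proof. by move=> mf mg; apply: CintegD => //; exact: CintegN. Qed.

Lemma CintegZl (c : R[i]) f : Cinteg f -> Cinteg (fun x => c * f x).
Proof.
move=> [f1 f2]; split; [under eq_fun do rewrite ReM|under eq_fun do rewrite ImM].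
  by apply: integB; exact: integZl.
by apply: integD; exact: integZl.
Qed.

Lemma Cinteg_conj f : Cinteg f -> Cinteg (fun x => conjc (f x)).
Proof.
move=> [f1 f2]; split; [by under eq_fun do rewrite Re_conj|under eq_fun do rewrite Im_conj].
exact: integN.
Qed.

Lemma Cinteg0 : Cinteg (cst 0).
Proof. by split; exact: integ0. Qed.

Lemma Cinteg_sum I (s : seq I) (F : I -> Y -> R[i]) :
  (forall i, Cinteg (F i)) -> Cinteg (fun x => \sum_(i <- s) F i x).
Proof.
move=> mF; elim: s => [|i s IH].
  by under eq_fun do rewrite big_nil; exact: Cinteg0.
by under eq_fun do rewrite big_cons; exact: CintegD.
Qed.

Lemma Cinteg_real (g : Y -> R) : integ g -> Cinteg (fun x => (g x)%:C).
Proof. by move=> ig; split => //=; exact: integ0. Qed.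

Lemma eq_Cintegral f g : f =1 g -> Cintegral f = Cintegral g.
Proof. by move=> /funext ->. Qed.

Lemma CintegralD f g : Cinteg f -> Cinteg g ->
  Cintegral (fun x => f x + g x) = Cintegral f + Cintegral g.
Proof.
move=> [f1 f2] [g1 g2]; apply: complexP; rewrite !ReImE /Cintegral/=.
  by under eq_Rintegral do rewrite ReD; rewrite RintegralD.
by under eq_Rintegral do rewrite ImD; rewrite RintegralD.
Qed.

Lemma CintegralZl (c : R[i]) f : Cinteg f ->
  Cintegral (fun x => c * f x) = c * Cintegral f.
Proof.
move=> [f1 f2]; apply: complexP; rewrite !ReImE /Cintegral/=.
  under eq_Rintegral do rewrite ReM.
  by rewrite RintegralB// ?RintegralZl//; exact: integZl.
under eq_Rintegral do rewrite ImM.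
by rewrite RintegralD// ?RintegralZl//; exact: integZl.
Qed.

Lemma Cintegral_conj f : Cinteg f ->
  Cintegral (fun x => conjc (f x)) = conjc (Cintegral f).
Proof.
move=> [f1 f2]; apply: complexP; rewrite !ReImE /Cintegral/=.
  by under eq_Rintegral do rewrite Re_conj.
under eq_Rintegral do rewrite Im_conj -mulN1r.
by rewrite RintegralZl// mulN1r.
Qed.

Lemma Cintegral_sum I (s : seq I) (F : I -> Y -> R[i]) :
  (forall i, Cinteg (F i)) ->
  Cintegral (fun x => \sum_(i <- s) F i x) = \sum_(i <- s) Cintegral (F i).
Proof.
move=> iF; elim: s => [|i s IH].
  rewrite (@eq_Cintegral _ (cst 0)); last by move=> x; rewrite big_nil.
  by rewrite big_nil /Cintegral /= Rintegral_cst// mul0r.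
rewrite (@eq_Cintegral _ (fun x => F i x + \sum_(j <- s) F j x)); last first.
  by move=> x; rewrite big_cons.
by rewrite CintegralD// ?big_cons ?IH//; exact: Cinteg_sum.
Qed.

Lemma Cintegral_real (g : Y -> R) : Cintegral (fun x => (g x)%:C) = (\int[mu]_x g x)%:C.
Proof. by rewrite /Cintegral /= Rintegral_cst// mul0r. Qed.

(** The factor 2 comes from bounding real and imaginary parts separately; later only the finiteness
    of the bound matters. *)
Lemma normc_Cintegral_le f (h : Y -> R) : Cmeas f -> integ h ->
  (forall x, Normc.normc (f x) <= h x) ->
  Normc.normc (Cintegral f) <= 2 * \int[mu]_x h x.
Proof.
move=> mf ih fh; have [i1 i2] := Cinteg_le mf ih fh.
apply: le_trans (normcR_le _) _; rewrite mulr_natl mulr2n lerD//=.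
  apply: le_trans (le_normr_Rintegral _ i1) _ => //.
  apply: le_integ => //; first exact: integrable_norm.
  by move=> x; apply: le_trans (fh x); exact: Re_normc.
apply: le_trans (le_normr_Rintegral _ i2) _ => //.
apply: le_integ => //; first exact: integrable_norm.
by move=> x; apply: le_trans (fh x); exact: Im_normc.
Qed.

End complex_integral.

(** * Square-integrable complex functions *)

Section L2_space.
Variables (R : realType) (d : measure_display) (Y : measurableType d).
Variable mu : {measure set Y -> \bar R}.
Implicit Types f g : Y -> R[i].

Definition L2 f := Cmeas f /\ integ mu (fun x => sqn (f x)).
Definition nsq f : R := \int[mu]_x sqn (f x).
Definition ip f g : R[i] := Cintegral mu (fun x => f x * conjc (g x)).

Lemma nsq_ge0 f : 0 <= nsq f.
Proof. by apply: Rintegral_ge0 => x _; exact: sqn_ge0. Qed.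

Lemma L2_le f (h : Y -> R) : Cmeas f -> integ mu h -> (forall x, sqn (f x) <= h x) -> L2 f.
Proof.
move=> mf ih fh; split => //; apply: (integ_le _ ih); first exact: measurable_sqn.
by move=> x; rewrite ger0_norm ?sqn_ge0.
Qed.

Lemma L2D f g : L2 f -> L2 g -> L2 (fun x => f x + g x).
Proof.
move=> [mf if_] [mg ig]; apply: (@L2_le _ (fun x => 2 * sqn (f x) + 2 * sqn (g x))).
- exact: CmeasD.
- by apply: integD; exact: integZl.
- by move=> x; exact: sqnD_le2.
Qed.

Lemma L2Z (c : R[i]) f : L2 f -> L2 (fun x => c * f x).
Proof.
move=> [mf if_]; split; first by apply: CmeasM => //; exact: Cmeas_cst.
by under eq_fun do rewrite sqnM; exact: integZl.
Qed.

Lemma L2N f : L2 f -> L2 (fun x => - f x).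
Proof.
by move=> [mf if_]; split; [exact: CmeasN|under eq_fun do rewrite sqnN].
Qed.

Lemma L2B f g : L2 f -> L2 g -> L2 (fun x => f x - g x).
Proof. by move=> lf lg; apply: L2D => //; exact: L2N. Qed.

Lemma L2_conj f : L2 f -> L2 (fun x => conjc (f x)).
Proof.
by move=> [mf if_]; split; [exact: Cmeas_conj|under eq_fun do rewrite sqn_conj].
Qed.

Lemma L2_0 : L2 (cst 0).
Proof.
split; first exact: Cmeas_cst.
by rewrite (_ : (fun _ => _) = cst 0); [exact: integ0|apply/funext => x; rewrite sqn0].
Qed.

Lemma L2_sum I (s : seq I) (F : I -> Y -> R[i]) :
  (forall i, L2 (F i)) -> L2 (fun x => \sum_(i <- s) F i x).
Proof.
move=> mF; elim: s => [|i s IH].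
  by under eq_fun do rewrite big_nil; exact: L2_0.
by under eq_fun do rewrite big_cons; exact: L2D.
Qed.

Lemma L2_mulB (h f : Y -> R[i]) : Cmeas h -> (forall x, sqn (h x) <= 1) -> L2 f ->
  L2 (fun x => h x * f x).
Proof.
move=> mh h1 [mf lf]; apply: (L2_le _ lf); first exact: CmeasM.
by move=> x; rewrite sqnM ler_piMl ?sqn_ge0.
Qed.

Lemma L2_Cinteg_mul f g : L2 f -> L2 g -> Cinteg mu (fun x => f x * g x).
Proof.
move=> [mf lf] [mg lg].
apply: (@Cinteg_le _ _ _ _ _ (fun x => 2^-1 * (sqn (f x) + sqn (g x)))).
- exact: CmeasM.
- by apply: integZl; exact: integD.
- by move=> x; rewrite Normc.normcM [leRHS]mulrC normcM_le.
Qed.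

Lemma L2_ip f g : L2 f -> L2 g -> Cinteg mu (fun x => f x * conjc (g x)).
Proof. by move=> lf lg; apply: L2_Cinteg_mul => //; exact: L2_conj. Qed.

Lemma ipff f : ip f f = (nsq f)%:C.
Proof. by rewrite -Cintegral_real; apply: eq_Cintegral => x; exact: mul_conj. Qed.

Lemma ip_conj f g : L2 f -> L2 g -> ip g f = conjc (ip f g).
Proof.
move=> lf lg; rewrite -Cintegral_conj; last exact: L2_ip.
by apply: eq_Cintegral => x; rewrite conjcM conjcK mulrC.
Qed.

Lemma ipZl c f g : L2 f -> L2 g -> ip (fun x => c * f x) g = c * ip f g.
Proof.
move=> lf lg; rewrite -CintegralZl; last exact: L2_ip.
by apply: eq_Cintegral => x; rewrite mulrA.
Qed.

Lemma ip_suml I (s : seq I) (F : I -> Y -> R[i]) g :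
  (forall i, L2 (F i)) -> L2 g -> ip (fun x => \sum_(i <- s) F i x) g = \sum_(i <- s) ip (F i) g.
Proof.
move=> lF lg; rewrite -Cintegral_sum; last by move=> i; exact: L2_ip.
by apply: eq_Cintegral => x; rewrite mulr_suml.
Qed.

Lemma le_nsq f g : L2 f -> L2 g -> (forall x, sqn (f x) <= sqn (g x)) -> nsq f <= nsq g.
Proof. by move=> [_ lf] [_ lg] fg; exact: le_integ. Qed.

Lemma eq_nsq f g : (forall x, sqn (f x) = sqn (g x)) -> nsq f = nsq g.
Proof. by move=> fg; apply: eq_Rintegral => x _. Qed.

Lemma nsqN f : nsq (fun x => - f x) = nsq f.
Proof. by apply: eq_nsq => x; rewrite sqnN. Qed.

Lemma nsqZ c f : L2 f -> nsq (fun x => c * f x) = sqn c * nsq f.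
Proof.
by move=> [_ lf]; rewrite /nsq; under eq_Rintegral do rewrite sqnM; exact: RintegralZl.
Qed.

Lemma nsqD_le t f g : 0 < t -> L2 f -> L2 g ->
  nsq (fun x => f x + g x) <= (1 + t) * nsq f + (1 + t^-1) * nsq g.
Proof.
move=> t0 lf lg; have [_ lfg] := L2D lf lg; case: lf lg => mf lf [mg lg].
have iZ (k : R) h : integ mu h -> mu.-integrable setT (EFin \o (fun x => k * h x)).
  by move=> ih; exact: integZl.
rewrite /nsq -!RintegralZl// -RintegralD//; try exact: iZ.
apply: le_integ => //; first by apply: integD; exact: integZl.
by move=> x; exact: sqnD_le.
Qed.

Lemma nsqD_le2 f g : L2 f -> L2 g -> nsq (fun x => f x + g x) <= 2 * nsq f + 2 * nsq g.
Proof. by move=> lf lg; have := nsqD_le ltr01 lf lg; rewrite invr1. Qed.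

Lemma parallelogram f g : L2 f -> L2 g ->
  nsq (fun x => f x + g x) + nsq (fun x => f x - g x) = 2 * nsq f + 2 * nsq g.
Proof.
move=> lf lg; have [_ ld] := L2D lf lg; have [_ lb] := L2B lf lg.
case: lf lg => mf lf [mg lg].
have iZ (k : R) h : integ mu h -> mu.-integrable setT (EFin \o (fun x => k * h x)).
  by move=> ih; exact: integZl.
rewrite /nsq -!RintegralZl// -!RintegralD//; try exact: iZ.
by apply: eq_Rintegral => x _; rewrite /sqn !ReImE; ring.
Qed.

(** Minkowski's inequality is [nsqD_le] optimised in the weight, [t = b / a] for the norms [a] and
    [b]. Adding [e / 2] to both keeps the quotient meaningful when a norm vanishes. *)
Lemma nsq_triangle f g : L2 f -> L2 g ->
  Num.sqrt (nsq (fun x => f x + g x)) <= Num.sqrt (nsq f) + Num.sqrt (nsq g).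
Proof.
move=> lf lg; apply/ler_addgt0Pr => e e0.
set a := Num.sqrt (nsq f); set b := Num.sqrt (nsq g).
have a0 : 0 <= a by exact: sqrtr_ge0.
have b0 : 0 <= b by exact: sqrtr_ge0.
have a2 : nsq f = a ^+ 2 by rewrite sqr_sqrtr ?nsq_ge0.
have b2 : nsq g = b ^+ 2 by rewrite sqr_sqrtr ?nsq_ge0.
have abe : 0 <= a + b + e by rewrite !addr_ge0// ltW.
rewrite -[leRHS]ger0_norm// -[leRHS]sqrtr_sqr ler_sqrt ?sqr_ge0//.
have ae0 : 0 < a + e / 2 by rewrite ltr_wpDl// divr_gt0.
have be0 : 0 < b + e / 2 by rewrite ltr_wpDl// divr_gt0.
apply: le_trans (nsqD_le (divr_gt0 be0 ae0) lf lg) _.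
rewrite a2 b2 invf_div.
have -> : 1 + (b + e / 2) / (a + e / 2) = (a + b + e) / (a + e / 2).
  by field; rewrite gt_eqF//; move: ae0; lra.
have -> : 1 + (a + e / 2) / (b + e / 2) = (a + b + e) / (b + e / 2).
  by field; rewrite gt_eqF//; move: be0; lra.
have -> : (a + b + e) ^+ 2 = (a + b + e) / (a + e / 2) * (a + e / 2) ^+ 2 +
    (a + b + e) / (b + e / 2) * (b + e / 2) ^+ 2.
  by field; apply/andP; split; rewrite gt_eqF//; move: ae0 be0; lra.
by apply: lerD; rewrite ler_wpM2l ?divr_ge0 ?(ltW ae0) ?(ltW be0)// ler_pXn2r ?nnegrE ?lerDl ?divr_ge0 ?(ltW ae0) ?(ltW be0) ?(ltW e0).
Qed.

Lemma nsqB_ip f g : L2 f -> L2 g ->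
  nsq (fun x => f x - g x) = nsq f + nsq g - 2 * Re (ip f g).
Proof.
move=> lf lg; have [ii _] := L2_ip lf lg; have [_ lb] := L2B lf lg.
case: lf lg => mf lf [mg lg].
rewrite /nsq /= -RintegralZl// -RintegralD// -RintegralB//; last 2 first.
- exact: integD.
- exact: integZl.
by apply: eq_Rintegral => x _; rewrite /sqn !ReImE; ring.
Qed.

Definition orthonormal_fam (I : eqType) (e : I -> Y -> R[i]) :=
  (forall i, L2 (e i)) /\ forall i j, ip (e i) (e j) = (i == j)%:R.

Lemma ip_orthonormal_sum (I : finType) (e : I -> Y -> R[i]) (c : I -> R[i]) j :
  orthonormal_fam e -> ip (fun x => \sum_i c i * e i x) (e j) = c j.
Proof.
move=> [le oe]; rewrite (@ip_suml _ _ (fun i x => c i * e i x))//; last by move=> i; exact: L2Z.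
rewrite (bigD1 j)//= big1 ?addr0 => [|i ij]; rewrite ipZl// oe ?eqxx ?mulr1//.
by rewrite (negbTE ij) mulr0.
Qed.

Lemma ip_orthonormal_sums (I : finType) (e : I -> Y -> R[i]) (c b : I -> R[i]) :
  orthonormal_fam e -> ip (fun x => \sum_i c i * e i x) (fun x => \sum_i b i * e i x) =
    \sum_i c i * conjc (b i).
Proof.
move=> oe; have le := oe.1.
have lS (a : I -> R[i]) : L2 (fun x => \sum_i a i * e i x).
  by apply: (@L2_sum _ _ (fun i x => a i * e i x)) => i; exact: L2Z.
rewrite ip_conj// (@ip_suml _ _ (fun i x => b i * e i x))//; last by move=> i; exact: L2Z.
rewrite (big_morph _ (@conjcD R) (conjc0 R)); apply: eq_bigr => i _.
by rewrite ipZl// ip_conj// ip_orthonormal_sum// conjcM conjcK mulrC.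
Qed.

Lemma nsq_orthonormal_sum (I : finType) (e : I -> Y -> R[i]) (c : I -> R[i]) :
  orthonormal_fam e -> nsq (fun x => \sum_i c i * e i x) = \sum_i sqn (c i).
Proof.
move=> oe; apply: (@complexI R); rewrite -ipff ip_orthonormal_sums//.
rewrite (big_morph _ (@real_complexD R) (erefl _)).
by apply: eq_bigr => i _; rewrite mul_conj.
Qed.

Lemma bessel (I : finType) (e : I -> Y -> R[i]) g :
  orthonormal_fam e -> L2 g -> \sum_i sqn (ip g (e i)) <= nsq g.
Proof.
move=> oe lg; have le := oe.1.
pose c i := ip g (e i).
have lS : L2 (fun x => \sum_i c i * e i x).
  by apply: (@L2_sum _ _ (fun i x => c i * e i x)) => i; exact: L2Z.
have := nsq_ge0 (fun x => g x - \sum_i c i * e i x).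
rewrite nsqB_ip// nsq_orthonormal_sum//.
rewrite ip_conj// Re_conj (@ip_suml _ _ (fun i x => c i * e i x))//; last by move=> i; exact: L2Z.
rewrite Re_sum.
rewrite (_ : \sum_i Re _ = \sum_i sqn (c i)); first by move=> ?; lra.
apply: eq_bigr => i _; rewrite ipZl// ip_conj//.
by rewrite -/(c i) mul_conj.
Qed.

End L2_space.

(** * Fubini's theorem for complex functions *)

Section complex_fubini.
Variables (R : realType) (d1 d2 : measure_display).
Variables (Y1 : measurableType d1) (Y2 : measurableType d2).
Variables (m1 : {sigma_finite_measure set Y1 -> \bar R}).
Variables (m2 : {sigma_finite_measure set Y2 -> \bar R}).

Lemma integ_dom_prod (g h : Y1 * Y2 -> R) : measurable_fun setT g -> measurable_fun setT h ->
  (forall z, `|g z| <= h z) ->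
  (\int[m1]_x \int[m2]_y (h (x, y))%:E < +oo)%E -> integ (m1 \x m2)%E g.
Proof.
move=> mg mh gh hoo; apply: (@integ_le _ _ _ _ _ h) => //.
have h0 z : 0 <= h z by apply: le_trans (gh z).
apply: ge0_integP => //.
by rewrite fubini_tonelli1//; exact/measurable_EFinP.
Qed.

(** Positive and negative parts are handled by Tonelli, so the sections may have infinite integrals;
    there [fine] returns a default value, and it is a measurable map. *)
Lemma measurable_Rintegral_prod (g : Y1 * Y2 -> R) : measurable_fun setT g ->
  measurable_fun setT (fun x => \int[m2]_y g (x, y)).
Proof.
move=> mg; have mE : measurable_fun setT (EFin \o g) by exact/measurable_EFinP.
have mp : measurable_fun setT (fun x => \int[m2]_y ((EFin \o g)^\+ (x, y)))%E.
  apply: (measurable_fun_fubini_tonelli_F (EFin \o g)^\+%E) => //.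
  exact: measurable_funepos.
have mn : measurable_fun setT (fun x => \int[m2]_y ((EFin \o g)^\- (x, y)))%E.
  apply: (measurable_fun_fubini_tonelli_F (EFin \o g)^\-%E) => //.
  exact: measurable_funeneg.
rewrite (_ : (fun x => _) = fine \o (fun x => \int[m2]_y ((EFin \o g)^\+ (x, y)) -
    \int[m2]_y ((EFin \o g)^\- (x, y)))%E); last first.
  apply/funext => x; rewrite /Rintegral integralE /=.
  congr (fine (_ - _)%E); apply: eq_integral => y _; by rewrite ?funeposE ?funenegE.
apply: (@measurableT_comp _ _ _ _ _ _ (fine : \bar R -> R)); first exact: fine_measurable.
exact: emeasurable_funB.
Qed.

Lemma Cmeas_Cintegral_prod (f : Y1 * Y2 -> R[i]) : Cmeas f ->
  Cmeas (fun x => Cintegral m2 (fun y => f (x, y))).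
Proof.
by move=> [f1 f2]; split => /=; exact: (measurable_Rintegral_prod (g := fun z => _ (f z))).
Qed.

(** Integrability of every section, not merely almost every one, identifies the inner real integrals
    with the extended ones at each point. *)
Lemma Rintegral_fubini (g : Y1 * Y2 -> R) : integ (m1 \x m2)%E g ->
  (forall x, integ m2 (fun y => g (x, y))) -> (forall y, integ m1 (fun x => g (x, y))) ->
  \int[m1]_x \int[m2]_y g (x, y) = \int[m2]_y \int[m1]_x g (x, y).
Proof.
move=> ig i1 i2; rewrite {1}/Rintegral [in RHS]/Rintegral; congr fine.
under eq_integral do rewrite -integ_fineK//.
under [in RHS]eq_integral do rewrite -integ_fineK//.
exact: (Fubini ig).
Qed.

Lemma Cintegral_fubini (f : Y1 * Y2 -> R[i]) : Cinteg (m1 \x m2)%E f ->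
  (forall x, Cinteg m2 (fun y => f (x, y))) -> (forall y, Cinteg m1 (fun x => f (x, y))) ->
  Cintegral m1 (fun x => Cintegral m2 (fun y => f (x, y))) =
  Cintegral m2 (fun y => Cintegral m1 (fun x => f (x, y))).
Proof.
move=> [f1 f2] i1 i2; rewrite /Cintegral /=.
rewrite (Rintegral_fubini (g := fun z => Re (f z)))//; last 2 first.
- by move=> x; case: (i1 x).
- by move=> x; case: (i2 x).
rewrite (Rintegral_fubini (g := fun z => Im (f z)))//.
- by move=> x; case: (i1 x).
- by move=> x; case: (i2 x).
Qed.

Lemma integ_Rintegral_prod (g : Y1 * Y2 -> R) : integ (m1 \x m2)%E g ->
  (forall x, integ m2 (fun y => g (x, y))) -> integ m1 (fun x => \int[m2]_y g (x, y)).
Proof.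
move=> ig i1; have := integrable_fubini_F ig; apply: eq_integrable => // x _ /=.
by rewrite -integ_fineK.
Qed.

End complex_fubini.

(** * Affine changes of variable, from the line to completed Lebesgue measure *)

Section lebesgue_affine.
Variable R : realType.
Local Notation RB := (measurableTypeR R).
Local Notation mu1 := (@lebesgue_measure R).

Lemma measurable_affine (r c : R) : measurable_fun setT ((fun x : RB => r * x + c) : RB -> RB).
Proof.
apply: (@measurable_funD _ RB R setT (fun x => r * x) (cst c)); last exact: measurable_cst.
exact: mulrl_measurable.
Qed.

(** By uniqueness of Lebesgue measure: the pushforward multiplied by [r] agrees with it on half-open
    intervals. *)
Lemma lebesgue_measure_affine (r c : R) (A : set RB) : 0 < r -> measurable A ->
  mu1 ((fun x : RB => r * x + c : RB) @^-1` A) = ((r^-1)%:E * mu1 A)%E.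
Proof.
move=> r0 mA; pose phi := (fun x : RB => r * x + c : RB).
have mphi : measurable_fun setT phi by exact: measurable_affine.
pose m := mscale (NngNum (ltW r0)) (pushforward mu1 phi).
have -> : mu1 A = m mphi A.
  apply: (@lebesgue_measure_unique R (m mphi)) => // _ [[a b] _ <-] /=.
  rewrite /mscale /= /pushforward.
  have -> : phi @^-1` `]a, b]%classic = `](a - c) / r, (b - c) / r]%classic.
    apply/seteqP; split=> x /=; rewrite !in_itv/= ltr_pdivrMr// ler_pdivlMr// mulrC ltrBlDr lerBrDr//.
  rewrite !lebesgue_measure_itv/= !lte_fin ltr_pM2r ?invr_gt0// ltrD2r.
  case: ifPn => _; last by rewrite mule0.
  rewrite -!EFinD -EFinM; congr EFin; field.
  by rewrite gt_eqF.
by rewrite /m /mscale /= muleA -EFinM mulVf ?gt_eqF// mul1e.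
Qed.

Lemma ge0_integral_affine1 (r c : R) (g : RB -> \bar R) : 0 < r ->
  measurable_fun setT g -> (forall x, 0 <= g x)%E ->
  (\int[mu1]_x g (r * x + c)%R = (r^-1)%:E * \int[mu1]_x g x)%E.
Proof.
move=> r0 mg g0; pose phi := (fun x : RB => r * x + c : RB).
have rV0 : 0 <= r^-1 by rewrite invr_ge0 ltW.
rewrite -(@ge0_integral_mscale _ RB R mu1 setT measurableT (NngNum rV0) g)//.
have mphi : measurable_fun setT phi by exact: measurable_affine.
rewrite -[LHS](@ge0_integral_pushforward _ _ RB RB R phi mphi mu1 setT g)//.
apply: eq_measure_integral => A mA _ /=.
by rewrite /mscale /= /pushforward /= lebesgue_measure_affine.
Qed.

End lebesgue_affine.

Section lebesgue_borel_integrals.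
Variable R : realType.
Local Notation RB := (measurableTypeR R).
Local Notation mu1 := (@lebesgue_measure R).
Local Notation LB := (@lebesgue_borel R).

Lemma ge0_integral_borelS n (g : 'rV[R]_n.+1 -> \bar R) :
  measurable_fun setT g -> (forall x, 0 <= g x)%E ->
  (\int[LB n.+1]_x g x = \int[mu1]_a \int[LB n]_v g (rV_cons (a, v)))%E.
Proof.
move=> mg g0.
have mc := @measurable_rV_cons R n.
transitivity (\int[(mu1 \x LB n)%E]_z g (rV_cons z))%E.
  exact: (@ge0_integral_pushforward _ _ _ _ R _ mc (mu1 \x LB n)%E setT g).
rewrite (fubini_tonelli1 (fun z => g (rV_cons z)))//.
exact: (measurableT_comp mg mc).
Qed.

Lemma measurable_section_borelS n (g : 'rV[R]_n.+1 -> \bar R) :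
  measurable_fun setT g -> (forall x, 0 <= g x)%E ->
  measurable_fun setT ((fun a => \int[LB n]_v g (rV_cons (a, v))) : RB -> \bar R)%E.
Proof.
move=> mg g0.
apply: (measurable_fun_fubini_tonelli_F (fun z => g (rV_cons z))) => //.
exact: (measurableT_comp mg (@measurable_rV_cons R n)).
Qed.

Definition affine n (r : R) (c : 'rV[R]_n) (x : 'rV[R]_n) : 'rV[R]_n := r *: x + c.

Lemma measurable_affine_rV n (r : R) (c : 'rV[R]_n) : measurable_fun setT (affine r c).
Proof.
apply: measurable_fun_rV => i; under eq_fun do rewrite !mxE.
apply: measurable_funD; last exact: measurable_cst.
apply: measurable_funM; first exact: measurable_cst.
exact: measurable_rV_coor.
Qed.

Lemma affine_cons n (r : R) (c : 'rV[R]_n.+1) a v :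
  affine r c (rV_cons (a, v)) =
  rV_cons (r * a + c 0 ord0, affine r (\row_i c 0 (lift ord0 i)) v).
Proof.
apply/rowP => i; rewrite !mxE /=.
by case: unliftP => [j ->|->] /=; rewrite ?mxE.
Qed.

Lemma ge0_integral_affine_borel n (r : R) (c : 'rV[R]_n) (g : 'rV[R]_n -> \bar R) : 0 < r ->
  measurable_fun setT g -> (forall x, 0 <= g x)%E ->
  (\int[LB n]_x g (affine r c x) = (r ^- n)%:E * \int[LB n]_x g x)%E.
Proof.
move=> r0; elim: n c g => [|n IH] c g mg g0.
  rewrite expr0 invr1 mul1e; apply: eq_integral => x _; congr (g _).
  by apply/rowP => -[].
rewrite ge0_integral_borelS//; last exact: (measurableT_comp mg (measurable_affine_rV r c)).
under eq_integral => a _.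
  under eq_integral do rewrite affine_cons.
  rewrite (IH _ (fun v => g (rV_cons (r * a + c 0 ord0, v))))//; last first.
    apply: (measurableT_comp mg); apply: (measurableT_comp (@measurable_rV_cons R n)).
    exact: pair1_measurable.
  over.
rewrite ge0_integralZl//; last 3 first.
- have := @measurable_affine R r (c 0 ord0).
  exact: (measurableT_comp (measurable_section_borelS mg g0)).
- by move=> a _; exact: integral_ge0.
- by rewrite lee_fin invr_ge0 exprn_ge0// ltW.
rewrite (@ge0_integral_affine1 _ r (c 0%R ord0) (fun a => \int[LB n]_v g (rV_cons (a, v)))%E)//; last 2 first.
- exact: measurable_section_borelS.
- by move=> a; exact: integral_ge0.
by rewrite muleA -EFinM -invfM -exprSr ge0_integral_borelS.
Qed.

Lemma lebesgue_borel_affine n (r : R) (c : 'rV[R]_n) (A : set 'rV[R]_n) : 0 < r ->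
  measurable A -> (LB n (affine r c @^-1` A) = (r ^- n)%:E * LB n A)%E.
Proof.
move=> r0 mA; have mB : measurable (affine r c @^-1` A).
  by rewrite -[X in measurable X]setTI; exact: measurable_affine_rV.
have iE (B : set 'rV[R]_n) : measurable B -> LB n B = (\int[LB n]_x (\1_B x)%:E)%E.
  by move=> mB'; rewrite integral_indic// setIT.
rewrite !iE// -(@ge0_integral_affine_borel n r c (fun x => (\1_A x)%:E))//.
  by apply/measurable_EFinP; exact: measurable_indic.
Qed.

Lemma affineK n (r : R) (c : 'rV[R]_n) : r != 0 ->
  cancel (affine r c) (affine r^-1 (- (r^-1 *: c))).
Proof.
by move=> r0 x; rewrite /affine scalerDr scalerA mulVf// scale1r addrK.
Qed.

Lemma affineVK n (r : R) (c : 'rV[R]_n) : r != 0 ->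
  cancel (affine r^-1 (- (r^-1 *: c))) (affine r c).
Proof.
by move=> r0 x; rewrite /affine scalerBr !scalerA mulfV// !scale1r subrK.
Qed.

Local Open Scope ereal_scope.

(** Countable Borel covers pull back to covers of the preimage. The outer measure is used so that
    the scaling holds for arbitrary sets, which are the test sets of Caratheodory's condition. *)
Let mu_ext_affine_le n (r : R) (c : 'rV[R]_n) (A : set 'rV[R]_n) : (0 < r)%R ->
  (LB n)^*%mu (affine r c @^-1` A) <= (r ^- n)%:E * (LB n)^*%mu A.
Proof.
move=> r0.
have rn0 : (0 < r ^+ n)%R by rewrite exprn_gt0.
rewrite -lee_pdivrMl ?invr_gt0// invrK.
apply: le_ereal_inf_tmp => _ [F [mF AF] <-].
rewrite -lee_pdivlMl// -nneseriesZl; last by move=> i _.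
apply: ereal_inf_lbound; exists (fun k => affine r c @^-1` F k).
  split; first by move=> i; rewrite -[X in measurable X]setTI; exact: measurable_affine_rV.
  by rewrite -preimage_bigcup; exact: preimage_subset.
by apply: eq_eseriesr => i _; rewrite lebesgue_borel_affine.
Qed.

Lemma mu_ext_affine n (r : R) (c : 'rV[R]_n) (A : set 'rV[R]_n) : (0 < r)%R ->
  (LB n)^*%mu (affine r c @^-1` A) = (r ^- n)%:E * (LB n)^*%mu A.
Proof.
move=> r0; apply/eqP; rewrite eq_le mu_ext_affine_le//=.
have rn0 : (0 < r ^+ n)%R by rewrite exprn_gt0.
have rV0 : (0 < r^-1)%R by rewrite invr_gt0.
(* The reverse inequality is the same bound for the inverse affine map. *)
have := @mu_ext_affine_le n r^-1 (- (r^-1 *: c))%R (affine r c @^-1` A) rV0.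
rewrite -comp_preimage (_ : _ \o _ = id); last first.
  by apply/funext => x /=; rewrite affineVK// gt_eqF.
rewrite preimage_id exprVn invrK => h.
by rewrite lee_pdivrMl.
Qed.

End lebesgue_borel_integrals.

(** Since [psi] is a left inverse of [phi], every test set is a preimage under [phi]; the splitting
    identity required is then that of [A] multiplied by [k]. *)
Lemma caratheodory_preimage (R : realType) (T : Type) (m : set T -> \bar R) (k : R)
    (phi psi : T -> T) (A : set T) : (forall B, m (phi @^-1` B) = k%:E * m B)%E ->
  (forall B, 0 <= m B)%E -> cancel phi psi ->
  m.-caratheodory A -> m.-caratheodory (phi @^-1` A).
Proof.
move=> mphi m0 phiK mA Z; have -> : Z = phi @^-1` (psi @^-1` Z).
  by apply/seteqP; split => x /=; rewrite phiK.
by rewrite preimage_setC -!preimage_setI !mphi [in LHS]mA ge0_muleDr.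
Qed.

Section Lebesgue_rV.
Variables (R : realType) (d : nat).
Local Notation LB := (@lebesgue_borel R).
Local Notation X := (lebesgue_rV R d).
Local Notation leb := (@Leb R d).

Lemma borel_Lebesgue_measurable (A : set 'rV[R]_d) : measurable A -> Lebesgue_measurable A.
Proof. by move=> mA; exact: caratheodory_measurable_mu_ext. Qed.

Lemma Leb_borel (A : set 'rV[R]_d) : measurable A -> leb A = LB d A.
Proof. by move=> mA; rewrite -[RHS]measurable_mu_extE. Qed.

Definition to_borel (x : X) : 'rV[R]_d := x.

Lemma measurable_to_borel : measurable_fun setT to_borel.
Proof. by move=> _ A mA; rewrite setTI; exact: borel_Lebesgue_measurable. Qed.

Definition affineX (r : R) (c : 'rV[R]_d) (x : X) : X := affine r c x.

Lemma Leb_affine (r : R) (c : 'rV[R]_d) (A : set X) : 0 < r ->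
  (leb (affineX r c @^-1` A) = (r ^- d)%:E * leb A)%E.
Proof. by move=> r0; exact: mu_ext_affine. Qed.

Lemma measurable_affineX (r : R) (c : 'rV[R]_d) : 0 < r ->
  measurable_fun setT (affineX r c).
Proof.
move=> r0 _ A mA; rewrite setTI.
have rn0 : r != 0 by rewrite gt_eqF.
have h1 (B : set 'rV[R]_d) := mu_ext_affine c B r0.
have h2 (B : set 'rV[R]_d) : (0 <= (LB d)^*%mu B)%E by exact: mu_ext_ge0.
have h3 : ((LB d)^*%mu).-caratheodory (A : set 'rV[R]_d) by exact: mA.
exact: (caratheodory_preimage h1 h2 (affineK c rn0) h3).
Qed.

Lemma dilateE (r : R) (T : set 'rV[R]_d) : 0 < r -> dilate r T = affine r^-1 0 @^-1` T.
Proof.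
move=> r0; have rn0 : r != 0 by rewrite gt_eqF.
apply/seteqP; split => [_ [t Tt <-]|x Tx] /=.
  by rewrite /affine scalerA mulVf// scale1r addr0.
by exists (affine r^-1 0 x) => //; rewrite /affine addr0 scalerA mulfV// scale1r.
Qed.

Lemma Lebesgue_measurable_dilate (r : R) (T : set 'rV[R]_d) : 0 < r ->
  Lebesgue_measurable T -> Lebesgue_measurable (dilate r T).
Proof.
move=> r0 mT; rewrite dilateE//.
have rV0 : 0 < r^-1 by rewrite invr_gt0.
by have := measurable_affineX 0 rV0 (@measurableT _ X) mT; rewrite setTI.
Qed.

Lemma Leb_dilate (r : R) (T : set 'rV[R]_d) : 0 < r ->
  (leb (dilate r T) = (r ^+ d)%:E * leb T)%E.
Proof. by move=> r0; rewrite dilateE// Leb_affine ?invr_gt0// exprVn invrK. Qed.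

(** A Borel hull: intersect countable Borel covers whose total measure exceeds that of [A] by at
    most [1 / (n + 1)]. It reduces statements on Lebesgue measurable sets to Borel sets, for which
    shifts are jointly measurable. *)
Lemma Leb_regular (A : set X) : measurable A -> (leb A < +oo)%E ->
  exists B : set 'rV[R]_d, [/\ measurable B, A `<=` to_borel @^-1` B &
    leb (to_borel @^-1` B `\` A) = 0%E].
Proof.
move=> mA fA.
have fA' : leb A \is a fin_num by rewrite ge0_fin_numE// measure_ge0.
have [B hB] : {B : nat -> set 'rV[R]_d & forall n, [/\ measurable (B n), A `<=` to_borel @^-1` B n &
    (LB d (B n) <= leb A + (n.+1%:R^-1)%:E)%E]}.
  apply: (@choice _ _ (fun n B => [/\ measurable B, A `<=` to_borel @^-1` B &
    (LB d B <= leb A + (n.+1%:R^-1)%:E)%E])) => n.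
  have n0 : 0 < n.+1%:R^-1 :> R by rewrite invr_gt0.
  have [_ [F [mF AF] <-] hF] := lb_ereal_inf_adherent n0 fA'.
  exists (\bigcup_k F k); split; [exact: bigcupT_measurable|exact: AF|].
  apply: (@le_trans _ _ (\sum_(k <oo) LB d (F k))%E); last exact: (ltW hF).
  by apply: measure_sigma_subadditive; [exact: mF|exact: bigcupT_measurable|].
exists (\bigcap_n B n).
have mB : measurable (\bigcap_n B n) by apply: bigcapT_measurable => n; case: (hB n).
have AB : A `<=` to_borel @^-1` (\bigcap_n B n) by move=> x Ax n _; case: (hB n) => _ h _; exact: h.
split; [exact: mB|exact: AB|].
have mB' : measurable (to_borel @^-1` (\bigcap_n B n)) by exact: borel_Lebesgue_measurable.
have leBA : (leb (to_borel @^-1` (\bigcap_n B n)) <= leb A)%E.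
  rewrite [leLHS](Leb_borel mB).
  apply/lee_addgt0Pr => e e0.
  (* With this [n], [n + 1] exceeds [1 / e], so the excess of the cover is below [e]. *)
  pose n := Num.truncn e^-1.
  have [mBn _ hn] := hB n.
  apply: (@le_trans _ _ (LB d (B n))).
    apply: le_measure; rewrite ?inE; [exact: mB|exact: mBn|].
    by move=> x; apply.
  apply: (le_trans hn); apply: leeD; first exact: lexx.
  rewrite lee_fin; apply: ltW; rewrite invf_plt ?posrE//.
  exact: truncnS_gt.
have fB : (leb (to_borel @^-1` (\bigcap_n B n)) < +oo)%E by exact: le_lt_trans leBA fA.
rewrite measureD; [|exact: mB'|exact: mA|exact: fB].
have -> : to_borel @^-1` (\bigcap_n B n) `&` A = A by apply/setIidr.
apply/eqP; rewrite eq_le sube_le0 leBA sube_ge0 ?fA' ?orbT//.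
by apply: le_measure; rewrite ?inE; [exact: mA|exact: mB'|exact: AB].
Qed.

End Lebesgue_rV.

(* Completed Lebesgue measure as an interface: ls_val and ls_pt identify the carrier
   with R^d.  The abstraction keeps terms from being unfolded down to Caratheodory
   measurability. *)
Record lebesgue_space (R : realType) (d : nat) := LebesgueSpace {
  ls_display : measure_display;
  ls_sort : measurableType ls_display;
  ls_mu : {sigma_finite_measure set ls_sort -> \bar R};
  ls_val : ls_sort -> 'rV[R]_d;
  ls_pt : 'rV[R]_d -> ls_sort;
  ls_valK : cancel ls_val ls_pt;
  ls_ptK : cancel ls_pt ls_val;
  measurable_ls_val : measurable_fun setT ls_val;
  ls_borel : forall A, measurable A -> ls_mu (ls_val @^-1` A) = lebesgue_borel R d A;
  measurable_ls_affine : forall r c, 0 < r ->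
    measurable_fun setT (fun x => ls_pt (affine r c (ls_val x)));
  ls_affine : forall r c (A : set ls_sort), 0 < r -> measurable A ->
    ls_mu ((fun x => ls_pt (affine r c (ls_val x))) @^-1` A) = ((r ^- d)%:E * ls_mu A)%E;
  ls_regular : forall A, measurable A -> (ls_mu A < +oo)%E ->
    exists B, [/\ measurable B, A `<=` ls_val @^-1` B & ls_mu (ls_val @^-1` B `\` A) = 0%E] }.

Definition Leb_space (R : realType) (d : nat) : lebesgue_space R d :=
  @LebesgueSpace R d _ (lebesgue_rV R d) (@Leb R d) (@to_borel R d) (fun x => x)
    (fun x => erefl) (fun x => erefl) (@measurable_to_borel R d) (@Leb_borel R d)
    (@measurable_affineX R d) (fun r c A r0 _ => @Leb_affine R d r c A r0) (@Leb_regular R d).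

(** * Integrals of products of functions of one coordinate *)

Section product_functions.
Variable R : realType.
Local Notation LB := (@lebesgue_borel R).
Local Notation RB := (measurableTypeR R).
Local Notation mu1 := (@lebesgue_measure R).

Lemma prod_rV_cons (S : comPzRingType) n (f : 'I_n.+1 -> R -> S) a (v : 'rV[R]_n) :
  \prod_j f j (rV_cons (a, v) 0 j) = f ord0 a * \prod_j f (lift ord0 j) (v 0 j).
Proof.
rewrite big_ord_recl mxE unlift_none /=; congr (_ * _).
by apply: eq_bigr => i _; rewrite mxE liftK.
Qed.

Lemma measurable_prod_coor n (g : 'I_n -> R -> R) :
  (forall j, measurable_fun setT (g j : RB -> R)) ->
  measurable_fun setT (fun x : 'rV[R]_n => \prod_j g j (x 0 j)).
Proof.
move=> mg; have : measurable_fun setT (fun x : 'rV[R]_n => \prod_(j <- index_enum 'I_n) g j (x 0 j)).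
  elim: (index_enum _) => [|j s IH].
    by under eq_fun do rewrite big_nil; exact: measurable_cst.
  under eq_fun do rewrite big_cons.
  by apply: measurable_funM => //; exact: (measurableT_comp (mg j) (@measurable_rV_coor R n j)).
exact.
Qed.

Lemma integral_LB0 (c : R) : (\int[LB 0]_x c%:E = c%:E)%E.
Proof. by rewrite (integral_cst (LB 0) measurableT c%:E)//= diracT mule1. Qed.

Lemma integ_prod_borel n (g : 'I_n -> R -> R) : (forall j x, 0 <= g j x) ->
  (forall j, integ mu1 (g j)) ->
  integ (LB n) (fun x => \prod_j g j (x 0 j)) /\
  \int[LB n]_x \prod_j g j (x 0 j) = \prod_j \int[mu1]_x g j x.
Proof.
move=> + ig; have mg j := integ_measurable (ig j); move: ig mg.
elim: n g => [|n IH] g ig mg g0.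
  have -> : (fun x : 'rV[R]_0 => \prod_j g j (x 0 j)) = cst 1.
    by apply/funext => x; rewrite big_ord0.
  rewrite big_ord0; split.
    by apply: ge0_integP => //; rewrite [ltLHS]integral_LB0 ltry.
  by rewrite /Rintegral integral_LB0.
have [iI eI] := IH (fun j => g (lift ord0 j)) (fun j => ig _) (fun j => mg _) (fun j => g0 _).
have p0 m (h : 'I_m -> R -> R) x : (forall j x, 0 <= h j x) -> 0 <= \prod_j h j (x j).
  by move=> h0; apply: prodr_ge0.
have mp := measurable_prod_coor mg.
have E : (\int[LB n.+1]_x (\prod_j g j (x 0%R j))%:E =
   ((\int[mu1]_x g ord0 x) * (\prod_j \int[mu1]_x g (lift ord0 j) x))%:E)%E.
  rewrite ge0_integral_borelS//; last 2 first.
  - exact/measurable_EFinP.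
  - by move=> x; rewrite lee_fin; exact: (p0 _ g (fun j => x 0 j)).
  under eq_integral => a _.
    under eq_integral do rewrite prod_rV_cons EFinM.
    rewrite ge0_integralZl_EFin//; last 2 first.
    - by move=> x _; rewrite lee_fin; exact: (p0 _ (fun j => g (lift ord0 j)) (fun j => x 0 j)).
    - by apply/measurable_EFinP; exact: integ_measurable iI.
    rewrite integ_fineK// eI muleC.
    over.
  rewrite ge0_integralZl_EFin//; last 3 first.
  - by move=> x _; rewrite lee_fin.
  - by apply/measurable_EFinP.
  - by apply: prodr_ge0 => j _; exact: Rintegral_ge0.
  by rewrite integ_fineK// -EFinM mulrC.
split.
  by apply: ge0_integP => //; [move=> x; exact: (p0 _ g (fun j => x 0 j))|rewrite E ltry].
by rewrite {1}/Rintegral E /= big_ord_recl.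
Qed.

(** Absolute integrability is the nonnegative case applied to the moduli; Fubini then splits off the
    first coordinate. *)
Lemma Cinteg_prod_borel n (f : 'I_n -> R -> R[i]) : (forall j, Cinteg mu1 (f j)) ->
  Cinteg (LB n) (fun x => \prod_j f j (x 0 j)) /\
  Cintegral (LB n) (fun x => \prod_j f j (x 0 j)) = \prod_j Cintegral mu1 (f j).
Proof.
elim: n f => [|n IH] f if_.
  have -> : (fun x : 'rV[R]_0 => \prod_j f j (x 0 j)) = cst 1.
    by apply/funext => x; rewrite big_ord0.
  have i1 : integ (LB 0) (cst 1).
    by apply: ge0_integP => //; rewrite [ltLHS]integral_LB0 ltry.
  rewrite big_ord0; split; first exact: (Cinteg_real i1).
  rewrite (_ : cst 1 = fun x => ((cst 1 : _ -> R) x)%:C)// Cintegral_real.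
  by rewrite /Rintegral integral_LB0.
have [iI eI] := IH (fun j => f (lift ord0 j)) (fun j => if_ _).
have mf j : Cmeas (f j : RB -> R[i]) by exact: Cinteg_meas.
have mp m (h : 'I_m -> R -> R[i]) : (forall j, Cmeas (h j : RB -> R[i])) ->
    Cmeas (fun x : 'rV[R]_m => \prod_j h j (x 0 j)).
  move=> mh; apply: (@Cmeas_prod _ _ _ _ _ (fun j (x : 'rV[R]_m) => h j (x 0 j))) => j.
  exact: (Cmeas_comp (@measurable_rV_coor R m j) (mh j)).
have iF : Cinteg (LB n.+1) (fun x => \prod_j f j (x 0 j)).
  apply: (@Cinteg_le _ _ _ _ _ (fun x : 'rV[R]_n.+1 => \prod_j Normc.normc (f j (x 0 j)))).
  - exact: mp.
  - apply: (integ_prod_borel (g := fun j x => Normc.normc (f j x)) _ _).1 => [j x|j].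
      exact: normc_ge0.
    exact: Cinteg_normc.
  - by move=> x; rewrite normc_prod.
split => //.
have mc := @measurable_rV_cons R n.
pose F (z : RB * 'rV[R]_n) := \prod_j f j (rV_cons z 0 j).
have FE z : F z = f ord0 z.1 * \prod_j f (lift ord0 j) (z.2 0 j).
  by case: z => a v; rewrite -prod_rV_cons.
have iFR : integ (mu1 \x LB n)%E (fun z => Normc.normc (F z)).
  apply: ge0_integP.
  - apply: measurable_normc; exact: (Cmeas_comp mc (mp _ _ mf)).
  - by move=> z; exact: normc_ge0.
  rewrite -(@ge0_integral_pushforward _ _ _ _ R _ mc (mu1 \x LB n)%E setT
     (fun x => (Normc.normc (\prod_j f j (x 0 j)))%:E))//.
  - exact: (integ_lty (Cinteg_normc iF)).
  - by apply/measurable_EFinP; apply: measurable_normc; exact: mp.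
  - by move=> x _; rewrite lee_fin normc_ge0.
have iFC : Cinteg (mu1 \x LB n)%E F.
  by apply: (Cinteg_le _ iFR) => //; exact: (Cmeas_comp mc (mp _ _ mf)).
(* Here [p] stands for the real or the imaginary part, so that real Fubini is invoked through one
   statement. *)
have half (p : R[i] -> R) : integ (LB n.+1) (fun x => p (\prod_j f j (x 0 j))) ->
    integ (mu1 \x LB n)%E (fun z => p (F z)) ->
    (forall a, integ (LB n) (fun v => p (F (a, v)))) ->
    \int[LB n.+1]_x p (\prod_j f j (x 0 j)) = \int[mu1]_a \int[LB n]_v p (F (a, v)).
  move=> i1 i2 i3; rewrite {1}/Rintegral.
  have -> : (\int[LB n.+1]_x (p (\prod_j f j (x 0%R j)))%:E = \int[mu1 \x LB n]_z (p (F z))%:E)%E.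
    apply: (@integral_pushforward _ _ _ _ R _ mc (mu1 \x LB n)%E setT
     (fun x => (p (\prod_j f j (x 0%R j)))%:E)) => //.
    by apply/measurable_EFinP; exact: integ_measurable i1.
  rewrite -(integral12_prod_meas1 i2) {1}/Rintegral; congr fine.
  by apply: eq_integral => a _; rewrite -integ_fineK.
have iS a : Cinteg (LB n) (fun v => F (a, v)).
  by under eq_fun do rewrite FE /=; exact: CintegZl.
rewrite {1}/Cintegral (half _ iF.1 iFC.1)//; last by move=> a; case: (iS a).
rewrite (half _ iF.2 iFC.2)//; last by move=> a; case: (iS a).
transitivity (Cintegral mu1 (fun a => Cintegral (LB n) (fun v => F (a, v)))) => //.
rewrite (@eq_Cintegral _ _ RB _ _ (fun a : RB => (\prod_j Cintegral mu1 (f (lift ord0 j))) * f ord0 a)).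
  by rewrite CintegralZl// big_ord_recl mulrC.
move=> a; rewrite mulrC -eI -CintegralZl//.
by apply: eq_Cintegral => v; rewrite FE.
Qed.

End product_functions.

(** * Explicit integrals on the line: exponential decay, Cauchy density, full periods *)

Section one_dim_integrals.
Variable R : realType.
Local Notation RB := (measurableTypeR R).
Local Notation mu1 := (@lebesgue_measure R).

Lemma ge0_FTC_0y (f F : R -> R) : (forall x, 0 <= x -> 0 <= f x) -> continuous f ->
  (forall x : R, is_derive x (1 : R) F (f x)) -> F x @[x --> +oo] --> 0 ->
  (\int[mu1]_(x in `[0%R, +oo[) (f x)%:E = (- F 0)%:E)%E.
Proof.
move=> f0 cf dF F0.
have cF : continuous F.
  move=> x; apply: differentiable_continuous; apply/derivable1_diffP.
  exact: (@ex_derive _ _ _ _ _ _ _ (dF x)).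
rewrite (@ge0_continuous_FTC2y R f F 0 0)//.
- by rewrite sub0e EFinN.
- exact: continuous_subspaceT.
- by apply: cvg_at_right_filter; exact: cF.
- by move=> x _; rewrite derive1E; exact: (@derive_val _ _ _ _ _ _ _ (dF x)).
Qed.

Lemma is_derive_mull (k x : R) : is_derive x 1 ( *%R k) k.
Proof. by have := is_deriveZ k (@is_derive_id R R x 1); rewrite -[k *: 1]/(k * 1) mulr1. Qed.

Lemma is_derive_expN (x : R) : is_derive x 1 (fun y => expR (- y)) (- expR (- x)).
Proof.
have := @is_derive1_comp R expR -%R x (expR (- x)) (- 1) (is_derive_expR _) _.
by rewrite mulrN1; apply.
Qed.

Lemma is_derive_cosM (k x : R) : is_derive x 1 (fun y => cos (k * y)) (- k * sin (k * x)).
Proof.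
have := @is_derive1_comp R cos ( *%R k) x (- sin (k * x)) k (is_derive_cos _) (is_derive_mull k x).
by rewrite mulrC mulrN -mulNr.
Qed.

Lemma is_derive_sinM (k x : R) : is_derive x 1 (fun y => sin (k * y)) (k * cos (k * x)).
Proof.
have := @is_derive1_comp R sin ( *%R k) x (cos (k * x)) k (is_derive_sin _) (is_derive_mull k x).
by rewrite mulrC.
Qed.

Lemma continuous_mull (k : R) : continuous ( *%R k).
Proof. by move=> x; apply: differentiable_continuous; apply/derivable1_diffP; have [] := is_derive_mull k x. Qed.

Lemma continuous_cosM (k : R) : continuous (fun x : R => cos (k * x)).
Proof. by move=> x; apply: continuous_comp; [exact: continuous_mull|exact: continuous_cos]. Qed.

Lemma continuous_sinM (k : R) : continuous (fun x : R => sin (k * x)).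
Proof. by move=> x; apply: continuous_comp; [exact: continuous_mull|exact: continuous_sin]. Qed.

Lemma continuous_expN : continuous (fun x : R => expR (- x)).
Proof. by move=> x; apply: continuous_comp; [exact: oppr_continuous|exact: continuous_expR]. Qed.

Lemma continuous_expNabs : continuous (fun x : R => expR (- `|x|)).
Proof.
by move=> x; apply: (@continuous_comp _ _ _ (fun y : R => `|y|) (fun y => expR (- y)));
  [exact: norm_continuous|exact: continuous_expN].
Qed.

Lemma cvg_expN_bounded (b : R -> R) (C : R) : (forall x, `|b x| <= C) ->
  (expR (- x) * b x) @[x --> +oo] --> (0 : R).
Proof.
move=> bC; apply: (@squeeze_cvgr _ _ _ _ (fun x => - (expR (- x) * C)) (fun x => expR (- x) * C)).
- near=> x; rewrite -mulrN !ler_pM2l ?expR_gt0//.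
  by have := bC x; rewrite ler_norml.
- rewrite -[X in _ --> X]oppr0 -[X in _ --> - X](mul0r C).
  by apply: cvgN; apply: cvgM; [exact: cvgr_expR|exact: cvg_cst].
- rewrite -[X in _ --> X](mul0r C).
  by apply: cvgM; [exact: cvgr_expR|exact: cvg_cst].
Unshelve. all: by end_near. Qed.

Definition oneD2 (k : R) : 1 + k ^+ 2 != 0.
Proof. by rewrite gt_eqF// ltr_wpDr ?sqr_ge0. Qed.

(** The summand 1 makes the integrand nonnegative, as the fundamental theorem on a half-line
    requires here; it is subtracted again once integrability is known. *)
Lemma integral_expN_cos_half (k : R) :
  (\int[mu1]_(x in `[0%R, +oo[) (expR (- x) * (1 + cos (k * x)))%:E = (1 + (1 + k ^+ 2)^-1)%:E)%E.
Proof.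
(* [exp(-x) b(x)] is an antiderivative: the quotient accounts for the cosine term and [- 1] for the
   bare exponential. *)
pose b x := (k * sin (k * x) - cos (k * x)) / (1 + k ^+ 2) - 1.
have hd x : is_derive x (1 : R) (fun y => expR (- y) * b y) (expR (- x) * (1 + cos (k * x))).
  have dk : is_derive x (1 : R) (fun y => k * sin (k * y) - cos (k * y))
    (k * (k * cos (k * x)) - (- k * sin (k * x))).
    apply: (@is_deriveB _ _ _ (fun y => k * sin (k * y)) (fun y => cos (k * y))).
      exact: (@is_deriveZ _ _ _ (fun y => sin (k * y)) k _ _ _ (is_derive_sinM k x)).
    exact: is_derive_cosM.
  have db : is_derive x (1 : R) b ((1 + k ^+ 2)^-1 * (k * (k * cos (k * x)) - (- k * sin (k * x))) - 0).
    apply: (@is_deriveB _ _ _ (fun y => (k * sin (k * y) - cos (k * y)) / (1 + k ^+ 2)) (cst 1)).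
    rewrite (_ : (fun y => _ / _) = (1 + k ^+ 2)^-1 \*: (fun y => k * sin (k * y) - cos (k * y))).
      exact: (@is_deriveZ _ _ _ _ (1 + k ^+ 2)^-1 _ _ _ dk).
    by apply/funext => y; rewrite mulrC.
  apply: (is_derive_eq (@is_deriveM _ _ (fun y => expR (- y)) b x _ _ _ (is_derive_expN x) db)).
  by rewrite /b /GRing.scale /=; field; exact: oneD2.
have h0 x : 0 <= x -> 0 <= expR (- x) * (1 + cos (k * x)).
  by move=> _; rewrite mulr_ge0 ?expR_ge0// -lerBlDl sub0r cos_geN1.
have hc : continuous (fun x => expR (- x) * (1 + cos (k * x))).
  move=> x; apply: cvgM; first exact: continuous_expN.
  by apply: cvgD; [exact: cvg_cst|exact: continuous_cosM].
rewrite (ge0_FTC_0y h0 hc hd).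
  by rewrite /b mulr0 sin0 cos0 oppr0 expR0; congr (_%:E); rewrite mulr0 sub0r mulN1r; ring.
apply: (@cvg_expN_bounded _ ((`|k| + 1) / (1 + k ^+ 2) + 1)) => x.
have k0 : 0 < 1 + k ^+ 2 by rewrite ltr_wpDr ?sqr_ge0.
apply: le_trans (ler_normB _ _) _; rewrite normr1 lerD2r normrM normfV (ger0_norm (ltW k0)).
rewrite ler_pM2r ?invr_gt0//; apply: le_trans (ler_normB _ _) _.
by rewrite lerD ?cos_max// normrM ler_piMr ?sin_max.
Qed.

Lemma integral_expNabs_cos1 (k : R) :
  (\int[mu1]_x (expR (- `|x|) * (1 + cos (k * x)))%:E = (2 + 2 / (1 + k ^+ 2))%:E)%E.
Proof.
rewrite ge0_symfun_integralT.
- rewrite -set_itvcy.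
  under eq_integral => x.
    rewrite inE /= in_itv/= andbT => x0; rewrite ger0_norm//.
    over.
  by rewrite integral_expN_cos_half -EFinM mulrDr mulr1.
- by move=> x; rewrite mulr_ge0 ?expR_ge0// -lerBlDl sub0r cos_geN1.
- move=> x; apply: cvgM; first exact: continuous_expNabs.
  by apply: cvgD; [exact: cvg_cst|exact: continuous_cosM].
- by move=> x /=; rewrite normrN mulrN cosN.
Qed.

Lemma integral_expNabs : (\int[mu1]_x (expR (- `|x|))%:E = 2%:E)%E.
Proof.
have := integral_expNabs_cos1 0.
under eq_integral do rewrite mul0r cos0 mulrC EFinM.
rewrite ge0_integralZl_EFin//; last first.
  apply/measurable_EFinP; apply: continuous_measurable_fun; exact: continuous_expNabs.
move/(congr1 (fun z => (2^-1)%:E * z)%E); rewrite muleA -EFinM.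
have -> : 2^-1 * (1 + 1) = 1 :> R by field.
rewrite mul1e => ->; rewrite -EFinM; congr (_%:E).
by rewrite expr0n addr0 divr1; field.
Qed.

Lemma integ_expNabs : integ mu1 (fun x => expR (- `|x|)).
Proof.
apply: ge0_integP.
- by apply: continuous_measurable_fun; exact: continuous_expNabs.
- by move=> x; exact: expR_ge0.
- by rewrite integral_expNabs ltry.
Qed.

Lemma measurable_expNabsM (h : R -> R) : continuous h ->
  measurable_fun setT ((fun x => expR (- `|x|) * h x) : RB -> RB).
Proof.
move=> ch; apply: continuous_measurable_fun => x.
by apply: cvgM; [exact: continuous_expNabs|exact: ch].
Qed.

Lemma integ_expNabsM (h : R -> R) : continuous h -> (forall x, `|h x| <= 1) ->
  integ mu1 (fun x => expR (- `|x|) * h x).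
Proof.
move=> ch h1; apply: (integ_le (h := fun x : RB => expR (- `|x|))).
- exact: measurable_expNabsM.
- exact: integ_expNabs.
- by move=> x; rewrite normrM (ger0_norm (expR_ge0 _)) ler_piMr ?expR_ge0.
Qed.

Lemma Rintegral_expNabs_cos (k : R) :
  \int[mu1]_x (expR (- `|x|) * cos (k * x)) = 2 / (1 + k ^+ 2).
Proof.
have := integral_expNabs_cos1 k.
under eq_integral do rewrite mulrDr mulr1.
move/(congr1 (@fine R)) => /=.
rewrite [fine _](@RintegralD _ RB _ _ setT (fun x : R => expR (- `|x|)) (fun x : R => expR (- `|x|) * cos (k * x)))//; last 2 first.
- exact: integ_expNabs.
- by apply: integ_expNabsM; [exact: continuous_cosM|move=> x; exact: cos_max].
rewrite {1}/Rintegral integral_expNabs /= => h.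
by apply: (addrI 2).
Qed.

Lemma ge0_integral_reflect (f : RB -> \bar R) : measurable_fun setT f -> (forall x, 0 <= f x)%E ->
  (\int[mu1]_x f (- x)%R = \int[mu1]_x f x)%E.
Proof.
move=> mf f0.
have mN : measurable_fun setT (-%R : RB -> RB) by exact: oppr_measurable.
rewrite -[LHS](@ge0_integral_pushforward _ _ RB RB R -%R mN mu1 setT f)//.
by apply: eq_measure_integral => A mA _; exact: lebesgue_measureN.
Qed.

(** The integrand is odd. Reflection is applied to the nonnegative function obtained by adding 1 to
    the sine, which gives [2 - I = 2 + I] for the integral [I]. *)
Lemma Rintegral_expNabs_sin (k : R) :
  \int[mu1]_x (expR (- `|x|) * sin (k * x)) = 0.
Proof.
pose f x := expR (- `|x|) * (1 + sin (k * x)).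
have cs : continuous (fun x : R => 1 + sin (k * x)).
  by move=> x; apply: cvgD; [exact: cvg_cst|exact: continuous_sinM].
have mf : measurable_fun setT ((EFin \o f) : RB -> \bar R).
  by apply/measurable_EFinP; exact: measurable_expNabsM.
have := ge0_integral_reflect mf.
have is_ : integ mu1 (fun x => expR (- `|x|) * sin (k * x)).
  by apply: integ_expNabsM; [exact: continuous_sinM|move=> x; exact: sin_max].
have ie := integ_expNabs.
have -> : (\int[mu1]_x (EFin \o f) (- x)%R = (2 - \int[mu1]_x (expR (- `|x|) * sin (k * x)))%:E)%E.
  under eq_integral do rewrite /f /= normrN mulrN sinN mulrBr mulr1.
  rewrite integ_fineK; last exact: integB.
  by congr EFin; rewrite [LHS]RintegralB// {1}/Rintegral integral_expNabs.
have -> : (\int[mu1]_x (EFin \o f) x = (2 + \int[mu1]_x (expR (- `|x|) * sin (k * x)))%:E)%E.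
  under eq_integral do rewrite /f /= mulrDr mulr1.
  rewrite integ_fineK; last exact: integD.
  by congr EFin; rewrite [LHS]RintegralD// {1}/Rintegral integral_expNabs.
move=> h; have {h} /h [] : forall x, (0 <= (EFin \o f) x)%E.
  by move=> x; rewrite lee_fin mulr_ge0 ?expR_ge0// -lerBlDl sub0r sin_geN1.
by lra.
Qed.

Lemma fourier_expNabs (k : R) :
  Cinteg mu1 (fun x => (expR (- `|x|))%:C * expi (- (k * x))) /\
  Cintegral mu1 (fun x => (expR (- `|x|))%:C * expi (- (k * x))) = (2 / (1 + k ^+ 2))%:C.
Proof.
have ReE x : Re ((expR (- `|x|))%:C * expi (- (k * x))) = expR (- `|x|) * cos (k * x).
  by rewrite ReM /= cosN mul0r subr0.
have ImE x : Im ((expR (- `|x|))%:C * expi (- (k * x))) = - 1 * (expR (- `|x|) * sin (k * x)).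
  by rewrite ImM /= sinN mul0r addr0 mulrN mulN1r.
have is_ : integ mu1 (fun x => expR (- `|x|) * sin (k * x)).
  by apply: integ_expNabsM; [exact: continuous_sinM|move=> x; exact: sin_max].
split; [split|].
- under eq_fun do rewrite ReE.
  by apply: integ_expNabsM; [exact: continuous_cosM|move=> x; exact: cos_max].
- by under eq_fun do rewrite ImE; exact: integZl.
- rewrite /Cintegral; under eq_Rintegral do rewrite ReE.
  rewrite Rintegral_expNabs_cos; congr Complex.
  by under eq_Rintegral do rewrite ImE; rewrite RintegralZl// Rintegral_expNabs_sin mulr0.
Qed.

Lemma integral_cauchy : (\int[mu1]_x (pi^-1 * (1 + x ^+ 2)^-1)%:E = 1%:E)%E.
Proof.
have mo : measurable_fun setT (fun x : RB => (oneDsqr x)^-1).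
  by apply: continuous_measurable_fun; exact: continuous_oneDsqrV.
have E : (\int[mu1]_x ((oneDsqr x)^-1)%:E = pi%:E)%E.
  rewrite ge0_symfun_integralT.
  - by rewrite -set_itvcy integral0y_oneDsqr -EFinM mulrC divfK.
  - by move=> x; rewrite invr_ge0 addr_ge0 ?sqr_ge0.
  - exact: continuous_oneDsqrV.
  - by move=> x /=; rewrite /oneDsqr sqrrN.
under eq_integral do rewrite EFinM.
rewrite ge0_integralZl_EFin//.
- by rewrite E -EFinM mulVf// gt_eqF ?pi_gt0.
- by move=> x _; rewrite lee_fin invr_ge0 addr_ge0 ?sqr_ge0.
- exact/measurable_EFinP.
- by rewrite invr_ge0 pi_ge0.
Qed.

Lemma integ_cauchy : integ mu1 (fun x => pi^-1 * (1 + x ^+ 2)^-1).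
Proof.
apply: ge0_integP.
- apply: measurable_funM; first exact: measurable_cst.
  by apply: continuous_measurable_fun; exact: continuous_oneDsqrV.
- by move=> x; rewrite mulr_ge0 ?invr_ge0 ?pi_ge0// addr_ge0 ?sqr_ge0.
- by rewrite integral_cauchy ltry.
Qed.

Lemma expi_2piMn (n : nat) : expi (2 * pi * n%:R) = 1 :> R[i].
Proof.
elim: n => [|n IH]; first by rewrite mulr0 expi0.
rewrite (_ : 2 * pi * n.+1%:R = 2 * pi * n%:R + pi *+ 2); last by rewrite -natr1; ring.
by rewrite expiD IH mul1r /expi cos2pi sin2pi.
Qed.

Lemma expi_2piMz (n : int) : expi (2 * pi * n%:~R) = 1 :> R[i].
Proof.
case: n => n; first exact: expi_2piMn.
by rewrite NegzE mulrNz mulrN -conj_expi -pmulrn expi_2piMn conjc1.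
Qed.

(** The interval is half-open because unit cubes have to tile space; the fundamental theorem is
    applied on its closure, which differs by a null set. *)
Lemma integral_trig_period (c a : R) (F f : R -> R) : (forall x : R, is_derive x (1 : R) F (f x)) ->
  continuous f -> F (a + 1) = F a ->
  integ mu1 (fun x => \1_`[a, a + 1[ x * f x) /\ \int[mu1]_x (\1_`[a, a + 1[ x * f x) = 0.
Proof.
move=> dF cf Fa.
have cF : continuous F.
  move=> x; apply: differentiable_continuous; apply/derivable1_diffP.
  exact: (@ex_derive _ _ _ _ _ _ _ (dF x)).
have aa : a < a + 1 by rewrite ltrDl.
have I0 : (\int[mu1]_(x in `[a, (a + 1)%R]) (f x)%:E = 0)%E.
  rewrite (@continuous_FTC2 R f F a (a + 1))//.
  - by rewrite Fa subee.
  - exact: continuous_subspaceT.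
  - split.
    + by move=> x _; exact: (@ex_derive _ _ _ _ _ _ _ (dF x)).
    + by apply: cvg_at_right_filter; exact: cF.
    + by apply: cvg_at_left_filter; exact: cF.
  - by move=> x _; rewrite derive1E; exact: (@derive_val _ _ _ _ _ _ _ (dF x)).
have mf : measurable_fun setT (f : RB -> RB) by exact: continuous_measurable_fun.
have ii : mu1.-integrable `[a, a + 1] (EFin \o f).
  by apply: continuous_compact_integrable; [exact: segment_compact|exact: continuous_subspaceT].
have gE : EFin \o (fun x : RB => \1_`[a, a + 1[ x * f x) = (EFin \o f) \_ [set` `[a, a + 1[].
  apply/funext => x /=; rewrite patchE indicE; case: ifPn => _; first by rewrite mul1r.
  by rewrite mul0r.
have i2 : mu1.-integrable `[a, a + 1[ (EFin \o f).
  by apply: integrableS ii => //; apply: subset_itvl; rewrite bnd_simp.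
split.
  rewrite /integ gE.
  by apply/(integrable_mkcond _ _).1 => //.
rewrite /Rintegral; transitivity (fine (\int[mu1]_x ((EFin \o f) \_ [set` `[a, (a + 1)%R[]) x)%E).
  by rewrite -gE.
rewrite -integral_mkcond integral_itv_bndo_bndc ?I0//.
exact: (measurable_int mu1 i2).
Qed.

Lemma Cintegral_exp_period (n : int) (a : R) :
  Cinteg mu1 (fun x => (\1_`[a, a + 1[ x)%:C * expi (2 * pi * n%:~R * x)) /\
  Cintegral mu1 (fun x => (\1_`[a, a + 1[ x)%:C * expi (2 * pi * n%:~R * x)) = (n == 0)%:R.
Proof.
set c := 2 * pi * n%:~R.
have per : expi (c * (a + 1)) = expi (c * a).
  by rewrite mulrDr mulr1 expiD expi_2piMz mulr1.
have ReE x : Re ((\1_`[a, a + 1[ x)%:C * expi (c * x)) = \1_`[a, a + 1[ x * cos (c * x).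
  by rewrite ReM /= mul0r subr0.
have ImE x : Im ((\1_`[a, a + 1[ x)%:C * expi (c * x)) = \1_`[a, a + 1[ x * sin (c * x).
  by rewrite ImM /= mul0r addr0.
have [n0|n0] := eqVneq n 0.
  have c0 x : expi (c * x) = 1 by rewrite /c n0 mulr0 mul0r expi0.
  have fE : (fun x : RB => (\1_`[a, a + 1[ x)%:C * expi (c * x)) = (fun x => (\1_`[a, a + 1[ x)%:C).
    by apply/funext => x; rewrite c0 mulr1.
  rewrite fE Cintegral_real; split.
    by apply: Cinteg_real; exact: integrable_indic_itv.
  rewrite /Rintegral integral_indic// setIT.
  have h : (mu1 `[a, (a + 1)%R[ = 1%:E)%E.
    by rewrite lebesgue_measure_itv/= lte_fin ltrDl ltr01 -EFinB addrAC subrr add0r.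
  by rewrite -[RHS]/((fine 1%:E)%:C) -h.
have cn0 : c != 0 by rewrite !mulf_neq0 ?intr_eq0// gt_eqF ?pi_gt0.
have [i1 e1] : integ mu1 (fun x => \1_`[a, a + 1[ x * cos (c * x)) /\
    \int[mu1]_x (\1_`[a, a + 1[ x * cos (c * x)) = 0.
  apply: (@integral_trig_period c a (c^-1 \*: (fun x => sin (c * x)))).
  - move=> x; apply: (is_derive_eq (@is_deriveZ _ _ _ _ c^-1 _ _ _ (is_derive_sinM c x))).
    by rewrite /GRing.scale /= mulKf.
  - exact: continuous_cosM.
  - by move: per; rewrite /expi => -[_ h]; congr (c^-1 * _).
have [i2 e2] : integ mu1 (fun x => \1_`[a, a + 1[ x * sin (c * x)) /\
    \int[mu1]_x (\1_`[a, a + 1[ x * sin (c * x)) = 0.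
  apply: (@integral_trig_period c a ((- c^-1) \*: (fun x => cos (c * x)))).
  - move=> x; apply: (is_derive_eq (@is_deriveZ _ _ _ _ (- c^-1) _ _ _ (is_derive_cosM c x))).
    by rewrite /GRing.scale /= mulrA mulrNN mulVf// mul1r.
  - exact: continuous_sinM.
  - by move: per; rewrite /expi => -[h _]; congr (- c^-1 * _).
split; first by split; [under eq_fun do rewrite ReE|under eq_fun do rewrite ImE].
rewrite /Cintegral; under eq_Rintegral do rewrite ReE; rewrite e1.
by under eq_Rintegral do rewrite ImE; rewrite e2.
Qed.

End one_dim_integrals.

(** * Continuity of translation in measure *)

Lemma cvge0_le (R : realType) (u : nat -> \bar R) (e : R) :
  u n @[n --> \oo] --> 0%E -> 0 < e -> exists n, (u n <= e%:E)%E.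
Proof.
move=> /fine_cvgP[fu /cvgrPdist_le h] e0.
have [n1 _ h1] := fu; have [n2 _ h2] := h _ e0.
exists (maxn n1 n2); have f1 := h1 _ (leq_maxl n1 n2).
have := h2 _ (leq_maxr n1 n2); rewrite /= sub0r normrN => h3.
by rewrite -(fineK f1) lee_fin (le_trans (ler_norm _)).
Qed.

Section translation_continuity.
Variables (R : realType) (d : nat).
Local Notation E := 'rV[R]_d.
Local Notation mu1 := (@lebesgue_measure R).
Local Notation mu := (@lebesgue_borel R d).

Definition boxset (I : 'I_d -> set R) : set E := [set x | forall j, I j (x 0 j)].

Lemma measurable_boxset (I : 'I_d -> set R) :
  (forall j, measurable (I j : set (measurableTypeR R))) -> measurable (boxset I).
Proof.
move=> mI; rewrite (_ : boxset I = \bigcap_(j in [set: 'I_d]) (rV_coor j @^-1` I j)); last first.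
  by apply/seteqP; split => [x h j _|x h j]; [exact: h|exact: (h j Logic.I)].
apply: fin_bigcap_measurable; first exact: finite_finset.
move=> j _; rewrite -[X in measurable X]setTI.
by apply: (@measurable_rV_coor R d j) => //; exact: mI.
Qed.

Lemma measure_boxset (I : 'I_d -> set R) :
  (forall j, measurable (I j : set (measurableTypeR R))) -> (forall j, mu1 (I j) < +oo)%E ->
  mu (boxset I) = (\prod_j fine (mu1 (I j)))%:E.
Proof.
move=> mI fI; have mB := measurable_boxset mI.
have ii j : integ mu1 (\1_(I j)).
  apply: ge0_integP => //.
  by rewrite integral_indic//; rewrite setIT; exact: fI.
have g0 j x : 0 <= \1_(I j) x :> R by rewrite indicE; exact: ler0n.
have [i1 e1] := @integ_prod_borel R d (fun j => \1_(I j)) g0 ii.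
have E1 (x : E) : \1_(boxset I) x = \prod_j \1_(I j) (x 0 j) :> R.
  rewrite indicE; have [h|h] := pselect (boxset I x).
    by rewrite mem_set// big1// => j _; rewrite indicE mem_set//; exact: h.
  have /existsNP[j nj] : ~ forall j, I j (x 0 j) by exact: h.
  rewrite memNset//.
  by rewrite (bigD1 j)//= indicE memNset// mul0r.
have -> : mu (boxset I) = (\int[mu]_x (\1_(boxset I) x)%:E)%E by rewrite integral_indic// setIT.
under eq_integral do rewrite E1.
rewrite integ_fineK// e1; congr (_%:E); apply: eq_bigr => j _.
by rewrite /Rintegral integral_indic// setIT.
Qed.

Definition cubeN (N : nat) : set E := boxset (fun=> [set x : R | `|x| <= N%:R]).

Lemma itvcc_absE (a e : R) : [set x : R | `|x - a| <= e] = `[a - e, a + e]%classic.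
Proof. by apply/seteqP; split => x /=; rewrite in_itv /= ler_distl. Qed.

Lemma measurable_abs_le (N : R) : measurable ([set x : R | `|x| <= N] : set (measurableTypeR R)).
Proof.
rewrite (_ : [set x : R | `|x| <= N] = `[0 - N, 0 + N]%classic); first exact: measurable_itv.
by rewrite -itvcc_absE; apply/seteqP; split => x /=; rewrite subr0.
Qed.

Lemma measurable_cubeN N : measurable (cubeN N).
Proof. by apply: measurable_boxset => j; exact: measurable_abs_le. Qed.

Lemma measure_abs_le_lty (N : R) : (mu1 [set x : R | (`|x| <= N)%R] < +oo)%E.
Proof.
rewrite (_ : [set x : R | `|x| <= N] = `[0 - N, 0 + N]%classic); last first.
  by rewrite -itvcc_absE; apply/seteqP; split => x /=; rewrite subr0.
rewrite lebesgue_measure_itv/=; case: ifP => _; last exact: ltry.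
by rewrite -EFinB ltry.
Qed.

Lemma measure_cubeN_lty N : (mu (cubeN N) < +oo)%E.
Proof.
rewrite measure_boxset ?ltry// => j; first exact: measurable_abs_le.
exact: measure_abs_le_lty.
Qed.

Definition symd (A : set E) (y : E) : set E :=
  (A `\` affine 1 y @^-1` A) `|` (affine 1 y @^-1` A `\` A).

Lemma measurable_shift (A : set E) (y : E) : measurable A -> measurable (affine 1 y @^-1` A).
Proof. by move=> mA; rewrite -[X in measurable X]setTI; exact: measurable_affine_rV. Qed.

Lemma measurable_symd (A : set E) (y : E) : measurable A -> measurable (symd A y).
Proof.
move=> mA; have mS := measurable_shift y mA.
by apply: measurableU; exact: measurableD.
Qed.

Lemma measure_shift (A : set E) (y : E) : measurable A -> mu (affine 1 y @^-1` A) = mu A.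
Proof. by move=> mA; rewrite lebesgue_borel_affine// expr1n invr1 mul1e. Qed.

Definition small (dl : R) (y : E) := forall j, `|y 0 j| < dl.

(** A property chosen to define a sigma-algebra. The cube keeps all measures finite: a half-space
    and its translate may differ by a slab of infinite measure, and countable unions rest on
    continuity from above. *)
Definition shift_cont (A : set E) := measurable A /\
  forall N (e : R), 0 < e -> exists2 dl : R, 0 < dl & forall y, small dl y ->
    (mu (cubeN N `&` symd A y) <= e%:E)%E.

Lemma shift_cont0 : shift_cont set0.
Proof.
split; first exact: measurable0.
move=> N e e0; exists 1 => // y _.
by rewrite /symd preimage_set0 !setD0 setU0 setI0 measure0 lee_fin ltW.
Qed.

Lemma shift_contC A : shift_cont A -> shift_cont (~` A).
Proof.
move=> [mA hA]; split; first exact: measurableC.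
move=> N e e0; have [dl dl0 hd] := hA N e e0; exists dl => // y yd.
suff -> : symd (~` A) y = symd A y by exact: hd.
by rewrite /symd preimage_setC !setDE !setCK setUC [X in _ `|` X]setIC [X in X `|` _]setIC.
Qed.

Lemma shift_cont_finU (A : nat -> set E) N : (forall i, shift_cont (A i)) ->
  forall n (e : R), 0 < e -> exists2 dl : R, 0 < dl & forall y, small dl y ->
    (mu (cubeN N `&` \bigcup_(i < n) symd (A i) y) <= e%:E)%E.
Proof.
move=> hA; elim=> [|n IH] e e0.
  exists 1 => // y _; rewrite (_ : _ `&` _ = set0) ?measure0 ?lee_fin ?ltW//.
  by rewrite -subset0 => x; case=> _; case=> i.
have e20 : 0 < e / 2 by rewrite divr_gt0.
have [d1 d10 h1] := IH _ e20.
have [d2 d20 h2] := (hA n).2 N _ e20.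
exists (Num.min d1 d2) => [|y ys]; first by rewrite lt_min d10.
have y1 : small d1 y by move=> j; have := ys j; rewrite lt_min => /andP[].
have y2 : small d2 y by move=> j; have := ys j; rewrite lt_min => /andP[].
have mS i : measurable (symd (A i) y) by apply: measurable_symd; case: (hA i).
have mU : measurable (\bigcup_(i < n) symd (A i) y) by apply: bigcup_measurable.
have mQ := measurable_cubeN N.
apply: (@le_trans _ _ (mu ((cubeN N `&` \bigcup_(i < n) symd (A i) y) `|` (cubeN N `&` symd (A n) y)))).
  apply: le_measure; rewrite ?inE.
  - by apply: measurableI => //; apply: bigcup_measurable.
  - by apply: measurableU; exact: measurableI.
  move=> x [Qx [i /= ni hi]]; move: ni; rewrite ltnS leq_eqVlt => /orP[/eqP ein|lin].
    by right; split => //; rewrite -ein.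
  by left; split => //; exists i.
apply: le_trans (measureU2 _ _ _) _; try exact: measurableI.
rewrite [e](splitr e) EFinD; apply: leeD; [exact: h1|exact: h2].
Qed.

(** Up to a remainder of small measure and its translate, the union is a finite one, whose symmetric
    difference lies in the union of finitely many small ones. *)
Lemma shift_cont_bigcup (A : nat -> set E) : (forall i, shift_cont (A i)) ->
  shift_cont (\bigcup_i A i).
Proof.
move=> hA; have mA i : measurable (A i) by case: (hA i).
have mU : measurable (\bigcup_i A i) by exact: bigcupT_measurable.
split => // N e e0.
pose B n := \bigcup_(i < n) A i.
have mB n : measurable (B n) by apply: bigcup_measurable.
have mQ := measurable_cubeN N.+1.
(* The remainder is taken in a cube larger by one because a shift with coordinates below 1 carries
   [cubeN N] into [cubeN N.+1]. *)
pose F n := cubeN N.+1 `&` (\bigcup_i A i `\` B n).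
have mF n : measurable (F n) by apply: measurableI => //; exact: measurableD.
have F0 : (mu (F 0%N) < +oo)%E.
  apply: le_lt_trans (measure_cubeN_lty N.+1).
  by apply: le_measure; rewrite ?inE//; exact: subIsetl.
have FI : \bigcap_n F n = set0.
  rewrite -subset0 => x hx; have [_ [[i _ Aix] _]] := hx 0%N Logic.I.
  by have [_ [_]] := hx i.+1 Logic.I; apply; exists i => //=.
have ndF : nonincreasing_seq F.
  move=> m n mn; apply/subsetPset => x [Qx [Ux nB]]; split => //; split => //.
  by move=> [i /= im Aix]; apply: nB; exists i => //=; exact: leq_trans im mn.
have cF := @nonincreasing_cvg_mu _ _ _ mu F F0 mF _ ndF.
have {}cF : mu (F n) @[n --> \oo] --> 0%E.
  by have := cF; rewrite FI measure0; apply; exact: measurable0.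
have e40 : 0 < e / 4 by rewrite divr_gt0.
have [n hn] : exists n, (mu (F n) <= (e / 4)%:E)%E.
  exact: cvge0_le cF _.
have e20 : 0 < e / 2 by rewrite divr_gt0.
have [d1 d10 h1] := shift_cont_finU N hA n e20.
exists (Num.min d1 1) => [|y ys]; first by rewrite lt_min d10 ltr01.
have y1 : small d1 y by move=> j; have := ys j; rewrite lt_min => /andP[].
have y2 : small 1 y by move=> j; have := ys j; rewrite lt_min => /andP[].
have mS i : measurable (symd (A i) y) by exact: measurable_symd.
have mU' : measurable (\bigcup_(i < n) symd (A i) y) by apply: bigcup_measurable.
have mQN := measurable_cubeN N.
pose G := affine 1 y @^-1` F n.
have mG : measurable G by exact: measurable_shift.
apply: (@le_trans _ _ (mu ((cubeN N `&` \bigcup_(i < n) symd (A i) y) `|` (F n `|` G)))).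
  apply: le_measure; rewrite ?inE.
  - by apply: measurableI => //; exact: measurable_symd.
  - by apply: measurableU; [exact: measurableI|exact: measurableU].
  move=> x [Qx sx].
  have Qx1 : cubeN N.+1 x by move=> j; apply: le_trans (Qx j) _; rewrite ler_nat.
  have Qy1 : cubeN N.+1 (affine 1 y x).
    move=> j; rewrite /affine !mxE mul1r /= -natr1; apply: le_trans (ler_normD _ _) _.
    by rewrite lerD//; [exact: Qx|exact/ltW/y2].
  have [|nF] := pselect (F n x); first by right; left.
  have [|nG] := pselect (G x); first by right; right.
  left; split => //; case: sx => [[[i _ Aix] nU]|[[i _ Aix] nU]].
    have /existsNP[k] : ~ forall i, ~ ((i < n)%N /\ A i x).
      move=> h; apply: nF; split => //; split; first by exists i.
      by move=> [k kn Ak]; apply: (h k).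
    move/contrapT => [kn Ak]; exists k => //=; left; split => // Aky.
    by apply: nU; exists k.
  have /existsNP[k] : ~ forall i, ~ ((i < n)%N /\ A i (affine 1 y x)).
    move=> h; apply: nG; split => //; split; first by exists i.
    by move=> [k kn Ak]; apply: (h k).
  move/contrapT => [kn Ak]; exists k => //=; right; split => // Aky.
  by apply: nU; exists k.
apply: le_trans (measureU2 _ _ _) _.
- exact: measurableI.
- exact: measurableU.
rewrite [e](splitr e) EFinD; apply: leeD; first exact: h1.
apply: le_trans (measureU2 _ _ _) _ => //.
have -> : e / 2 = e / 4 + e / 4 by field.
have hG : (mu G <= (e / 4)%:E)%E by apply: le_trans hn; rewrite (measure_shift y (mF n)).
by rewrite EFinD; exact: leeD.
Qed.

(** A point of the symmetric difference has its coordinate [j] within [dl] of [c], and so lies in a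
    thin slab of the cube. *)
Lemma shift_cont_ray j (c : R) : shift_cont (rV_coor j @^-1` `]c, +oo[).
Proof.
have mA : measurable (rV_coor j @^-1` `]c, +oo[ : set E).
  by rewrite -[X in measurable X]setTI; exact: (@measurable_rV_coor R d j).
split => // N e e0.
pose K := \prod_(i | i != j) fine (mu1 [set x : R | `|x| <= N%:R]).
have K0 : 0 <= K by apply: prodr_ge0 => i _; exact: fine_ge0.
(* The slab has measure [2 dl K], with [K] the product of the other sides; [K + 1] avoids division
   by zero. *)
pose dl := e / (2 * (K + 1)).
have K10 : 0 < 2 * (K + 1) by rewrite mulr_gt0// ltr_wpDl.
have dl0 : 0 < dl by rewrite divr_gt0.
exists dl => // y ys.
pose J i := if i == j then [set x : R | `|x - c| <= dl] else [set x : R | `|x| <= N%:R].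
have mJ i : measurable (J i : set (measurableTypeR R)).
  rewrite /J; case: ifP => _; last exact: measurable_abs_le.
  by rewrite itvcc_absE; exact: measurable_itv.
have JE : mu1 [set x : R | `|x - c| <= dl] = (2 * dl)%:E.
  rewrite itvcc_absE lebesgue_measure_itv/= lte_fin.
  rewrite ltrD2l gtrN// -EFinB; congr EFin; ring.
have fJ i : (mu1 (J i) < +oo)%E.
  rewrite /J; case: ifP => _; last exact: measure_abs_le_lty.
  by rewrite JE ltry.
apply: (@le_trans _ _ (mu (boxset J))).
  apply: le_measure; rewrite ?inE.
  - by apply: measurableI; [exact: measurable_cubeN|exact: measurable_symd].
  - exact: measurable_boxset.
  move=> x [Qx sx] i; rewrite /J; case: eqVneq => [->{i}|_]; last exact: Qx.
  have := ys j; rewrite ltr_norml => /andP[y1 y2].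
  move: sx; rewrite /symd /setD /rV_coor /affine /= !in_itv/= !andbT !mxE mul1r.
  by rewrite ler_norml => -[[h /negP]|[h /negP]]; rewrite -leNgt => h'; apply/andP; split; lra.
rewrite measure_boxset// lee_fin (bigD1 j)//= {1}/J eqxx JE /=.
rewrite (_ : \prod_(i | i != j) _ = K); last first.
  by apply: eq_bigr => i ij; rewrite /J (negbTE ij).
rewrite /dl; have -> : 2 * (e / (2 * (K + 1))) * K = e * (K / (K + 1)).
  by field; rewrite gt_eqF// ltr_wpDl.
by rewrite ler_piMr ?(ltW e0)// ler_pdivrMr ?ltr_wpDl// mul1r lerDl.
Qed.

(** The sets with the property form a sigma-algebra containing the coordinate rays, which generate
    the Borel sets. *)
Lemma borel_shift_cont (A : set E) : measurable A -> shift_cont A.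
Proof.
have sD : sigma_algebra setT shift_cont.
  split; first exact: shift_cont0.
  - by move=> B hB; rewrite setTD; exact: shift_contC.
  - by move=> F hF; exact: shift_cont_bigcup.
apply: (smallest_sub sD) => B.
pose G (S : set (set E)) := forall B, S B -> shift_cont B.
suff : G (\big[setU/set0]_(i < d) preimage_set_system setT (@rV_coor R d i) measurable) by apply.
apply: big_ind => //.
- by move=> S1 S2 h1 h2 C [/h1|/h2].
- move=> j _ _ [Y mY <-]; rewrite setTI.
  have : (@RGenOInfty.G R).-sigma.-measurable Y by rewrite -RGenOInfty.measurableE.
  suff : <<s (@RGenOInfty.G R) >> `<=` (fun Z => shift_cont (rV_coor j @^-1` Z)) by move=> h /h.
  apply: smallest_sub.
    split.
    + by rewrite /= preimage_set0; exact: shift_cont0.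
    + by move=> C hC; rewrite /= setTD preimage_setC; exact: shift_contC.
    + by move=> F hF /=; rewrite preimage_bigcup; exact: shift_cont_bigcup.
  by move=> _ [c ->] /=; exact: shift_cont_ray.
Qed.

(** Finite measure makes the part of [A] outside a large cube negligible, so the truncation is
    removed. Only the points that leave [A] are counted, as this is what a packet loses. *)
Lemma translation_continuity (A : set E) (e : R) : measurable A -> (mu A < +oo)%E -> 0 < e ->
  exists2 dl : R, 0 < dl & forall y, small dl y ->
    (mu (A `\` affine 1 y @^-1` A) <= e%:E)%E.
Proof.
move=> mA fA e0.
pose F n := A `\` cubeN n.
have mF n : measurable (F n) by apply: measurableD => //; exact: measurable_cubeN.
have F0 : (mu (F 0%N) < +oo)%E.
  by apply: le_lt_trans fA; apply: le_measure; rewrite ?inE//; exact: subDsetl.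
have FI : \bigcap_n F n = set0.
  rewrite -subset0 => x hx.
  pose n := \max_j (Num.truncn `|x 0%R j|).+1.
  have [_] := hx n Logic.I; apply => j /=.
  apply: ltW; apply: (lt_le_trans (truncnS_gt _)); rewrite ler_nat.
  exact: (leq_bigmax (F := fun j => (Num.truncn `|x 0%R j|).+1)).
have ndF : nonincreasing_seq F.
  move=> m n mn; apply/subsetPset => x [Ax nQ]; split => // Qx; apply: nQ => j.
  by apply: le_trans (Qx j) _; rewrite ler_nat.
have cF := @nonincreasing_cvg_mu _ _ _ mu F F0 mF _ ndF.
have {}cF : mu (F n) @[n --> \oo] --> 0%E.
  by have := cF; rewrite FI measure0; apply; exact: measurable0.
have e20 : 0 < e / 2 by rewrite divr_gt0.
have [n hn] : exists n, (mu (F n) <= (e / 2)%:E)%E.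
  exact: cvge0_le cF _.
have [dl dl0 hd] := (borel_shift_cont mA).2 n _ e20.
exists dl => // y ys; have mS := measurable_symd y mA.
have mQ := measurable_cubeN n.
apply: (@le_trans _ _ (mu (F n `|` (cubeN n `&` symd A y)))).
  apply: le_measure; rewrite ?inE.
  - by apply: measurableD => //; exact: measurable_shift.
  - by apply: measurableU => //; exact: measurableI.
  move=> x [Ax nAx]; have [Qx|nQ] := pselect (cubeN n x); last by left.
  by right; split => //; left.
apply: le_trans (measureU2 _ _ _) _ => //; first exact: measurableI.
by rewrite [e](splitr e) EFinD; apply: leeD => //; exact: hd.
Qed.

End translation_continuity.

(** * Transfer of integrals and affine substitutions to the abstract Lebesgue space *)

Section lebesgue_space_theory.
Variables (R : realType) (d : nat) (L : lebesgue_space R d).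
Local Notation E := 'rV[R]_d.
Local Notation X := (ls_sort L).
Local Notation leb := (ls_mu L).
Local Notation val := (@ls_val R d L).
Local Notation pt := (@ls_pt R d L).
Local Notation LB := (@lebesgue_borel R).

Lemma measurable_ls_comp d' (Z : measurableType d') (g : E -> Z) :
  measurable_fun setT g -> measurable_fun setT (fun x : X => g (val x)).
Proof. by move=> mg; exact: (measurableT_comp mg (@measurable_ls_val _ _ L)). Qed.

Lemma measurable_ls_coor j : measurable_fun setT (fun x : X => val x 0 j).
Proof. exact: (measurable_ls_comp (@measurable_rV_coor R d j)). Qed.

Lemma measurable_ls_set (A : set E) : measurable A -> measurable (val @^-1` A).
Proof. by move=> mA; rewrite -[Y in measurable Y]setTI; exact: measurable_ls_val. Qed.

Lemma ge0_integral_ls (g : E -> \bar R) : measurable_fun setT g ->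
  (forall x, 0 <= g x)%E -> (\int[leb]_x g (val x) = \int[LB d]_x g x)%E.
Proof.
move=> mg g0; have mv := @measurable_ls_val _ _ L.
rewrite -[LHS](@ge0_integral_pushforward _ _ X _ R val mv leb setT g)//.
by apply: eq_measure_integral => A mA _; exact: ls_borel.
Qed.

Lemma integ_ls (g : E -> R) : integ (LB d) g -> integ leb (fun x => g (val x)).
Proof.
move=> ig; have mg := integ_measurable ig.
apply/integrableP; split; first exact/measurable_EFinP/measurable_ls_comp.
rewrite (@ge0_integral_ls (fun x => `|(g x)%:E|)%E)//; first by case/integrableP: ig.
exact/measurableT_comp/measurable_EFinP.
Qed.

Lemma Rintegral_ls (g : E -> R) : integ (LB d) g ->
  \int[leb]_x g (val x) = \int[LB d]_x g x.
Proof.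
move=> ig; congr fine; have mv := @measurable_ls_val _ _ L.
have mg : measurable_fun setT (EFin \o g) by exact: measurable_int ig.
rewrite -[LHS](@integral_pushforward _ _ X _ R val mv leb setT (EFin \o g))//; last first.
  exact: integ_ls.
by apply: eq_measure_integral => A mA _; exact: ls_borel.
Qed.

Lemma Cinteg_ls (g : E -> R[i]) : Cinteg (LB d) g -> Cinteg leb (fun x => g (val x)).
Proof. by move=> [g1 g2]; split; [exact: (integ_ls g1)|exact: (integ_ls g2)]. Qed.

Lemma Cintegral_ls (g : E -> R[i]) : Cinteg (LB d) g ->
  Cintegral leb (fun x => g (val x)) = Cintegral (LB d) g.
Proof. by move=> [g1 g2]; rewrite /Cintegral (Rintegral_ls g1) (Rintegral_ls g2). Qed.

Lemma Cinteg_prod (f : 'I_d -> R -> R[i]) : (forall j, Cinteg (@lebesgue_measure R) (f j)) ->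
  Cinteg leb (fun x => \prod_j f j (val x 0 j)) /\
  Cintegral leb (fun x => \prod_j f j (val x 0 j)) =
    \prod_j Cintegral (@lebesgue_measure R) (f j).
Proof.
move=> /Cinteg_prod_borel[i1 e1]; split; first exact: (Cinteg_ls i1).
by rewrite (Cintegral_ls i1).
Qed.

Lemma integ_prod (g : 'I_d -> R -> R) : (forall j x, 0 <= g j x) ->
  (forall j, integ (@lebesgue_measure R) (g j)) ->
  integ leb (fun x => \prod_j g j (val x 0 j)) /\
  \int[leb]_x \prod_j g j (val x 0 j) = \prod_j \int[@lebesgue_measure R]_x g j x.
Proof.
move=> g0 /(integ_prod_borel g0)[i1 e1]; split; first exact: (integ_ls i1).
by rewrite (Rintegral_ls i1).
Qed.

Definition affX (r : R) (c : E) (x : X) : X := pt (affine r c (val x)).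

Lemma val_affX r c x : val (affX r c x) = r *: val x + c.
Proof. by rewrite /affX ls_ptK. Qed.

Lemma measurable_affX r c : 0 < r -> measurable_fun setT (affX r c).
Proof. exact: measurable_ls_affine. Qed.

Lemma measurable_affX_set r c (A : set X) : 0 < r -> measurable A -> measurable (affX r c @^-1` A).
Proof. by move=> r0 mA; rewrite -[Y in measurable Y]setTI; exact: measurable_affX. Qed.

Lemma leb_affX r c (A : set X) : 0 < r -> measurable A ->
  (leb (affX r c @^-1` A) = (r ^- d)%:E * leb A)%E.
Proof. exact: ls_affine. Qed.

Lemma leb_shiftX c (A : set X) : measurable A -> leb (affX 1 c @^-1` A) = leb A.
Proof. by move=> mA; rewrite leb_affX// expr1n invr1 mul1e. Qed.

Lemma ge0_integral_affX (r : R) (c : E) (g : X -> \bar R) : 0 < r ->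
  measurable_fun setT g -> (forall x, 0 <= g x)%E ->
  (\int[leb]_x g (affX r c x) = (r ^- d)%:E * \int[leb]_x g x)%E.
Proof.
move=> r0 mg g0; pose phi := affX r c.
have rV0 : 0 <= r ^- d by rewrite invr_ge0 exprn_ge0// ltW.
rewrite -(@ge0_integral_mscale _ X R leb setT measurableT (NngNum rV0) g)//.
have mphi : measurable_fun setT phi by exact: measurable_affX.
rewrite -[LHS](@ge0_integral_pushforward _ _ X X R phi mphi leb setT g)//.
apply: eq_measure_integral => A mA _ /=.
by rewrite /mscale /= /pushforward /= leb_affX.
Qed.

Lemma integ_affX (r : R) (c : E) (g : X -> R) : 0 < r ->
  integ leb g -> integ leb (fun x => g (affX r c x)).
Proof.
move=> r0 ig; have mg := integ_measurable ig.
apply/integrableP; split.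
  exact/measurable_EFinP/(measurableT_comp mg)/measurable_affX.
rewrite (@ge0_integral_affX r c (fun x => `|(g x)%:E|)%E)//.
  by apply: lte_mul_pinfty => //; [rewrite lee_fin invr_ge0 exprn_ge0// ltW|case/integrableP: ig].
exact/measurableT_comp/measurable_EFinP.
Qed.

Lemma Rintegral_affX (r : R) (c : E) (g : X -> R) : 0 < r ->
  integ leb g -> \int[leb]_x g (affX r c x) = r ^- d * \int[leb]_x g x.
Proof.
move=> r0 ig; pose phi := affX r c.
have mphi : measurable_fun setT phi by exact: measurable_affX.
have mg : measurable_fun setT (EFin \o g) by exact: measurable_int ig.
have rV0 : 0 <= r ^- d by rewrite invr_ge0 exprn_ge0// ltW.
have pE (h : X -> R) : integ leb h -> (forall x, 0 <= h x) ->
    \int[leb]_x h (affX r c x) = r ^- d * \int[leb]_x h x.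
  move=> ih h0; rewrite /Rintegral (@ge0_integral_affX r c (fun x => (h x)%:E))//.
    by rewrite fineM//; exact: (integrable_fin_num _ ih).
  by apply/measurable_EFinP; exact: integ_measurable ih.
have ip : integ leb (fun x => (`|g x| + g x) / 2).
  under eq_fun do rewrite mulrC.
  by apply: integZl; apply: integD => //; exact: integrable_norm.
have im : integ leb (fun x => (`|g x| - g x) / 2).
  under eq_fun do rewrite mulrC.
  by apply: integZl; apply: integB => //; exact: integrable_norm.
have gE x : g x = (`|g x| + g x) / 2 - (`|g x| - g x) / 2 by field.
under eq_Rintegral do rewrite gE.
under [in RHS]eq_Rintegral do rewrite gE.
rewrite [LHS]RintegralB//; last 2 first.
- exact: (integ_affX _ r0 ip).
- exact: (integ_affX _ r0 im).
rewrite [in RHS]RintegralB// mulrBr.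
rewrite (pE (fun x => (`|g x| + g x) / 2))//; last first.
  by move=> x; rewrite divr_ge0// -lerBlDr sub0r -normrN ler_norm.
rewrite (pE (fun x => (`|g x| - g x) / 2))//.
by move=> x; rewrite divr_ge0// subr_ge0 ler_norm.
Qed.

Lemma Cintegral_affX (r : R) (c : E) (g : X -> R[i]) : 0 < r ->
  Cinteg leb g -> Cintegral leb (fun x => g (affX r c x)) = (r ^- d)%:C * Cintegral leb g.
Proof.
move=> r0 [g1 g2]; rewrite /Cintegral.
rewrite (Rintegral_affX _ r0 g1) (Rintegral_affX _ r0 g2).
by apply: complexP; rewrite !ReImE /=; ring.
Qed.

End lebesgue_space_theory.

(** * Averaging over lattice offsets *)

Lemma tail_integral d' (Y : measurableType d') (R : realType) (mu : {measure set Y -> \bar R})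
    (T : nat -> set Y) (w : Y -> R) (e : R) :
  (forall n, measurable (T n)) -> (forall y, \forall n \near \oo, ~ T n y) ->
  integ mu w -> (forall y, 0 <= w y) -> 0 < e ->
  exists n, (\int[mu]_y (w y * \1_(T n) y)%:E <= e%:E)%E.
Proof.
move=> mT T0 iw w0 e0; have mw := integ_measurable iw.
pose f n (y : Y) : \bar R := (w y * \1_(T n) y)%:E.
have mf n : measurable_fun setT (f n).
  by apply/measurable_EFinP; apply: measurable_funM => //; exact: measurable_indic.
have cf (y : Y) : f n y @[n --> \oo] --> 0%E.
  have [N _ hN] := T0 y.
  apply: cvg_near_cst; exists N => // n /= Nn.
  by rewrite /f indicE memNset ?mulr0//; exact: hN.
have [|||//|_ _ cI] := @dominated_convergence _ Y R mu setT measurableT f (cst 0%E) (EFin \o w) mf.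
- exact: measurable_cst.
- by apply: aeW => y _; exact: cf.
- exact: iw.
- apply: aeW => y n _; rewrite /f /= lee_fin ger0_norm ?mulr_ge0// ?indicE ?ler0n//.
  by rewrite ler_piMr// lern1 leq_b1.
have {}cI : (\int[mu]_y f n y)%E @[n --> \oo] --> 0%E.
  by move: cI; rewrite integral0.
exact: cvge0_le cI e0.
Qed.

Section selection.
Variables (R : realType) (d : nat) (L : lebesgue_space R d).
Local Notation E := 'rV[R]_d.
Local Notation X := (ls_sort L).
Local Notation leb := (ls_mu L).
Local Notation val := (@ls_val R d L).
Local Notation pt := (@ls_pt R d L).
Local Notation LB := (@lebesgue_borel R).

Definition tailX N : set X := val @^-1` (~` @cubeN R d N).

Lemma measurable_tailX N : measurable (tailX N).
Proof. by apply: measurable_ls_set; apply: measurableC; exact: measurable_cubeN. Qed.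

Lemma cubeN_cover (x : E) : exists N, @cubeN R d N x.
Proof.
exists (\max_(j < d) (Num.truncn `|x 0%R j|).+1) => j /=.
apply: ltW; apply: (lt_le_trans (truncnS_gt _)); rewrite ler_nat.
exact: (leq_bigmax (F := fun j => (Num.truncn `|x 0 j|).+1)).
Qed.

Lemma tailX0 y : \forall n \near \oo, ~ tailX n y.
Proof.
have [N hN] := cubeN_cover (val y).
exists N => // n /= Nn; apply => j; apply: le_trans (hN j) _; rewrite /= ler_nat//.
Qed.

Definition shiftd (s : R) (A : set E) (y : E) : set X := val @^-1` (A `\` affine 1 (s *: y) @^-1` A).

Lemma measurable_shiftd (s : R) (A : set E) (y : E) : measurable A ->
  measurable (shiftd s A y).
Proof.
by move=> mA; apply: measurable_ls_set; apply: measurableD => //; exact: measurable_shift.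
Qed.

(* Only for Borel A: preimages of Lebesgue null sets under (x, y) |-> x + s y need not
   be measurable for the product of the completed sigma-algebras. *)
Lemma measurable_joint_shift (s : R) (A : set E) : measurable A ->
  measurable ([set z : X * X | A (affine 1 (s *: val z.2) (val z.1))]).
Proof.
move=> mA; pose F (z : X * X) : E := affine 1 (s *: val z.2) (val z.1).
have mF : measurable_fun setT F.
  apply: measurable_fun_rV => j.
  under eq_fun do rewrite /F /affine !mxE mul1r.
  have m1 : measurable_fun setT (fun z : X * X => val z.1 0 j).
    exact: (measurableT_comp (@measurable_ls_coor _ _ L j) measurable_fst).
  have m2 : measurable_fun setT (fun z : X * X => val z.2 0 j).
    exact: (measurableT_comp (@measurable_ls_coor _ _ L j) measurable_snd).
  by apply: measurable_funD => //; apply: measurable_funM.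
by have := mF measurableT A mA; rewrite setTI.
Qed.

(** On a large cube of [y] the shifts [s y] are uniformly small and translation continuity applies;
    beyond it the measure is at most that of [A], and the tail of [w] is small. *)
Lemma averaged_translation (A : set E) (w : X -> R) (e : R) : measurable A ->
  (LB d A < +oo)%E -> integ leb w -> (forall y, 0 <= w y) -> 0 < e ->
  exists2 s0 : R, 0 < s0 & forall s : R, 0 < s -> s <= s0 ->
    (\int[leb]_y ((w y)%:E * leb (shiftd s A (val y))) <= e%:E)%E.
Proof.
move=> mA fA iw w0 e0; have mw := integ_measurable iw.
pose a := fine (LB d A); have a0 : 0 <= a by exact: fine_ge0.
have aE : LB d A = a%:E by rewrite /a fineK// ge0_fin_numE.
pose W := \int[leb]_y w y; have W0 : 0 <= W by apply: Rintegral_ge0.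
(* Half of [e] goes to the tail of [w] and half to the cube; adding 1 to [a] and to [W] guards
   against division by zero. *)
have e2 : 0 < e / (2 * (a + 1)) by rewrite divr_gt0// mulr_gt0// ltr_wpDl.
have [K hK] := tail_integral measurable_tailX tailX0 iw w0 e2.
have e1 : 0 < e / (2 * (W + 1)) by rewrite divr_gt0// mulr_gt0// ltr_wpDl.
have [dl dl0 hd] := translation_continuity mA fA e1.
have K10 : 0 < K%:R + 1 :> R by rewrite ltr_wpDl.
(* For [y] in the cube of half-side [K] this makes every coordinate of [s y] smaller than [dl]. *)
exists (dl / (K%:R + 1)) => [|s s0 ss]; first by rewrite divr_gt0.
have mS (y : E) : measurable (shiftd s A y) by exact: measurable_shiftd.
have mJ : measurable ([set z : X * X | A (val z.1) /\ ~ A (affine 1 (s *: val z.2) (val z.1))]).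
  apply: measurableI.
    rewrite -[Y in measurable Y]setTI.
    exact: (measurableT_comp (@measurable_ls_val _ _ L) measurable_fst).
  by apply: measurableC; exact: measurable_joint_shift.
have mm : measurable_fun setT (fun y : X => leb (shiftd s A (val y))).
  rewrite (_ : (fun y => _) = (fun y => leb (ysection
    [set z : X * X | A (val z.1) /\ ~ A (affine 1 (s *: val z.2) (val z.1))] y))).
    exact: measurable_fun_ysection.
  apply/funext => y /=; congr (leb _).
  by apply/seteqP; split => x; rewrite /ysection /shiftd /= inE.
pose B := e / (2 * (W + 1)).
pose g y : R := B * w y + a * (w y * \1_(tailX K) y).
have i1 : integ leb (fun y : X => w y * \1_(tailX K) y).
  apply: (integ_le _ iw).
    by apply: measurable_funM => //; apply: measurable_indic; exact: measurable_tailX.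
  move=> y; rewrite ger0_norm ?mulr_ge0// ?indicE ?ler0n//.
  by rewrite ler_piMr// lern1 leq_b1.
have ig : integ leb g by apply: integD; exact: integZl.
apply: (@le_trans _ _ (\int[leb]_y (g y)%:E)%E).
  apply: ge0_le_integral => //.
  - by move=> y _; rewrite mule_ge0 ?lee_fin.
  - by apply: emeasurable_funM => //; exact/measurable_EFinP.
  - by apply/measurable_EFinP; exact: integ_measurable ig.
  - move=> y _; rewrite /g indicE; have [Qy|nQ] := pselect (@cubeN R d K (val y)).
      rewrite memNset ?mulr0 ?addr0; last by move=> /=; apply.
      rewrite mulrC EFinM; apply: lee_wpmul2l; first by rewrite lee_fin.
      rewrite ls_borel; last by apply: measurableD => //; exact: measurable_shift.
      apply: hd => j; rewrite mxE normrM (gtr0_norm s0).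
      apply: (le_lt_trans (ler_wpM2l (ltW s0) (Qy j))).
      rewrite -(divfK (lt0r_neq0 K10) dl).
      apply: (@lt_le_trans _ _ (s * (K%:R + 1))); first by rewrite ltr_pM2l// ltrDl.
      by rewrite ler_pM2r.
    rewrite mem_set// mulr1.
    apply: (@le_trans _ _ (w y * a)%:E).
      rewrite EFinM; apply: lee_wpmul2l; first by rewrite lee_fin.
      rewrite -aE -(ls_borel L)//; apply: le_measure; rewrite ?inE//.
        exact: measurable_ls_set.
      by move=> x [].
    by rewrite lee_fin mulrC lerDr mulr_ge0// ltW.
rewrite integ_fineK// lee_fin /g RintegralD//; last 2 first.
- exact: (integZl _ iw).
- exact: (integZl _ i1).
rewrite RintegralZl// RintegralZl// -/W.
have hK' : \int[leb]_y (w y * \1_(tailX K) y) <= e / (2 * (a + 1)).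
  by rewrite -lee_fin -integ_fineK.
have h1 : B * W <= e / 2.
  rewrite /B; have -> : e / (2 * (W + 1)) * W = e / 2 * (W / (W + 1)).
    by field; rewrite gt_eqF// ltr_wpDl.
  by rewrite ler_piMr ?divr_ge0 ?(ltW e0)// ler_pdivrMr ?ltr_wpDl// mul1r lerDl.
have h2 : a * (e / (2 * (a + 1))) <= e / 2.
  have -> : a * (e / (2 * (a + 1))) = e / 2 * (a / (a + 1)).
    by field; rewrite gt_eqF// ltr_wpDl.
  by rewrite ler_piMr ?divr_ge0 ?(ltW e0)// ler_pdivrMr ?ltr_wpDl// mul1r lerDl.
rewrite [e in leRHS]splitr lerD//; apply: le_trans h2.
by rewrite ler_wpM2l.
Qed.

Definition zr (k : 'rV[int]_d) : E := \row_j (k 0 j)%:~R.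

Definition ucube : set E := [set x | forall j, 0 <= x 0 j < 1].

Lemma ucubeE : ucube = boxset (fun=> `[0, 1[%classic).
Proof. by apply/seteqP; split => x h j; have := h j; rewrite /= in_itv. Qed.

Lemma measurable_ucube : measurable ucube.
Proof. by rewrite ucubeE; apply: measurable_boxset. Qed.

Lemma leb_ucube : leb (val @^-1` ucube) = 1%E.
Proof.
rewrite ls_borel; last exact: measurable_ucube.
rewrite ucubeE.
have E1 : lebesgue_measure (`[0, 1[%classic : set R) = 1%E.
  by rewrite lebesgue_measure_itv/= lte_fin ltr01 oppr0 adde0.
rewrite measure_boxset// => [|j]; last by rewrite E1 ltry.
by rewrite E1 big1.
Qed.

Definition floor_rV (x : E) : 'rV[int]_d := \row_j Num.floor (x 0 j).

Lemma ucube_floor (x : E) (k : 'rV[int]_d) : ucube (x - zr k) <-> floor_rV x = k.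
Proof.
split=> [h|<- j].
  apply/rowP => j; rewrite mxE; apply: floor_def.
  by have := h j; rewrite !mxE subr_ge0 ltrBlDr addrC intrD.
rewrite !mxE subr_ge0 ltrBlDr addrC.
by have := floor_itv (x 0 j); rewrite intrD.
Qed.

(** The number of lattice points in [A], as a function of the offset, has mean [|A| / lam^d] over a
    period, so some offset attains at least the mean. Counts are expressed by finite duplicate-free
    sequences, hence no finiteness of the intersection is presupposed. *)
Lemma lattice_pigeonhole (A : set X) (lam : R) : measurable A -> (leb A < +oo)%E -> 0 < lam ->
  exists th : E, exists2 ks : seq 'rV[int]_d, uniq ks &
    fine (leb A) / lam ^+ d <= (size ks)%:R /\
    forall k, k \in ks -> A (pt (th + lam *: zr k)).
Proof.
move=> mA fA l0.
pose v := fine (leb A) / lam ^+ d.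
have v0 : 0 <= v by rewrite divr_ge0 ?fine_ge0// exprn_ge0// ltW.
apply/not_existsP => Hn.
have H (th : E) (ks : seq 'rV[int]_d) : uniq ks -> (forall k, k \in ks -> A (pt (th + lam *: zr k))) ->
    (size ks)%:R < v.
  move=> uks hks; rewrite ltNge; apply/negP => hv; apply: (Hn th).
  by exists ks.
pose S : set X := affX lam 0 @^-1` A.
have mS : measurable S by exact: measurable_affX_set.
have SE : leb S = v%:E.
  rewrite leb_affX// -[in LHS](@fineK _ (leb A)) ?ge0_fin_numE// -EFinM.
  by rewrite mulrC.
pose C k : set X := affX 1 (- zr k) @^-1` (val @^-1` ucube).
have mC k : measurable (C k).
  apply: measurable_affX_set => //.
  by apply: measurable_ls_set; exact: measurable_ucube.
have CE k x : C k x <-> floor_rV (val x) = k.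
  by rewrite -ucube_floor /C /= val_affX scale1r.
(* The pieces of the rescaled set in the unit cells, numbered by the countable encoding of integer
   vectors; codes of no vector give the empty set. *)
pose F i : set X := if pickle_inv i is Some k then S `&` C k else set0.
have mF i : measurable (F i).
  by rewrite /F; case: pickle_inv => [k|]; [exact: measurableI|exact: measurable0].
have tF : trivIset setT F.
  apply/trivIsetP => i j _ _ ij; rewrite -subset0 => x []; rewrite /F.
  have hi := @pickle_invK 'rV[int]_d i; have hj := @pickle_invK 'rV[int]_d j.
  case: (pickle_inv i) hi => // k /= ki [_ /CE fk].
  case: (pickle_inv j) hj => // k' /= kj [_ /CE fk'].
  by move: ij; rewrite -ki -kj -fk -fk' eqxx.
have UF : \bigcup_i F i = S.
  apply/seteqP; split=> [x [i _]|x Sx].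
    by rewrite /F; case: pickle_inv => // k [].
  exists (pickle (floor_rV (val x))) => //; rewrite /F pickleK_inv; split => //.
  by apply/CE.
have sF := @measure_semi_sigma_additive _ _ _ leb F mF tF.
have {}sF : (\sum_(0 <= i < n) leb (F i))%E @[n --> \oo] --> v%:E.
  by rewrite -SE -UF; apply: sF; rewrite UF.
have vgt0 : 0 < v by have := H 0 [::] isT; apply.
(* If every count is below [v], all are at most the largest natural number [m] below [v]: a uniform
   gap, which survives integration and the limit of partial sums. *)
have [m mv hm] : exists2 m, m%:R < v & forall n, n%:R < v -> (n <= m)%N.
  have ub n : n%:R < v -> (n <= (Num.truncn v).+1)%N.
    by move=> nv; rewrite -(ler_nat R) ltW// (lt_trans nv)// truncnS_gt.
  have e0 : exists n, n%:R < v by exists 0%N.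
  by case: (ex_maxnP e0 ub) => m mv hm; exists m.
have bound n : (\sum_(0 <= i < n) leb (F i) <= (m%:R)%:E)%E.
  (* Each piece moved back to the unit cube: at an offset [u], the number of [D i] containing [u] is
     a count of lattice points. *)
  pose D i : set X := if pickle_inv i is Some k then val @^-1` ucube `&` affX 1 (zr k) @^-1` S else set0.
  have mU : measurable (val @^-1` ucube) by apply: measurable_ls_set; exact: measurable_ucube.
  have mD i : measurable (D i).
    rewrite /D; case: pickle_inv => [k|]; last exact: measurable0.
    apply: measurableI => //.
    exact: measurable_affX_set.
  have FD i : leb (F i) = (\int[leb]_x (\1_(D i) x)%:E)%E.
    rewrite integral_indic// setIT /D /F; case: pickle_inv => // k.
    have -> : val @^-1` ucube `&` affX 1 (zr k) @^-1` S = affX 1 (zr k) @^-1` (S `&` C k).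
      rewrite preimage_setI setIC; congr (_ `&` _); apply/seteqP.
      by split => x; rewrite /C /= !val_affX !scale1r addrK.
    by symmetry; apply: leb_shiftX; exact: measurableI.
  under eq_bigr do rewrite FD.
  rewrite -ge0_integral_sum//; last first.
    by move=> i; apply/measurable_EFinP; exact: measurable_indic.
  apply: (@le_trans _ _ (\int[leb]_x (m%:R * \1_(val @^-1` ucube) x)%:E)%E); last first.
    under eq_integral do rewrite EFinM.
    rewrite ge0_integralZl_EFin//; last by apply/measurable_EFinP; exact: measurable_indic.
    rewrite integral_indic// setIT [X in (_ * X)%E](_ : _ = 1%E) ?mule1//.
    exact: leb_ucube.
  apply: ge0_le_integral => //.
  - by move=> x _; apply: sume_ge0.
  - apply: emeasurable_sum => i.
    by apply/measurable_EFinP; exact: measurable_indic.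
  - by apply/measurable_EFinP; apply: measurable_funM => //; exact: measurable_indic.
  move=> u _; rewrite sumEFin lee_fin.
  have [Uu|nU] := pselect (ucube (val u)); last first.
    rewrite big1 ?mulr_ge0// => i _; rewrite indicE memNset// /D.
    by case: pickle_inv => // k [].
  rewrite [X in _ <= _ * X]indicE mem_set// mulr1.
  pose g i := if u \in D i then @pickle_inv 'rV[int]_d i else None.
  have -> : \sum_(0 <= i < n) \1_(D i) u = (size (pmap g (iota 0 n)))%:R :> R.
    rewrite size_pmap -sum1_count natr_sum [RHS]big_mkcond /index_iota subn0.
    apply: eq_bigr => i _; rewrite /g indicE; case: (boolP (u \in D i)) => [uD|]//=.
    by move: uD; rewrite inE /D; case: pickle_inv.
  rewrite ler_nat; apply: hm; apply: (H (lam *: val u)).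
    apply: (@pmap_uniq _ _ g pickle); last exact: iota_uniq.
    move=> i; rewrite /g; case: ifP => // _; exact: pickle_invK.
  move=> k; rewrite mem_pmap => /mapP[i _]; rewrite /g; case: ifPn => // uD kE.
  move: uD; rewrite inE /D -kE => -[_].
  by rewrite /S /= /affX /affine ls_ptK scale1r addr0 scalerDr.
have : (v%:E <= (m%:R)%:E)%E.
  rewrite -(cvg_lim _ sF)//; apply: lime_le; first by apply/cvg_ex; exists v%:E.
  exact: nearW.
by rewrite lee_fin leNgt mv.
Qed.

End selection.

Section selection_principle.
Variables (R : realType) (d : nat) (L : lebesgue_space R d).
Local Notation E := 'rV[R]_d.
Local Notation X := (ls_sort L).
Local Notation leb := (ls_mu L).
Local Notation val := (@ls_val R d L).
Local Notation LB := (@lebesgue_borel R).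

(** Mass of the profile [w], rescaled by [s] and placed at [x], that falls outside [A]. The
    indicator of the unit cube as profile gives the time leakage of a packet; the squared transform
    of that indicator gives its frequency leakage. *)
Definition escape (A : set X) (w : X -> R) (s : R) (x : E) : \bar R :=
  (\int[leb]_y (w y * \1_(~` A) (affX s x y))%:E)%E.

(** The two integrands differ only where [affX s x y] falls in the null set between [A] and its
    hull, and affine preimages of null sets are null. *)
Lemma escape_borel (A : set X) (B : set E) (w : X -> R) (s : R) (x : E) : 0 < s ->
  measurable A -> measurable B -> A `<=` val @^-1` B -> leb (val @^-1` B `\` A) = 0%E ->
  integ leb w -> (forall y, 0 <= w y) ->
  (escape A w s x <= escape (val @^-1` B) w s x)%E.
Proof.
move=> s0 mA mB AB BA0 iw w0; have mw := integ_measurable iw.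
have mB' : measurable (val @^-1` B) by exact: measurable_ls_set.
have mi (C : set X) : measurable C ->
    measurable_fun setT (fun y : X => (w y * \1_(~` C) (affX s x y))%:E).
  move=> mC; apply/measurable_EFinP; apply: measurable_funM => //.
  have mi : measurable_fun setT (\1_(~` C) : X -> R).
    by apply: measurable_indic; exact: measurableC.
  exact: (measurableT_comp mi (measurable_affX x s0)).
rewrite le_eqVlt; apply/orP; left; apply/eqP.
apply: ge0_ae_eq_integral => //.
- exact: mi.
- exact: mi.
- by move=> y _; rewrite lee_fin mulr_ge0// indicE.
- by move=> y _; rewrite lee_fin mulr_ge0// indicE.
exists (affX s x @^-1` (val @^-1` B `\` A)); split.
- by apply: measurable_affX_set => //; exact: measurableD.
- have := leb_affX x s0 (measurableD mB' mA).
  by rewrite [X in (_ * X)%E]BA0 mule0.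
move=> y /= /not_implyP[_ h]; have [Ay|nA] := pselect (A (affX s x y)).
  exfalso; apply: h; rewrite !indicE memNset; last by apply.
  by rewrite memNset//; apply; exact: AB.
split => //; apply: contrapT => nB; apply: h.
by rewrite !indicE mem_set// mem_set.
Qed.

(** Tonelli turns the total leakage over positions in [B] into the averaged measure controlled by
    [averaged_translation]. *)
Lemma measurable_escape (B : set E) (w : X -> R) (s : R) : measurable B ->
  integ leb w -> (forall y, 0 <= w y) ->
  measurable_fun setT (fun x : X => escape (val @^-1` B) w s (val x)) /\
  (\int[leb]_(x in val @^-1` B) escape (val @^-1` B) w s (val x) =
    \int[leb]_y ((w y)%:E * leb (shiftd s B (val y))))%E.
Proof.
move=> mB iw w0; have mw := integ_measurable iw.
have mB' : measurable (val @^-1` B) by exact: measurable_ls_set.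
have mJ : measurable ([set z : X * X | ~ B (affine 1 (s *: val z.2) (val z.1))]).
  by apply: measurableC; exact: measurable_joint_shift.
pose J := [set z : X * X | ~ B (affine 1 (s *: val z.2) (val z.1))].
have JE (x y : X) : \1_(~` (val @^-1` B)) (affX s (val x) y) = \1_J (x, y) :> R.
  have e : affine 1 (s *: val y) (val x) = s *: val y + val x.
    by rewrite /affine scale1r addrC.
  by rewrite !indicE; congr (nat_of_bool _)%:R; apply/idP/idP; rewrite !inE /J /= ?val_affX ?e.
have mw2 : measurable_fun setT (fun z : X * X => w z.2).
  exact: (measurableT_comp mw measurable_snd).
have mf (g : X * X -> R) : measurable_fun setT g ->
    measurable_fun setT (fun z : X * X => (w z.2 * g z)%:E).
  by move=> mg; apply/measurable_EFinP; exact: measurable_funM.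
have mJi : measurable_fun setT (\1_J : X * X -> R) by exact: measurable_indic.
split.
  rewrite (_ : (fun x => _) = fubini_F leb (fun z : X * X => (w z.2 * \1_J z)%:E)).
    apply: measurable_fun_fubini_tonelli_F; first exact: mf.
    by move=> z; rewrite lee_fin mulr_ge0// indicE.
  by apply/funext => x; rewrite /fubini_F /escape /=; under eq_integral do rewrite JE.
pose D : set (X * X) := [set z | B (val z.1)].
have mD : measurable D.
  by rewrite -[Y in measurable Y]setTI; exact: (measurableT_comp (@measurable_ls_val _ _ L) measurable_fst).
have mDJ : measurable_fun setT (fun z : X * X => \1_D z * \1_J z : R).
  by apply: measurable_funM => //; exact: measurable_indic.
have f0 (z : X * X) : (0 <= (w z.2 * (\1_D z * \1_J z))%:E)%E.
  by rewrite lee_fin !mulr_ge0// indicE.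
rewrite integral_mkcond.
transitivity (\int[leb]_x \int[leb]_y (w y * (\1_D (x, y) * \1_J (x, y)))%:E)%E.
  apply: eq_integral => x _; rewrite patchE; have [Bx|nB] := boolP (x \in _).
    rewrite /escape; apply: eq_integral => y _; rewrite JE [in RHS]indicE.
    by rewrite mem_set ?mul1r//; move: Bx; rewrite inE.
  rewrite integral0_eq// => y _; rewrite [X in _ * (X * _)]indicE memNset ?mul0r ?mulr0//.
  by move: nB; rewrite notin_setE.
rewrite (fubini_tonelli (fun z : X * X => (w z.2 * (\1_D z * \1_J z))%:E) (mf _ mDJ) f0).
apply: eq_integral => y _ /=.
have mS : measurable (shiftd s B (val y) : set X) by exact: measurable_shiftd.
transitivity (\int[leb]_x ((w y)%:E * (\1_(shiftd s B (val y)) x)%:E))%E.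
  apply: eq_integral => x _; rewrite -EFinM; congr (_ * _)%:E.
  rewrite !indicE -natrM mulnb; congr (_%:R); congr nat_of_bool.
  apply/andP/idP; rewrite !inE /D /J /shiftd /=.
    by [].
  by [].
rewrite ge0_integralZl_EFin//; last by apply/measurable_EFinP; exact: measurable_indic.
by rewrite integral_indic// setIT.
Qed.

(** The total leakage is at most [del * eta], so by Chebyshev the positions leaking [del] or more
    have measure at most [eta]; the pigeonhole is applied to the others. The ratio [c] of spacing to
    scale is 1 for cubes and [2 pi] for frequencies. *)
Lemma lattice_selection (A : set X) (w : X -> R) (c del eta : R) :
  measurable A -> (leb A < +oo)%E -> integ leb w -> (forall y, 0 <= w y) ->
  0 < c -> 0 < del -> 0 < eta ->
  exists2 s0 : R, 0 < s0 & forall s : R, 0 < s -> s <= s0 ->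
    exists th : E, exists2 ks : seq 'rV[int]_d, uniq ks &
      (fine (leb A) - eta) / (c * s) ^+ d <= (size ks)%:R /\
      forall k, k \in ks -> (escape A w s (th + (c * s) *: zr R k) <= del%:E)%E.
Proof.
move=> mA fA iw w0 c0 del0 eta0.
have [B [mB AB BA0]] := ls_regular mA fA.
have mB' : measurable (val @^-1` B) by exact: measurable_ls_set.
have BAE : leb (val @^-1` B) = leb A.
  rewrite -(setDUK AB) measureU//; [|exact: measurableD|]; last first.
    by rewrite -subset0 => x [? []].
  by rewrite [X in (_ + X)%E]BA0 adde0.
have fB : (LB d B < +oo)%E by rewrite -(ls_borel L)// BAE.
have [s0 s00 hs] := averaged_translation mB fB iw w0 (mulr_gt0 del0 eta0).
exists s0 => // s sgt0 ss0.
have [mg gE] := measurable_escape s mB iw w0.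
pose g x := escape (val @^-1` B) w s (val x).
have g0 x : (0 <= g x)%E.
  by apply: integral_ge0 => y _; rewrite lee_fin mulr_ge0// indicE.
have mgB : measurable_fun (val @^-1` B) g by apply: measurable_funS mg.
pose G : set X := val @^-1` B `&` [set x | (del%:E <= `|g x|)%E].
have mG : measurable G.
  by apply: emeasurable_fun_c_infty => //; exact: measurableT_comp.
have G1 : (del%:E * leb G <= (del * eta)%:E)%E.
  apply: le_trans (le_integral_abse leb mB' mgB del0) _.
  under eq_integral do rewrite gee0_abs//.
  by rewrite /g gE; exact: hs.
have G2 : (leb G <= eta%:E)%E.
  by move: G1; rewrite EFinM lee_pmul2l// lte_fin.
pose A' := val @^-1` B `\` G.
have mA' : measurable A' by exact: measurableD.
have A'B : (leb A' <= leb (val @^-1` B))%E.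
  by apply: le_measure; rewrite ?inE// => x [].
have fA' : (leb A' < +oo)%E by apply: le_lt_trans A'B _; rewrite BAE.
have hA' : fine (leb A) - eta <= fine (leb A').
  rewrite lerBlDr -lee_fin EFinD !fineK ?ge0_fin_numE// -BAE.
  have -> : val @^-1` B = A' `|` G.
    by rewrite /A' setUC setDUK//; move=> x [].
  apply: (@le_trans _ _ (leb A' + leb G)%E); first exact: measureU2.
  exact: leeD2l.
have cs0 : 0 < c * s by rewrite mulr_gt0.
have [th [ks uks [hsz hk]]] := lattice_pigeonhole mA' fA' cs0.
exists th; exists ks => //; split.
  by apply: le_trans hsz; rewrite ler_pM2r// invr_gt0 exprn_gt0.
move=> k /hk [Bk nG].
apply: le_trans (escape_borel _ sgt0 mA mB AB BA0 iw w0) _.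
rewrite leNgt; apply/negP => hlt; apply: nG; split => //=.
by rewrite gee0_abs// /g ls_ptK ltW.
Qed.

End selection_principle.

(** * Fourier integral and Plancherel theorem *)

Section dot_theory.
Variables (R : realType) (d : nat).
Implicit Types x y z : 'rV[R]_d.

Lemma dotC x y : dot x y = dot y x.
Proof. by apply: eq_bigr => i _; rewrite mulrC. Qed.

Lemma dotDl x y z : dot (x + y) z = dot x z + dot y z.
Proof. by rewrite /dot -big_split; apply: eq_bigr => i _; rewrite mxE mulrDl. Qed.

Lemma dotDr x y z : dot z (x + y) = dot z x + dot z y.
Proof. by rewrite !(dotC z) dotDl. Qed.

Lemma dotZl a x z : dot (a *: x) z = a * dot x z.
Proof. by rewrite /dot mulr_sumr; apply: eq_bigr => i _; rewrite mxE mulrA. Qed.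

Lemma dotZr a x z : dot z (a *: x) = a * dot z x.
Proof. by rewrite !(dotC z) dotZl. Qed.

Lemma dotNl x z : dot (- x) z = - dot x z.
Proof. by rewrite -scaleN1r dotZl mulN1r. Qed.

Lemma dotBl x y z : dot (x - y) z = dot x z - dot y z.
Proof. by rewrite dotDl dotNl. Qed.

End dot_theory.

Lemma Cinteg_expiM (R : realType) d' (Y : measurableType d') (mu : {measure set Y -> \bar R})
    (f : Y -> R[i]) (g : Y -> R) : Cinteg mu f -> measurable_fun setT g ->
  Cinteg mu (fun x => f x * expi (g x)).
Proof.
move=> cf mg; apply: (Cinteg_le _ (Cinteg_normc cf)).
  by apply: CmeasM; [exact: (Cinteg_meas cf)|exact: Cmeas_expi].
by move=> x; rewrite Normc.normcM normc_expi mulr1.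
Qed.

Lemma realCK (R : realType) (a : R) (z : R[i]) : a != 0 -> (a^-1)%:C * (a%:C * z) = z.
Proof. by move=> a0; rewrite mulrA -real_complexM mulVf// mul1r. Qed.

Section fourier_integral_theory.
Variables (R : realType) (d : nat) (L : lebesgue_space R d).
Local Notation E := 'rV[R]_d.
Local Notation X := (ls_sort L).
Local Notation leb := (ls_mu L).
Local Notation val := (@ls_val R d L).

Definition fnorm : R := (2 * pi) `^ (- (d%:R / 2)).

Lemma fnorm_gt0 : 0 < fnorm.
Proof. by rewrite powR_gt0// mulr_gt0// pi_gt0. Qed.

Lemma fnorm2 : fnorm ^+ 2 = (2 * pi) ^- d.
Proof.
have p0 : 0 <= 2 * pi :> R by rewrite mulr_ge0// pi_ge0.
rewrite /fnorm -powR_mulrn ?powR_ge0// -powRrM.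
by rewrite mulNr divfK ?pnatr_eq0// powRN powR_mulrn.
Qed.

Lemma fnormE : fnorm = (2 * pi) `^ (- (d%:R / 2)). Proof. by []. Qed.

(* From here on the normalising power is a symbol known through [fnorm_gt0] and [fnorm2]; [fnormE]
   keeps the link with the definition of the transform. *)
Opaque fnorm.

Definition FT (f : X -> R[i]) (xi : E) : R[i] :=
  fnorm%:C * Cintegral leb (fun t => f t * expi (- dot xi (val t))).

Lemma measurable_dot_ls (xi : E) : measurable_fun setT (fun t : X => dot xi (val t)).
Proof.
rewrite /dot; apply: measurable_sum => i.
by apply: measurable_funM => //; exact: measurable_ls_coor.
Qed.

Lemma measurable_dot_ls2 : measurable_fun setT (fun z : X * X => dot (val z.1) (val z.2)).
Proof.
rewrite /dot; apply: measurable_sum => i; apply: measurable_funM.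
  exact: (measurableT_comp (@measurable_ls_coor _ _ L i) measurable_fst).
exact: (measurableT_comp (@measurable_ls_coor _ _ L i) measurable_snd).
Qed.

Lemma Cinteg_FT_integrand f xi : Cinteg leb f ->
  Cinteg leb (fun t : X => f t * expi (- dot xi (val t))).
Proof.
move=> cf; apply: (Cinteg_expiM cf); apply: measurable_funN.
exact: measurable_dot_ls.
Qed.

Definition FTbound (f : X -> R[i]) : R := fnorm * (2 * \int[leb]_x Normc.normc (f x)).

Lemma normc_FT_le f xi : Cinteg leb f -> Normc.normc (FT f xi) <= FTbound f.
Proof.
move=> cf; rewrite /FT Normc.normcM normc_real gtr0_norm ?fnorm_gt0//.
rewrite ler_pM2l ?fnorm_gt0//; apply: normc_Cintegral_le.
- exact/Cinteg_meas/Cinteg_FT_integrand.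
- exact: Cinteg_normc.
- by move=> x; rewrite Normc.normcM normc_expi mulr1.
Qed.

Lemma Cmeas_FT f : Cmeas f -> Cmeas (fun x : X => FT f (val x)).
Proof.
move=> mf; apply: CmeasM; first exact: Cmeas_cst.
apply: (Cmeas_Cintegral_prod leb (f := fun z : X * X => f z.2 * expi (- dot (val z.1) (val z.2)))).
apply: CmeasM; first exact: (Cmeas_comp measurable_snd mf).
by apply: Cmeas_expi; apply: measurable_funN; exact: measurable_dot_ls2.
Qed.

Lemma Cinteg_FTM f w : Cinteg leb f -> Cinteg leb w ->
  Cinteg leb (fun x : X => FT f (val x) * w x).
Proof.
move=> cf cw; apply: (@Cinteg_le _ _ _ _ _ (fun x => FTbound f * Normc.normc (w x))).
- by apply: CmeasM; [exact/Cmeas_FT/(Cinteg_meas cf)|exact: Cinteg_meas cw].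
- by apply: integZl; exact: Cinteg_normc.
- by move=> x; rewrite Normc.normcM ler_wpM2r ?normc_ge0// normc_FT_le.
Qed.

Lemma FTD f g xi : Cinteg leb f -> Cinteg leb g ->
  FT (fun x => f x + g x) xi = FT f xi + FT g xi.
Proof.
move=> cf cg; rewrite /FT -mulrDr -CintegralD; try exact: Cinteg_FT_integrand.
by congr (_ * _); apply: eq_Cintegral => x; rewrite mulrDl.
Qed.

Lemma FTZ c f xi : Cinteg leb f -> FT (fun x => c * f x) xi = c * FT f xi.
Proof.
move=> cf; rewrite /FT [RHS]mulrCA -[X in _ = _ * X]CintegralZl; last exact: Cinteg_FT_integrand.
by congr (_ * _); apply: eq_Cintegral => x; rewrite mulrA.
Qed.

Lemma FTN f xi : Cinteg leb f -> FT (fun x => - f x) xi = - FT f xi.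
Proof.
move=> cf; rewrite -mulN1r -FTZ//; congr (_ * _); apply: eq_Cintegral => x.
by rewrite mulN1r.
Qed.

Lemma FTB f g xi : Cinteg leb f -> Cinteg leb g ->
  FT (fun x => f x - g x) xi = FT f xi - FT g xi.
Proof. by move=> cf cg; rewrite FTD ?FTN//; exact: CintegN. Qed.

Lemma eq_FT f g : f =1 g -> FT f =1 FT g.
Proof. by move=> fg xi; congr (_ * _); apply: eq_Cintegral => x; rewrite fg. Qed.

Lemma FT_modulate f p xi : FT (fun t => f t * expi (dot p (val t))) xi = FT f (xi - p).
Proof.
congr (_ * _); apply: eq_Cintegral => x.
by rewrite -mulrA -expiD dotBl; congr (_ * expi _); ring.
Qed.

Lemma FT_conj f xi : Cinteg leb f -> conjc (FT f xi) =
  fnorm%:C * Cintegral leb (fun t => conjc (f t) * expi (dot xi (val t))).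
Proof.
move=> cf; rewrite /FT conjcM -Cintegral_conj; last exact: Cinteg_FT_integrand.
rewrite conjc_real; congr (_ * _); apply: eq_Cintegral => x.
by rewrite conjcM conj_expi opprK.
Qed.

(** Fubini for [u(x) w(y) exp(-i x.y)]: the kernel is symmetric in [x] and [y], and the modulus is
    the product of two integrable functions. *)
Lemma FT_multiplication u w : Cinteg leb u -> Cinteg leb w ->
  Cintegral leb (fun x => FT u (val x) * w x) = Cintegral leb (fun x => u x * FT w (val x)).
Proof.
move=> cu cw; pose Q (z : X * X) := u z.1 * w z.2 * expi (- dot (val z.1) (val z.2)).
have mu_ := Cinteg_meas cu; have mw := Cinteg_meas cw.
have mQ : Cmeas Q.
  apply: CmeasM; first apply: CmeasM.
  - exact: (Cmeas_comp measurable_fst mu_).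
  - exact: (Cmeas_comp measurable_snd mw).
  - by apply: Cmeas_expi; apply: measurable_funN; exact: measurable_dot_ls2.
have hQ z : Normc.normc (Q z) = Normc.normc (u z.1) * Normc.normc (w z.2).
  by rewrite !Normc.normcM normc_expi mulr1.
have iu := Cinteg_normc cu; have iw := Cinteg_normc cw.
have ih : integ (leb \x leb)%E (fun z : X * X => Normc.normc (u z.1) * Normc.normc (w z.2)).
  have mh : measurable_fun setT (fun z : X * X => Normc.normc (u z.1) * Normc.normc (w z.2)).
    apply: measurable_funM.
      exact: (measurableT_comp (measurable_normc mu_) measurable_fst).
    exact: (measurableT_comp (measurable_normc mw) measurable_snd).
  apply: (integ_dom_prod mh mh) => [z|].
    by rewrite ger0_norm// mulr_ge0// normc_ge0.
  have nE (h : X -> R[i]) : Cmeas h -> measurable_fun setT (fun x => (Normc.normc (h x))%:E).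
    by move=> mh'; apply/measurable_EFinP; exact: measurable_normc.
  have -> : (\int[leb]_x \int[leb]_y (Normc.normc (u x) * Normc.normc (w y))%:E)%E =
      (\int[leb]_x ((\int[leb]_y Normc.normc (w y))%:E * (Normc.normc (u x))%:E))%E.
    apply: eq_integral => x _.
    transitivity (\int[leb]_y ((Normc.normc (u x))%:E * (Normc.normc (w y))%:E))%E.
      by apply: eq_integral => y _; rewrite EFinM.
    rewrite ge0_integralZl_EFin ?normc_ge0//; last 2 first.
    - by move=> y _; rewrite lee_fin normc_ge0.
    - exact: nE.
    by rewrite (integ_fineK iw) muleC.
  rewrite ge0_integralZl_EFin//; last 3 first.
  - by move=> x _; rewrite lee_fin normc_ge0.
  - by apply/measurable_EFinP; exact: measurable_normc.
  - by apply: Rintegral_ge0 => x _; exact: normc_ge0.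
  by rewrite (integ_fineK iu) -EFinM ltry.
have cQ : Cinteg (leb \x leb)%E Q.
  by apply: (Cinteg_le mQ ih) => z; rewrite hQ.
have c1 x : Cinteg leb (fun y => Q (x, y)).
  rewrite /Q /=; under eq_fun do rewrite -mulrA.
  by apply: CintegZl; exact: Cinteg_FT_integrand.
have c2 y : Cinteg leb (fun x => Q (x, y)).
  rewrite /Q /=; under eq_fun do rewrite mulrAC mulrC dotC.
  by apply: CintegZl; exact: Cinteg_FT_integrand.
have HF := Cintegral_fubini cQ c1 c2.
pose K (f : X -> R[i]) (y : X) := Cintegral leb (fun x => f x * expi (- dot (val y) (val x))).
have FK f y : FT f (val y) = fnorm%:C * K f y by [].
have f0 : fnorm != 0 := lt0r_neq0 fnorm_gt0.
have E2 y : Cintegral leb (fun x => Q (x, y)) = w y * K u y.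
  rewrite -CintegralZl; last exact: Cinteg_FT_integrand.
  by apply: eq_Cintegral => x; rewrite /Q /= dotC mulrA [w y * _]mulrC.
have E1 x : Cintegral leb (fun y => Q (x, y)) = u x * K w x.
  rewrite -CintegralZl; last exact: Cinteg_FT_integrand.
  by apply: eq_Cintegral => y; rewrite /Q /= mulrA.
have cK f g : Cinteg leb f -> Cinteg leb g -> Cinteg leb (fun y => g y * K f y).
  move=> cf cg; rewrite (_ : (fun y => _) = (fun y => (fnorm^-1)%:C * (FT f (val y) * g y))).
    by apply: CintegZl; exact: Cinteg_FTM.
  apply/funext => y; rewrite FK -(mulrA (fnorm%:C)) (realCK _ f0).
  exact: mulrC.
transitivity (fnorm%:C * Cintegral leb (fun y => w y * K u y)).
  rewrite -CintegralZl; last exact: cK.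
  by apply: eq_Cintegral => y; rewrite FK -mulrA [K u y * _]mulrC.
rewrite -(eq_Cintegral _ E2) -HF (eq_Cintegral _ E1) -CintegralZl; last exact: cK.
by apply: eq_Cintegral => x; rewrite FK mulrCA.
Qed.

End fourier_integral_theory.

(** * Exponential damping and the product Poisson kernel *)

Section cauchy_kernel.
Variables (R : realType) (d : nat) (L : lebesgue_space R d).
Local Notation E := 'rV[R]_d.
Local Notation X := (ls_sort L).
Local Notation leb := (ls_mu L).
Local Notation val := (@ls_val R d L).
Local Notation pt := (@ls_pt R d L).
Local Notation fn := (fnorm R d).

(* Product exponentials instead of Gaussians: the transform is an explicit product of
   Cauchy kernels, so no Gaussian integral is needed. *)
Definition expdecay (s : R) (x : E) : R := \prod_j expR (- (s * `|x 0 j|)).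

Definition cauchyker (x : E) : R := \prod_j (2 / (1 + x 0 j ^+ 2)).

Lemma expdecay_gt0 s x : 0 < expdecay s x.
Proof. by apply: prodr_gt0 => j _; exact: expR_gt0. Qed.

Lemma expdecay_le1 s x : 0 <= s -> expdecay s x <= 1.
Proof.
move=> s0; rewrite -[leRHS](_ : \prod_(j < d) (1 : R) = 1); last by rewrite big1.
apply: ler_prod => j _; by rewrite expR_ge0 -expR0 ler_expR oppr_le0 mulr_ge0.
Qed.

Lemma ler_expdecay s t x : 0 <= s -> s <= t -> expdecay t x <= expdecay s x.
Proof.
move=> s0 st; apply: ler_prod => j _.
by rewrite expR_ge0 ler_expR lerN2 ler_wpM2r.
Qed.

Lemma measurable_expdecay s : measurable_fun setT (fun x : X => expdecay s (val x)).
Proof.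
apply: measurable_prod => j _; apply: (measurableT_comp (@measurable_expR R)).
apply: measurable_funN; apply: measurable_funM => //.
by apply: (measurableT_comp (@normr_measurable R setT)); exact: measurable_ls_coor.
Qed.

Lemma expdecay_affX s (x : X) : 0 < s -> expdecay s (val x) = expdecay 1 (val (affX s 0 x)).
Proof.
move=> s0; apply: eq_bigr => j _.
by rewrite val_affX addr0 mxE mul1r normrM (gtr0_norm s0).
Qed.

Lemma integ_expdecay s : 0 < s -> integ leb (fun x : X => expdecay s (val x)).
Proof.
move=> s0; rewrite (_ : (fun x => _) = (fun x => expdecay 1 (val (affX s 0 x)))).
  apply: (@integ_affX R d L s 0 (fun x => expdecay 1 (val x))) => //.
  have i1 (j : 'I_d) : integ (@lebesgue_measure R) (fun x => expR (- (1 * `|x|))).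
    by under eq_fun do rewrite mul1r; exact: integ_expNabs.
  exact: (@integ_prod R d L (fun _ x => expR (- (1 * `|x|))) (fun _ x => expR_ge0 _) i1).1.
by apply/funext => x; exact: expdecay_affX.
Qed.

Lemma FT_expdecay s xi : 0 < s -> FT (fun x : X => (expdecay s (val x))%:C) xi =
  (fn * (s ^- d * cauchyker (s^-1 *: xi)))%:C.
Proof.
move=> s0; rewrite /FT real_complexM; congr (_ * _).
pose g (y : X) := \prod_j ((expR (- `|val y 0 j|))%:C * expi (- ((s^-1 *: xi) 0 j * val y 0 j))).
have [cg Eg] := @Cinteg_prod R d L (fun j x => (expR (- `|x|))%:C * expi (- ((s^-1 *: xi) 0 j * x)))
  (fun j => (fourier_expNabs _).1).
transitivity (Cintegral leb (fun x => g (affX s 0 x))).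
  apply: eq_Cintegral => x; rewrite /g big_split /=; congr (_ * _).
    rewrite /expdecay (big_morph _ (@real_complexM R) (erefl _)).
    by apply: eq_bigr => j _; rewrite val_affX addr0 mxE normrM (gtr0_norm s0).
  rewrite -(big_morph _ (@expiD R) (@expi0 R)); congr (expi _).
  rewrite /dot -sumrN; apply: eq_bigr => j _.
  by rewrite val_affX addr0 !mxE mulrACA mulVf ?mul1r// gt_eqF.
rewrite Cintegral_affX// Eg real_complexM; congr (_ * _).
rewrite /cauchyker (big_morph _ (@real_complexM R) (erefl _)).
by apply: eq_bigr => j _; rewrite (fourier_expNabs _).2.
Qed.

Lemma cauchyker_ge0 x : 0 <= cauchyker x.
Proof. by apply: prodr_ge0 => j _; rewrite divr_ge0// addr_ge0// sqr_ge0. Qed.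

Lemma cauchyker_le x : cauchyker x <= 2 ^+ d.
Proof.
rewrite -[leRHS](_ : \prod_(j < d) (2 : R) = _); last by rewrite prodr_const card_ord.
apply: ler_prod => j _; rewrite divr_ge0 ?addr_ge0 ?sqr_ge0//=.
by rewrite ler_pdivrMr ?ler_peMr ?lerDl ?sqr_ge0// ltr_wpDr ?sqr_ge0.
Qed.

Lemma cauchykerN x : cauchyker (- x) = cauchyker x.
Proof. by apply: eq_bigr => j _; rewrite mxE sqrrN. Qed.

Lemma integ_cauchyker : integ leb (fun x => cauchyker (val x)) /\
  \int[leb]_x cauchyker (val x) = (2 * pi) ^+ d.
Proof.
have gE : (fun x : R => 2 / (1 + x ^+ 2)) = (fun x => (2 * pi) * (pi^-1 * (1 + x ^+ 2)^-1)).
  by apply/funext => x; rewrite mulrA -(mulrA 2) divff ?mulr1// gt_eqF// pi_gt0.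
have [] := @integ_prod R d L (fun _ x => 2 / (1 + x ^+ 2)).
- by move=> _ x; rewrite divr_ge0// addr_ge0// sqr_ge0.
- by move=> _; rewrite gE; apply: integZl; exact: integ_cauchy.
move=> i1 e1; split => //; rewrite /cauchyker e1 gE.
have c1 : \int[@lebesgue_measure R]_x (2 * pi * (pi^-1 / (1 + x ^+ 2))) = 2 * pi.
  rewrite RintegralZl ?measurableT//; last exact: integ_cauchy.
  by rewrite /Rintegral integral_cauchy /= mulr1.
by rewrite c1 prodr_const card_ord.
Qed.

(** The product over the coordinates of the Poisson kernels [s / (pi (s^2 + z_j^2))], written so
    that it appears as the transform of [expdecay s]. *)
Definition poisson (s : R) (z : E) : R := fn ^+ 2 * s ^- d * cauchyker (s^-1 *: z).

Lemma poisson_ge0 s z : 0 < s -> 0 <= poisson s z.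
Proof.
move=> s0; apply: mulr_ge0; last exact: cauchyker_ge0.
by apply: mulr_ge0; rewrite ?sqr_ge0// invr_ge0 exprn_ge0// ltW.
Qed.

Lemma poissonN s z : poisson s (- z) = poisson s z.
Proof. by rewrite /poisson scalerN cauchykerN. Qed.

Lemma poissonBC s x y : poisson s (x - y) = poisson s (y - x).
Proof. by rewrite -poissonN opprB. Qed.

Definition poisson_max (s : R) : R := fn ^+ 2 * s ^- d * 2 ^+ d.

Lemma poisson_le s z : 0 < s -> poisson s z <= poisson_max s.
Proof.
move=> s0; rewrite ler_wpM2l ?cauchyker_le// mulr_ge0 ?sqr_ge0//.
by rewrite invr_ge0 exprn_ge0// ltW.
Qed.

Lemma integ_poisson s x : 0 < s -> integ leb (fun y : X => poisson s (val y - x)) /\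
  \int[leb]_y poisson s (val y - x) = 1.
Proof.
move=> s0; have [i1 e1] := integ_cauchyker.
have sV0 : 0 < s^-1 by rewrite invr_gt0.
have E1 : (fun y : X => poisson s (val y - x)) =
    (fun y => fn ^+ 2 * s ^- d * cauchyker (val (affX s^-1 (- (s^-1 *: x)) y))).
  by apply/funext => y; rewrite val_affX /poisson scalerBr.
rewrite E1.
have i2 := @integ_affX R d L s^-1 (- (s^-1 *: x)) (fun y => cauchyker (val y)) sV0 i1.
split; first exact: integZl.
rewrite RintegralZl ?measurableT//.
rewrite (@Rintegral_affX R d L s^-1 (- (s^-1 *: x)) (fun y => cauchyker (val y)))// e1 fnorm2.
rewrite exprVn invrK [s ^+ d * _]mulrC mulrACA mulVf ?mulVf ?mulr1//.
  by rewrite gt_eqF// exprn_gt0.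
by rewrite gt_eqF// exprn_gt0// mulr_gt0// pi_gt0.
Qed.

Lemma measurable_poisson2 s : measurable_fun setT (fun z : X * X => poisson s (val z.2 - val z.1)).
Proof.
apply: measurable_funM => //; apply: measurable_prod => j _.
rewrite (_ : (fun z => _) = (fun z : X * X => 2 * (oneDsqr (s^-1 * (val z.2 0 j - val z.1 0 j)))^-1)); last first.
  by apply/funext => z; rewrite !mxE /oneDsqr.
apply: measurable_funM => //.
have mo : measurable_fun setT (fun x : measurableTypeR R => (oneDsqr x)^-1).
  by apply: continuous_measurable_fun; exact: continuous_oneDsqrV.
apply: (measurableT_comp mo); apply: measurable_funM => //; apply: measurable_funB.
  exact: (measurableT_comp (@measurable_ls_coor _ _ L j) measurable_snd).
exact: (measurableT_comp (@measurable_ls_coor _ _ L j) measurable_fst).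
Qed.

Lemma measurable_poisson s x : measurable_fun setT (fun y : X => poisson s (val y - x)).
Proof.
have := measurableT_comp (measurable_poisson2 s) (measurable_pair1 (pt x)).
by rewrite /comp /= ls_ptK.
Qed.

End cauchy_kernel.

(** * Damped energy and contractivity of the transform *)

Section energy.
Variables (R : realType) (d : nat) (L : lebesgue_space R d).
Local Notation E := 'rV[R]_d.
Local Notation X := (ls_sort L).
Local Notation leb := (ls_mu L).
Local Notation val := (@ls_val R d L).
Local Notation fn := (fnorm R d).
Implicit Types (h : X -> R[i]) (s : R).

Definition smooth s h (x : E) : R[i] :=
  Cintegral leb (fun y => h y * (poisson s (val y - x))%:C).

Lemma Cinteg_poissonM s h x : 0 < s -> Cinteg leb h ->
  Cinteg leb (fun y => h y * (poisson s (val y - x))%:C).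
Proof.
move=> s0 ch; refine (@Cinteg_le _ _ _ _ _ (fun y => poisson_max d s * Normc.normc (h y)) _ _ _).
- apply: CmeasM; first exact: Cinteg_meas ch.
  by apply: Cmeas_real; exact: measurable_poisson.
- by apply: integZl; exact: Cinteg_normc.
- move=> y; rewrite Normc.normcM normc_real ger0_norm ?poisson_ge0// mulrC.
  by rewrite ler_wpM2r ?normc_ge0// poisson_le.
Qed.

(** Test function for the multiplication formula: its product with the transform of [h] is the
    damped spectral energy, while its own transform is the conjugate of the Poisson smoothing of
    [h]. *)
Definition damped s h (t : X) : R[i] := (expdecay s (val t))%:C * conjc (FT h (val t)).

Lemma Cinteg_damped s h : 0 < s -> Cinteg leb h -> Cinteg leb (damped s h).
Proof.
move=> s0 ch; have cG : Cinteg leb (fun x : X => (expdecay s (val x))%:C).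
  by apply: Cinteg_real; exact: integ_expdecay.
have := Cinteg_conj (Cinteg_FTM ch cG).
under eq_fun do rewrite conjcM conjc_real mulrC; exact.
Qed.

(** The multiplication formula with the modulated exponential, whose transform is a translated
    Poisson kernel. *)
Lemma FT_damped s h xi : 0 < s -> Cinteg leb h ->
  FT (damped s h) xi = conjc (smooth s h xi).
Proof.
move=> s0 ch; have cG : Cinteg leb (fun x : X => (expdecay s (val x))%:C).
  by apply: Cinteg_real; exact: integ_expdecay.
have cGe : Cinteg leb (fun x : X => (expdecay s (val x))%:C * expi (dot xi (val x))).
  by apply: Cinteg_expiM => //; exact: measurable_dot_ls.
have cd := Cinteg_damped s0 ch.
apply: (can_inj (@conjcK R)); rewrite conjcK FT_conj//.
transitivity (fn%:C * Cintegral leb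
    (fun t => FT h (val t) * ((expdecay s (val t))%:C * expi (dot xi (val t))))).
  congr (_ * _); apply: eq_Cintegral => t.
  by rewrite /damped conjcM conjc_real conjcK [_%:C * FT h _]mulrC -mulrA.
rewrite FT_multiplication// -CintegralZl; last first.
  have := Cinteg_FTM cGe ch; under eq_fun do rewrite mulrC; exact.
apply: eq_Cintegral => y; rewrite FT_modulate FT_expdecay// mulrCA -real_complexM.
by congr (_ * _%:C); rewrite /poisson !mulrA expr2.
Qed.

Lemma energy_eq s h : 0 < s -> Cinteg leb h ->
  integ leb (fun x => expdecay s (val x) * sqn (FT h (val x))) /\
  \int[leb]_x (expdecay s (val x) * sqn (FT h (val x))) =
  \int[leb]_x Re (h x * conjc (smooth s h (val x))).
Proof.
move=> s0 ch; have cd := Cinteg_damped s0 ch.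
have cF := Cinteg_FTM ch cd.
have E1 x : FT h (val x) * damped s h x = (expdecay s (val x) * sqn (FT h (val x)))%:C.
  by rewrite /damped mulrCA mul_conj -real_complexM.
split; first by have [+ _] := cF; under eq_fun do rewrite E1.
have := FT_multiplication ch cd.
rewrite (eq_Cintegral _ E1) Cintegral_real => /(congr1 (@complex.Re R)) /= ->.
by apply: eq_Rintegral => x _; rewrite FT_damped.
Qed.

(* Schur's test: h(x) conj(h(y)) <= (|h(x)|^2 + |h(y)|^2) / 2 and the kernel has
   integral 1 in each variable. *)
Lemma energy_le s h : 0 < s -> Cinteg leb h -> L2 leb h ->
  \int[leb]_x (expdecay s (val x) * sqn (FT h (val x))) <= nsq leb h.
Proof.
move=> s0 ch [mh lh]; have cd := Cinteg_damped s0 ch.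
have [_ ->] := energy_eq s0 ch.
pose Q (z : X * X) := sqn (h z.2) * poisson s (val z.2 - val z.1).
have Q0 z : 0 <= Q z by rewrite mulr_ge0 ?sqn_ge0 ?poisson_ge0.
have mQ : measurable_fun setT Q.
  apply: measurable_funM; last exact: measurable_poisson2.
  exact: (measurableT_comp (measurable_sqn mh) measurable_snd).
have Q1 y : integ leb (fun x => Q (x, y)).
  rewrite /Q /=; apply: integZl; under eq_fun do rewrite poissonBC.
  exact: (integ_poisson _ _ s0).1.
have Q1E y : \int[leb]_x Q (x, y) = sqn (h y).
  rewrite /Q /= RintegralZl ?measurableT//.
    under eq_Rintegral do rewrite poissonBC.
    by rewrite (integ_poisson _ _ s0).2 mulr1.
  by under eq_fun do rewrite poissonBC; exact: (integ_poisson _ _ s0).1.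
have Q2 x : integ leb (fun y => Q (x, y)).
  apply: (integ_le _ (integZl (poisson_max d s) lh)).
    exact: (measurableT_comp mQ (measurable_pair1 x)).
  by move=> y; rewrite ger0_norm// /Q /= mulrC ler_wpM2r ?sqn_ge0// poisson_le.
have iQ : integ (leb \x leb)%E Q.
  apply: (integ_dom_prod mQ mQ) => [z|]; first by rewrite ger0_norm.
  rewrite (fubini_tonelli (fun z => (Q z)%:E)); last 2 first.
  - exact/measurable_EFinP.
  - by move=> z; rewrite lee_fin.
  rewrite (_ : (fun y => _) = (fun y => (sqn (h y))%:E)); first exact: integ_lty.
  by apply/funext => y; rewrite (integ_fineK (Q1 y)) Q1E.
pose J x := \int[leb]_y Q (x, y).
have iJ : integ leb J := integ_Rintegral_prod iQ Q2.
have EJ : \int[leb]_x J x = nsq leb h.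
  by rewrite /J (Rintegral_fubini iQ Q2 Q1); apply: eq_Rintegral => y _; rewrite Q1E.
have cw : Cinteg leb (fun x => h x * conjc (smooth s h (val x))).
  have := Cinteg_FTM cd ch.
  by under eq_fun do rewrite FT_damped// mulrC.
have ib : integ leb (fun x => 2^-1 * sqn (h x) + 2^-1 * J x).
  by apply: integD; exact: integZl.
apply: (@le_trans _ _ (\int[leb]_x (2^-1 * sqn (h x) + 2^-1 * J x))); last first.
  rewrite RintegralD ?measurableT//; try exact: integZl.
  by rewrite !RintegralZl ?measurableT// EJ -/(nsq leb h); lra.
apply: (le_integ cw.1 ib) => x.
have cx := Cinteg_conj (Cinteg_poissonM (val x) s0 ch).
have -> : h x * conjc (smooth s h (val x)) =
    Cintegral leb (fun y => h x * conjc (h y * (poisson s (val y - val x))%:C)).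
  rewrite CintegralZl// Cintegral_conj//; exact: Cinteg_poissonM.
have [ip1 ip2] := integ_poisson L (val x) s0.
have -> : 2^-1 * sqn (h x) + 2^-1 * J x =
    \int[leb]_y (2^-1 * sqn (h x) * poisson s (val y - val x) + 2^-1 * Q (x, y)).
  rewrite RintegralD ?measurableT//; try exact: integZl.
  rewrite RintegralZl ?measurableT// ip2 mulr1; congr (_ + _).
  by rewrite RintegralZl ?measurableT//; exact: Q2.
apply: le_integ => [||y].
- exact: (CintegZl _ cx).1.
- by apply: integD; exact: integZl.
rewrite /Q /=; have p0 := poisson_ge0 (val y - val x) s0.
set p := poisson s (val y - val x) in p0 *.
have key : Re (h x * conjc (h y)) <= 2^-1 * (sqn (h x) + sqn (h y)).
  apply: le_trans (ler_norm _) _; apply: le_trans (Re_normc _) _.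
  by rewrite Normc.normcM normc_conj; apply: le_trans (normcM_le _ _) _; rewrite mulrC.
rewrite conjcM conjc_real mulrA ReM /= mulr0 subr0 mulrC.
apply: le_trans (ler_wpM2l p0 key) _.
by rewrite le_eqVlt; apply/orP; left; apply/eqP; ring.
Qed.

Lemma expdecay_cvg (f : X -> R) : measurable_fun setT f -> (forall x, 0 <= f x) ->
  (\int[leb]_x (expdecay n.+1%:R^-1 (val x) * f x)%:E @[n --> \oo] --> \int[leb]_x (f x)%:E)%E.
Proof.
move=> mf f0.
pose g n (x : X) : \bar R := (expdecay n.+1%:R^-1 (val x) * f x)%:E.
have mg n : measurable_fun setT (g n).
  by apply/measurable_EFinP; apply: measurable_funM => //; exact: measurable_expdecay.
have g0 n x : setT x -> (0 <= g n x)%E.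
  by move=> _; rewrite lee_fin mulr_ge0// ltW// expdecay_gt0.
have nd x : setT x -> {homo g ^~ x : m n / (m <= n)%N >-> (m <= n)%E}.
  move=> _ m n mn; rewrite lee_fin ler_wpM2r// ler_expdecay// ?invr_ge0//.
  by rewrite lef_pV2 ?posrE// ler_nat.
have := @cvg_monotone_convergence _ X R leb setT measurableT g mg g0 nd.
rewrite [X in _ --> X -> _](_ : _ = (\int[leb]_x (f x)%:E)%E)//.
apply: eq_integral => x _; apply/cvg_lim => //; apply: cvg_EFin.
  exact: nearW.
rewrite -[X in _ --> X]mul1r; apply: cvgM; last exact: cvg_cst.
rewrite /expdecay -[X in _ --> X](_ : \prod_(j < d) (1 : R) = 1); last by rewrite big1.
apply: cvg_big => [|j _]; first exact: mul_continuous.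
rewrite -[X in _ --> X]expR0; apply: continuous_cvg; first exact: continuous_expR.
rewrite -[X in _ --> X]oppr0; apply: cvgN; rewrite -[X in _ --> X](mul0r `|val x 0 j|).
by apply: cvgM; [exact: cvg_harmonic|exact: cvg_cst].
Qed.

(** The damping factor increases to 1, so monotone convergence carries [energy_le] over to the
    undamped energy. *)
Lemma FT_L2 h : Cinteg leb h -> L2 leb h ->
  L2 leb (fun x => FT h (val x)) /\ nsq leb (fun x => FT h (val x)) <= nsq leb h.
Proof.
move=> ch lh; have mF := Cmeas_FT (Cinteg_meas ch).
have cv := expdecay_cvg (measurable_sqn mF) (fun x => sqn_ge0 _).
have le1 : (\int[leb]_x (sqn (FT h (val x)))%:E <= (nsq leb h)%:E)%E.
  rewrite -(cvg_lim _ cv)//; apply: lime_le; first by apply/cvg_ex; eexists; exact: cv.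
  apply: nearW => n; have s0 : 0 < n.+1%:R^-1 :> R by [].
  have [i1 _] := energy_eq s0 ch.
  by rewrite (integ_fineK i1) lee_fin; exact: energy_le.
have l2 : L2 leb (fun x => FT h (val x)).
  split => //; apply: ge0_integP; first exact: measurable_sqn.
    by move=> x; exact: sqn_ge0.
  by apply: (le_lt_trans le1); rewrite ltry.
by split => //; rewrite -lee_fin -integ_fineK//; exact: l2.2.
Qed.

End energy.

(** * Plancherel: null sets, indicators, and extension by approximation *)

Section null_sets.
Variables (R : realType) (d' : measure_display) (Y : measurableType d').
Variable mu : {measure set Y -> \bar R}.

Lemma Rintegral_ae (N : set Y) (f g : Y -> R) : measurable N -> mu N = 0%E ->
  measurable_fun setT f -> measurable_fun setT g -> (forall x, ~ N x -> f x = g x) ->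
  \int[mu]_x f x = \int[mu]_x g x.
Proof.
move=> mN N0 mf mg fg; congr fine; apply: ae_eq_integral => //; try exact/measurable_EFinP.
exists N; split => // x /= /not_implyP[_ h]; apply: contrapT => nN; apply: h.
by rewrite fg.
Qed.

Lemma Cintegral_ae (N : set Y) (f g : Y -> R[i]) : measurable N -> mu N = 0%E ->
  Cmeas f -> Cmeas g -> (forall x, ~ N x -> f x = g x) -> Cintegral mu f = Cintegral mu g.
Proof.
move=> mN N0 [f1 f2] [g1 g2] fg; apply: complexP => /=.
  by apply: (Rintegral_ae mN N0) => // x /fg ->.
by apply: (Rintegral_ae mN N0) => // x /fg ->.
Qed.

Lemma integ_indic (A : set Y) : measurable A -> (mu A < +oo)%E -> integ mu (\1_A : Y -> R).
Proof.
move=> mA fA; apply: ge0_integP; first exact: measurable_indic.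
  by move=> x; rewrite indicE.
by rewrite integral_indic// setIT.
Qed.

Lemma Rintegral_indic (A : set Y) : measurable A -> \int[mu]_x (\1_A x : R) = fine (mu A).
Proof. by move=> mA; rewrite /Rintegral integral_indic// setIT. Qed.

Lemma sqn_indic (A : set Y) x : sqn ((\1_A x : R)%:C) = \1_A x.
Proof. by rewrite sqn_real indicE expr2 -natrM mulnb andbb. Qed.

Lemma nsq_indic (A : set Y) : measurable A -> nsq mu (fun x => (\1_A x)%:C) = fine (mu A).
Proof.
by move=> mA; rewrite -Rintegral_indic//; apply: eq_Rintegral => x _; exact: sqn_indic.
Qed.

Lemma Cinteg_indic (A : set Y) : measurable A -> (mu A < +oo)%E ->
  Cinteg mu (fun x => (\1_A x)%:C).
Proof. by move=> mA fA; apply: Cinteg_real; exact: integ_indic. Qed.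

Lemma L2_indic (A : set Y) : measurable A -> (mu A < +oo)%E -> L2 mu (fun x => (\1_A x)%:C).
Proof.
move=> mA fA; split; first exact: Cmeas_indic.
by under eq_fun do rewrite sqn_indic; exact: integ_indic.
Qed.

End null_sets.

Section plancherel_indicators.
Variables (R : realType) (d : nat) (L : lebesgue_space R d).
Local Notation E := 'rV[R]_d.
Local Notation X := (ls_sort L).
Local Notation leb := (ls_mu L).
Local Notation val := (@ls_val R d L).
Local Notation LB := (@lebesgue_borel R).

Lemma poisson_scale s (z : E) : 0 < s -> poisson s (s *: z) = s ^- d * poisson 1 z.
Proof.
move=> s0; rewrite /poisson scalerA mulVf ?gt_eqF// invr1 expr1n invr1 mulr1.
by rewrite mulrCA mulrA.
Qed.

(** The damped energy of an indicator is [|B|] minus the mass that Poisson smoothing moves out of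
    [B]. By [averaged_translation] that loss is at most [e], which yields the inequality opposite to
    contractivity. *)
Lemma nsq_FT_indic_borel (B : set E) : measurable B -> (LB d B < +oo)%E ->
  nsq leb (fun x => FT (fun x : X => (\1_(val @^-1` B) x)%:C) (val x)) =
  nsq leb (fun x : X => (\1_(val @^-1` B) x)%:C).
Proof.
move=> mB fB; have mB' : measurable (val @^-1` B) by exact: measurable_ls_set.
have fB' : (leb (val @^-1` B) < +oo)%E by rewrite ls_borel.
pose iB (x : X) : R := \1_(val @^-1` B) x; pose h x := (iB x)%:C.
have iiB : integ leb iB by exact: integ_indic.
have miB := integ_measurable iiB.
have ch : Cinteg leb h by exact: Cinteg_indic.
have lh : L2 leb h by exact: L2_indic.
have iB0 x : 0 <= iB x by rewrite /iB indicE.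
have iB1 x : iB x <= 1 by rewrite /iB indicE lern1 leq_b1.
have [lF hF] := FT_L2 ch lh.
apply/eqP; rewrite eq_le hF/=; apply/ler_addgt0Pr => e e0.
(* The unit-scale Poisson kernel, of total mass one, serves as the profile of [escape]. *)
pose w (y : X) : R := poisson 1 (val y).
have [iw w1] : integ leb w /\ \int[leb]_y w y = 1.
  by have := @integ_poisson R d L 1 0 ltr01; under eq_fun do rewrite subr0.
have w0 y : 0 <= w y by apply: poisson_ge0.
have mw := integ_measurable iw.
have [s s0 hs] := averaged_translation mB fB iw w0 e0.
have {}hs := hs s s0 (lexx _).
have [iG EG] := energy_eq s0 ch.
have [mesc Eesc] := measurable_escape s mB iw w0.
have miBa x : measurable_fun setT (fun y => iB (affX s x y)).
  exact: (measurableT_comp miB (measurable_affX x s0)).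
pose k (x : X) := \int[leb]_y (w y * \1_(~` (val @^-1` B)) (affX s (val x) y)).
have cE y : \1_(~` (val @^-1` B)) y = 1 - iB y :> R.
  rewrite /iB !indicE in_setC; case: (y \in _) => /=; by rewrite ?subrr ?subr0.
have ik1 x : integ leb (fun y => w y * iB (affX s (val x) y)).
  apply: (integ_le _ iw); first exact: measurable_funM.
  move=> y; rewrite (ger0_norm (mulr_ge0 (w0 y) (iB0 _))).
  exact: (ler_piMr (w0 y) (iB1 _)).
have ik x : integ leb (fun y => w y * \1_(~` (val @^-1` B)) (affX s (val x) y)).
  under eq_fun do rewrite cE mulrBr mulr1.
  exact: integB.
have kE x : escape (val @^-1` B) w s (val x) = (k x)%:E.
  by rewrite /escape (integ_fineK (ik x)).
have k1 x : \int[leb]_y (w y * iB (affX s (val x) y)) = 1 - k x.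
  rewrite -w1 /k -RintegralB ?measurableT//; last exact: ik.
  by apply: eq_Rintegral => y _; rewrite cE; ring.
have k0 x : 0 <= k x.
  by apply: Rintegral_ge0 => y _; rewrite mulr_ge0// indicE.
have k01 x : k x <= 1.
  rewrite -subr_ge0 -k1; apply: Rintegral_ge0 => y _; exact: mulr_ge0.
have mk : measurable_fun setT k.
  apply/measurable_EFinP; rewrite (_ : EFin \o k = fun x => escape (val @^-1` B) w s (val x))//.
  by apply/funext => x; rewrite kE.
(* The substitution of [s y + x] for [y] turns the kernel of scale [s] into [w]; inside [B], the
   smoothing thus falls short of 1 exactly by the escaping mass. *)
have smE x : smooth s h (val x) = (1 - k x)%:C.
  pose g (y : X) := iB y * poisson s (val y - val x).
  have ig : integ leb g.
    have := Cinteg_poissonM (val x) s0 ch => -[+ _].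
    by under eq_fun do rewrite /h -real_complexM; exact.
  have -> : smooth s h (val x) = (\int[leb]_y g y)%:C.
    by rewrite -Cintegral_real; apply: eq_Cintegral => y; rewrite /h /g real_complexM.
  congr (_%:C); rewrite -k1; have := Rintegral_affX (val x) s0 ig.
  have sd0 : s ^- d != 0 by rewrite invr_eq0 gt_eqF// exprn_gt0.
  move=> H; apply: (mulfI sd0); rewrite -H -RintegralZl ?measurableT//; last exact: ik1.
  apply: eq_Rintegral => y _; rewrite /g val_affX addrK poisson_scale// /w; ring.
have iBk : integ leb (fun x => iB x * k x).
  apply: (integ_le _ iiB); first exact: measurable_funM.
  move=> x; rewrite (ger0_norm (mulr_ge0 (iB0 x) (k0 x))).
  exact: (ler_piMr (iB0 x) (k01 x)).
have le_e : \int[leb]_x (iB x * k x) <= e.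
  rewrite -lee_fin -(integ_fineK iBk); move: hs; rewrite -Eesc; apply: le_trans.
  rewrite [leRHS]integral_mkcond le_eqVlt; apply/orP; left; apply/eqP.
  apply: eq_integral => x _; rewrite patchE /iB indicE.
  by case: (x \in _); rewrite ?mul1r ?mul0r// kE.
have nB : nsq leb h = \int[leb]_x iB x.
  by apply: eq_Rintegral => x _; exact: sqn_indic.
have : nsq leb h - e <= \int[leb]_x (expdecay s (val x) * sqn (FT h (val x))).
  rewrite EG.
  have -> : \int[leb]_x Re (h x * conjc (smooth s h (val x))) = \int[leb]_x (iB x - iB x * k x).
    apply: eq_Rintegral => x _; rewrite smE conjc_real /h -real_complexM /=; ring.
  by rewrite RintegralB ?measurableT// nB lerB.
rewrite lerBlDr => /le_trans; apply; rewrite lerD2r.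
apply: le_integ => //; first exact: lF.2.
by move=> x; rewrite ler_piMl ?sqn_ge0// expdecay_le1// ltW.
Qed.

(** Replacing [A] by its Borel hull alters the indicator on a null set only, hence neither norm. *)
Lemma nsq_FT_indic (A : set X) : measurable A -> (leb A < +oo)%E ->
  nsq leb (fun x => FT (fun x : X => (\1_A x)%:C) (val x)) =
  nsq leb (fun x : X => (\1_A x)%:C).
Proof.
move=> mA fA; have [B [mB AB BA0]] := ls_regular mA fA.
have mB' : measurable (val @^-1` B) by exact: measurable_ls_set.
have mN : measurable (val @^-1` B `\` A) by exact: measurableD.
have BAE : leb (val @^-1` B) = leb A.
  rewrite -(setDUK AB) measureU//; last by rewrite -subset0 => x [? []].
  by rewrite [X in (_ + X)%E]BA0 adde0.
have fB : (LB d B < +oo)%E by rewrite -(ls_borel L)// BAE.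
have E1 x : ~ (val @^-1` B `\` A) x -> (\1_A x)%:C = (\1_(val @^-1` B) x)%:C :> R[i].
  move=> nN; congr (_%:C); rewrite !indicE; congr (nat_of_bool _)%:R.
  apply/idP/idP; rewrite !inE; first exact: AB.
  by move=> Bx; apply: contrapT => nA; apply: nN.
have -> : nsq leb (fun x => (\1_A x)%:C) = nsq leb (fun x : X => (\1_(val @^-1` B) x)%:C).
  by rewrite !nsq_indic//; congr fine; exact: (esym BAE).
rewrite -(nsq_FT_indic_borel mB fB); apply: eq_nsq => x; congr (sqn (_ * _)).
have me (C : set X) : measurable C ->
    Cmeas (fun t : X => (\1_C t)%:C * expi (- dot (val x) (val t))).
  move=> mC; apply: CmeasM; first exact: Cmeas_indic.
  by apply: Cmeas_expi; apply: measurable_funN; exact: measurable_dot_ls.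
by apply: (Cintegral_ae mN BA0 (me _ mA) (me _ mB')) => t /E1 ->.
Qed.

End plancherel_indicators.

Import HBNNSimple.

(** Turns squared norms into variables, so that [lra] works with atoms and never looks into the
    integrals. *)
Ltac abstract_nsq :=
  repeat match goal with |- context [nsq ?m ?f] => generalize (nsq m f); intro end.

Section plancherel.
Variables (R : realType) (d : nat) (L : lebesgue_space R d).
Local Notation E := 'rV[R]_d.
Local Notation X := (ls_sort L).
Local Notation leb := (ls_mu L).
Local Notation val := (@ls_val R d L).
Implicit Types f g h : X -> R[i].

Definition FTX f (x : X) : R[i] := FT f (val x).

Definition L12 f := Cinteg leb f /\ L2 leb f.

Definition isom f := L12 f /\ nsq leb (FTX f) = nsq leb f.

Lemma L12D f g : L12 f -> L12 g -> L12 (fun x => f x + g x).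
Proof. by move=> [? ?] [? ?]; split; [exact: CintegD|exact: L2D]. Qed.

Lemma L12Z c f : L12 f -> L12 (fun x => c * f x).
Proof. by move=> [? ?]; split; [exact: CintegZl|exact: L2Z]. Qed.

Lemma L12B f g : L12 f -> L12 g -> L12 (fun x => f x - g x).
Proof. by move=> [? ?] [? ?]; split; [exact: CintegB|exact: L2B]. Qed.

Lemma L12_conj f : L12 f -> L12 (fun x => conjc (f x)).
Proof. by move=> [? ?]; split; [exact: Cinteg_conj|exact: L2_conj]. Qed.

Lemma L2_FTX f : L12 f -> L2 leb (FTX f).
Proof. by move=> [cf lf]; exact: (FT_L2 cf lf).1. Qed.

Lemma nsq_FTX_le f : L12 f -> nsq leb (FTX f) <= nsq leb f.
Proof. by move=> [cf lf]; exact: (FT_L2 cf lf).2. Qed.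

Lemma FTX_B f g x : L12 f -> L12 g -> FTX (fun x => f x - g x) x = FTX f x - FTX g x.
Proof. by move=> [cf _] [cg _]; exact: FTB. Qed.

Lemma nsq_FTX_B f g : L12 f -> L12 g ->
  nsq leb (FTX (fun x => f x - g x)) = nsq leb (fun x => FTX f x - FTX g x).
Proof. by move=> lf lg; apply: eq_nsq => x; rewrite FTX_B. Qed.

Lemma defect_parallelogram f g : L12 f -> L12 g ->
  (nsq leb (fun x => f x + g x) - nsq leb (FTX (fun x => f x + g x))) +
  (nsq leb (fun x => f x - g x) - nsq leb (FTX (fun x => f x - g x))) =
  2 * (nsq leb f - nsq leb (FTX f)) + 2 * (nsq leb g - nsq leb (FTX g)).
Proof.
move=> lf lg; have p1 := parallelogram lf.2 lg.2.
have p2 := parallelogram (L2_FTX lf) (L2_FTX lg).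
rewrite nsq_FTX_B//.
have -> : nsq leb (FTX (fun x => f x + g x)) = nsq leb (fun x => FTX f x + FTX g x).
  by apply: eq_nsq => x; congr sqn; apply: FTD; [exact: lf.1|exact: lg.1].
by move: p1 p2; abstract_nsq; lra.
Qed.

(** The defects of [f + g] and [f - g] are nonnegative and, by the parallelogram identity, add up to
    zero. *)
Lemma isomD f g : isom f -> isom g -> isom (fun x => f x + g x).
Proof.
move=> [lf ef] [lg eg]; split; first exact: L12D.
have := defect_parallelogram lf lg.
have := nsq_FTX_le (L12D lf lg); have := nsq_FTX_le (L12B lf lg).
rewrite ef eg; clear ef eg; abstract_nsq => h1 h2 h3.
by apply/eqP; rewrite eq_le h2/=; lra.
Qed.

Lemma isomZ c f : isom f -> isom (fun x => c * f x).
Proof.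
move=> [lf ef]; split; first exact: L12Z.
rewrite (nsqZ _ lf.2) -ef -nsqZ; last exact: L2_FTX.
by apply: eq_nsq => x; congr sqn; apply: FTZ; exact: lf.1.
Qed.

Lemma isom0 : isom (cst 0).
Proof.
have l0 : L12 (cst 0) by split; [exact: Cinteg0|exact: L2_0].
split => //; apply/eqP; rewrite eq_le nsq_FTX_le//=.
apply: (@le_trans _ _ 0); last exact: nsq_ge0.
rewrite le_eqVlt; apply/orP; left; apply/eqP.
by rewrite /nsq /Rintegral integral0_eq// => x _; rewrite /cst sqn0.
Qed.

Lemma isom_sum I (s : seq I) (F : I -> X -> R[i]) :
  (forall i, isom (F i)) -> isom (fun x => \sum_(i <- s) F i x).
Proof.
move=> hF; elim: s => [|i s IH].
  by under eq_fun do rewrite big_nil; exact: isom0.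
by under eq_fun do rewrite big_cons; exact: isomD.
Qed.

(** The parallelogram identity for [g] and [f - g] bounds the defect of [f] by twice that of
    [f - g], hence by twice its squared norm; this is why [e / 2] is requested. *)
Lemma isom_approx f : L12 f ->
  (forall e, 0 < e -> exists2 g, isom g & nsq leb (fun x => f x - g x) <= e) -> isom f.
Proof.
move=> lf ap; split => //; apply/eqP; rewrite eq_le nsq_FTX_le//=.
apply/ler_addgt0Pr => e e0; have e20 : 0 < e / 2 by rewrite divr_gt0.
have [g [lg eg] hg] := ap _ e20.
have lfg := L12B lf lg.
have := defect_parallelogram lg lfg.
have -> : (fun x => g x + (f x - g x)) = f by apply/funext => x; rewrite addrC subrK.
have := nsq_FTX_le (L12B lg lfg); have := nsq_ge0 leb (FTX (fun x => f x - g x)).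
by rewrite eg; move: hg; abstract_nsq; lra.
Qed.

Lemma isom_indic (A : set X) : measurable A -> (leb A < +oo)%E -> isom (fun x => (\1_A x)%:C).
Proof.
move=> mA fA; split; first by split; [exact: Cinteg_indic|exact: L2_indic].
exact: nsq_FT_indic.
Qed.

Lemma isom_ge0 (f : X -> R) : integ leb f -> integ leb (fun x => f x ^+ 2) ->
  (forall x, 0 <= f x) -> isom (fun x => (f x)%:C).
Proof.
move=> if1 if2 f0; have mf := integ_measurable if1.
have lf : L12 (fun x => (f x)%:C).
  split; first exact: Cinteg_real.
  by split; [exact: Cmeas_real|under eq_fun do rewrite sqn_real].
apply: isom_approx => // e e0.
have mf' : measurable_fun setT (EFin \o f) by exact/measurable_EFinP.
pose g n := nnsfun_approx measurableT mf' n.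
have ef0 x : setT x -> (0 <= (EFin \o f) x)%E by rewrite lee_fin.
have g0 n x : 0 <= g n x by exact: fun_ge0.
have gf n x : g n x <= f x.
  by rewrite /g nnsfun_approxE -lee_fin; exact: (le_approx n ef0 I).
have gc x : g n x @[n --> \oo] --> f x.
  have := @cvg_approx _ X R setT (EFin \o f) x ef0 I (ltry _).
  by under eq_fun do rewrite -(nnsfun_approxE measurableT mf').
have mg n : measurable_fun setT (g n : X -> R) by exact: measurable_funP.
have gi n : isom (fun x => (g n x)%:C).
  rewrite (_ : (fun x => _) =
      fun x => \sum_(y <- finmap.enum_fset (fset_set (range (g n)))) y%:C * (\1_(g n @^-1` [set y]) x)%:C); last first.
    apply/funext => x; rewrite fimfunE fsbig_finite//.
    rewrite (big_morph _ (@real_complexD R) (erefl _)).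
    by apply: eq_bigr => y _; rewrite real_complexM.
  apply: isom_sum => y.
  have mA : measurable (g n @^-1` [set y]) by exact: measurable_sfunP.
  (* Level sets of negative values are empty, those of positive values have finite measure by
     Markov's inequality, and the zero level, possibly of infinite measure, contributes the zero
     function. *)
  have [y0|y0|->] := ltgtP y 0.
  - rewrite (_ : g n @^-1` [set y] = set0).
      apply: isomZ; apply: isom_indic; first exact: measurable0.
      by rewrite measure0.
    by rewrite -subset0 => x /= gy; have := g0 n x; rewrite gy leNgt y0.
  - apply: isomZ; apply: isom_indic => //.
    have /integ_lty h1 := if1.
    have h2 : (y%:E * leb (g n @^-1` [set y]) <= \int[leb]_x (f x)%:E)%E.
      have -> : leb (g n @^-1` [set y]) = (\int[leb]_x (\1_(g n @^-1` [set y]) x)%:E)%E.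
        by rewrite integral_indic// setIT.
      rewrite -ge0_integralZl_EFin//; last 2 first.
      - by apply/measurable_EFinP; exact: measurable_indic.
      - exact: ltW.
      apply: ge0_le_integral => //.
      - by move=> x _; rewrite mule_ge0// lee_fin ?indicE// ltW.
      - apply/measurable_EFinP; apply: measurable_funM => //; exact: measurable_indic.
      - move=> x _; rewrite lee_fin indicE.
        have [|_] := boolP (x \in _); last by rewrite mulr0.
        by rewrite inE /= mulr1 => <-.
    have := le_lt_trans h2 h1; rewrite !ltey; apply: contra => /eqP ->.
    by rewrite gt0_muley// lte_fin.
  - under eq_fun do rewrite mul0r.
    exact: isom0.
have h0 n (x : X) : 0 <= (f x - g n x) ^+ 2 <= f x ^+ 2.
  rewrite sqr_ge0 ler_pXn2r ?nnegrE ?subr_ge0//.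
  by rewrite lerBlDr lerDl g0.
have cv : (\int[leb]_x ((f x - g n x) ^+ 2)%:E)%E @[n --> \oo] --> 0%E.
  pose q n (x : X) : \bar R := ((f x - g n x) ^+ 2)%:E.
  have mq n : measurable_fun setT (q n).
    by apply/measurable_EFinP; apply: measurable_funX; exact: measurable_funB.
  have [||||_ _ cI] := @dominated_convergence _ X R leb setT measurableT q (cst 0%E)
      (EFin \o (fun x => f x ^+ 2)) mq.
  - exact: measurable_cst.
  - apply: aeW => x _; apply: cvg_EFin; first exact: nearW.
    rewrite -[X in _ --> X](_ : (f x - f x) ^+ 2 = 0); last by rewrite subrr expr0n.
    have c1 : f x - g n x @[n --> \oo] --> f x - f x.
      by apply: cvgB; [exact: cvg_cst|exact: gc].
    by rewrite expr2; exact: (cvgM c1 c1).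
  - exact: if2.
  - by apply: aeW => x n _; rewrite lee_fin ger0_norm//; have /andP[] := h0 n x.
  by move: cI; rewrite integral0.
have [n hn] := cvge0_le cv e0.
exists (fun x => (g n x)%:C) => //.
have ii : integ leb (fun x => (f x - g n x) ^+ 2).
  apply: (integ_le _ if2); first by apply: measurable_funX; exact: measurable_funB.
  by move=> x; rewrite ger0_norm//; have /andP[] := h0 n x.
rewrite -lee_fin; apply: le_trans hn.
rewrite (integ_fineK ii) lee_fin le_eqVlt; apply/orP; left; apply/eqP.
by apply: eq_Rintegral => x _; rewrite -real_complexB sqn_real.
Qed.

Lemma isom_real (f : X -> R) : integ leb f -> integ leb (fun x => f x ^+ 2) ->
  isom (fun x => (f x)%:C).
Proof.
move=> if1 if2; have mf := integ_measurable if1.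
have hp (c : R) : `|c| = 1 -> isom (fun x => ((`|f x| + c * f x) / 2)%:C).
  move=> c1.
  have cf x : `|c * f x| = `|f x| by rewrite normrM c1 mul1r.
  have i1 : integ leb (fun x => (`|f x| + c * f x) / 2).
    under eq_fun do rewrite mulrC.
    by apply: integZl; apply: integD; [exact: integrable_norm|exact: integZl].
  have h0 x : 0 <= (`|f x| + c * f x) / 2.
    by rewrite divr_ge0// -lerBlDr sub0r -cf -normrN ler_norm.
  apply: isom_ge0 => //; apply: (integ_le _ if2).
    by apply: measurable_funX; exact: integ_measurable i1.
  move=> x; rewrite ger0_norm ?sqr_ge0// -[leRHS]real_normK ?num_real//.
  rewrite ler_pXn2r ?nnegrE// ler_pdivrMr// mulr2n mulrDr mulr1 lerD2l -cf.
  exact: ler_norm.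
rewrite (_ : (fun x => _) = fun x => ((`|f x| + 1 * f x) / 2)%:C +
    (-1) * ((`|f x| + (-1) * f x) / 2)%:C).
  apply: isomD; first by apply: hp; rewrite normr1.
  by apply: isomZ; apply: hp; rewrite normrN normr1.
apply/funext => x; rewrite mulN1r -real_complexB; congr (_%:C); by field.
Qed.

Lemma plancherel f : L12 f -> nsq leb (FTX f) = nsq leb f.
Proof.
move=> lf; suff [_ //] : isom f.
have [[i1 i2] [mf l2]] := lf.
have hr (r : X -> R) : measurable_fun setT r -> (forall x, r x ^+ 2 <= sqn (f x)) ->
    integ leb (fun x => r x ^+ 2).
  move=> mr hr; apply: (integ_le _ l2); first exact: measurable_funX.
  by move=> x; rewrite ger0_norm ?sqr_ge0.
rewrite (_ : f = fun x => (Re (f x))%:C + (0 +i* 1) * (Im (f x))%:C).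
  apply: isomD; [|apply: isomZ]; apply: isom_real => //.
    by apply: hr; [exact: mf.1|move=> x; rewrite /sqn lerDl sqr_ge0].
  by apply: hr; [exact: mf.2|move=> x; rewrite /sqn lerDr sqr_ge0].
by apply/funext => x; apply: complexP; rewrite !ReImE /=; ring.
Qed.

(** The inverse transform is the conjugate of the transform of the conjugate. Damping makes it
    integrable, and both errors are at most [2 |h|^2 - 2 I n], where the damped energy [I n] tends
    to [|h|^2] by Plancherel. *)
Lemma fourier_inversion h : L12 h ->
  exists u : nat -> X -> R[i], [/\ forall n, L12 (u n),
    nsq leb (fun x => u n x - conjc (FTX (fun x => conjc (h x)) x)) @[n --> \oo] --> (0 : R) &
    nsq leb (fun x => FTX (u n) x - h x) @[n --> \oo] --> (0 : R)].
Proof.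
move=> lh; have lhc := L12_conj lh.
pose hc x := conjc (h x); pose g x := conjc (FTX hc x).
have lF := L2_FTX lhc.
have lg : L2 leb g by exact: L2_conj.
pose s n : R := n.+1%:R^-1.
have s0 n : 0 < s n by rewrite invr_gt0.
pose u n := damped (s n) hc.
have G01 n x : 0 <= expdecay (s n) (val x) <= 1.
  by rewrite (ltW (expdecay_gt0 _ _)) expdecay_le1// ltW.
have uE n x : u n x = (expdecay (s n) (val x))%:C * g x by [].
have sqg x : sqn (g x) = sqn (FTX hc x) by rewrite /g sqn_conj.
have cu n : Cinteg leb (u n) by exact: Cinteg_damped (s0 n) lhc.1.
have lu n : L2 leb (u n).
  apply: L2_mulB => //; first by apply: Cmeas_real; exact: measurable_expdecay.
  move=> x; rewrite sqn_real; have /andP[a b] := G01 n x.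
  by rewrite expr2 mulr_ile1.
have l12u n : L12 (u n) by [].
have nc : nsq leb hc = nsq leb h by apply: eq_nsq => x; rewrite sqn_conj.
have ng : nsq leb g = nsq leb h.
  by rewrite -nc -(plancherel lhc); apply: eq_nsq => x; rewrite sqg.
have iG n : integ leb (fun x => expdecay (s n) (val x) * sqn (g x)).
  by have := (energy_eq (s0 n) lhc.1).1; under eq_fun do rewrite -/(FTX _ _) -sqg.
pose I n := \int[leb]_x (expdecay (s n) (val x) * sqn (g x)).
have cI : I n @[n --> \oo] --> nsq leb h.
  have := expdecay_cvg (measurable_sqn lg.1) (fun x => sqn_ge0 _).
  rewrite (integ_fineK lg.2) -/(nsq leb g) ng.
  under eq_fun do rewrite (integ_fineK (iG _)).
  by move=> H; exact: (fine_cvg H).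
have c0 (a : nat -> R) : (forall n, 0 <= a n <= 2 * nsq leb h - 2 * I n) ->
    a n @[n --> \oo] --> (0 : R).
  move=> ha; apply: (@squeeze_cvgr _ _ _ _ (cst 0) (fun n => 2 * nsq leb h - 2 * I n)).
  - by apply: nearW => n; exact: ha.
  - exact: cvg_cst.
  rewrite -[X in _ --> X](subrr (2 * nsq leb h)); apply: cvgB; first exact: cvg_cst.
  by apply: cvgM => //; exact: cvg_cst.
have In n : I n <= nsq leb h.
  rewrite -ng; apply: le_integ => //; first exact: lg.2.
  by move=> x; rewrite ler_piMl ?sqn_ge0//; have /andP[] := G01 n x.
exists u; split => //; apply: c0 => n; rewrite nsq_ge0 andTb.
  apply: (@le_trans _ _ (nsq leb h - I n)); last first.
    by have := In n; move: (I n) => i; abstract_nsq; lra.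
  have -> : nsq leb h - I n = \int[leb]_x (sqn (g x) - expdecay (s n) (val x) * sqn (g x)).
    by rewrite -ng /nsq /I RintegralB ?measurableT//; [exact: lg.2|exact: iG].
  apply: le_integ.
  - exact: (L2B (lu n) lg).2.
  - by apply: integB => //; exact: lg.2.
  move=> x; rewrite uE -/(g x) -[X in _ - X]mul1r -mulrBl sqnM -[X in sqn (_ - X)]/(1%:C) -real_complexB.
  rewrite sqn_real -[X in _ <= X - _]mul1r -mulrBl ler_wpM2r ?sqn_ge0//.
  by have := G01 n x; nra.
have lFu := L2_FTX (l12u n).
rewrite (nsqB_ip lFu lh.2).
(* The multiplication formula moves the transform onto the conjugate of [h], and the pairing becomes
   the damped energy. *)
have -> : Re (ip leb (FTX (u n)) h) = I n.
  rewrite /ip (FT_multiplication (cu n) lhc.1).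
  rewrite -[RHS]/(Re (I n)%:C) -Cintegral_real; congr Re; apply: eq_Cintegral => x.
  rewrite uE -mulrA -/(FTX hc x) [g x * _]mulrC mul_conj -real_complexM.
  by rewrite sqg.
have := nsq_FTX_le (l12u n).
have : nsq leb (u n) <= nsq leb h.
  rewrite -ng; apply: le_nsq => // x; rewrite uE sqnM ler_piMl ?sqn_ge0//.
  rewrite sqn_real; have /andP[a b] := G01 n x.
  by rewrite expr2 mulr_ile1.
by move: (I n) => i; abstract_nsq; lra.
Qed.

End plancherel.

(** * Time-band limiting *)

Section time_band.
Variables (R : realType) (d : nat) (L : lebesgue_space R d).
Local Notation E := 'rV[R]_d.
Local Notation X := (ls_sort L).
Local Notation leb := (ls_mu L).
Local Notation val := (@ls_val R d L).
Implicit Types f g h v w : X -> R[i].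

Definition is_FT v g := [/\ L2 leb v, L2 leb g &
  exists u : nat -> X -> R[i], [/\ forall n, L12 (u n),
    nsq leb (fun x => u n x - v x) @[n --> \oo] --> (0 : R) &
    nsq leb (fun x => FTX (u n) x - g x) @[n --> \oo] --> (0 : R)]].

Lemma is_FT_L12 v : L12 v -> is_FT v (FTX v).
Proof.
move=> lv; split; [exact: lv.2|exact: L2_FTX|].
have z (k : X -> R[i]) : nsq leb (fun x => k x - k x) = 0.
  by rewrite /nsq /Rintegral integral0_eq// => x _; rewrite subrr sqn0.
by exists (fun=> v); split => // ; rewrite z; exact: cvg_cst.
Qed.

Lemma nsq_triangle_sub f g h : L2 leb f -> L2 leb g -> L2 leb h ->
  Num.sqrt (nsq leb (fun x => f x - h x)) <=
  Num.sqrt (nsq leb (fun x => f x - g x)) + Num.sqrt (nsq leb (fun x => g x - h x)).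
Proof.
move=> lf lg lh; have := nsq_triangle (L2B lf lg) (L2B lg lh).
by under eq_fun do rewrite addrA subrK.
Qed.

Lemma nsq_subC f g : nsq leb (fun x => f x - g x) = nsq leb (fun x => g x - f x).
Proof. by apply: eq_nsq => x; rewrite sqnBC. Qed.

Lemma sqrt_cvg0 (a : nat -> R) : a n @[n --> \oo] --> (0 : R) ->
  Num.sqrt (a n) @[n --> \oo] --> (0 : R).
Proof. by move=> ca; rewrite -[X in _ --> X]sqrtr0; apply: continuous_cvg => //; exact: sqrt_continuous. Qed.

(** Plancherel holds for each [u n - w]; the triangle inequality carries it to the limit. Square
    roots are compared because the errors enter additively there. *)
Lemma is_FT_isometry v g w : is_FT v g -> L12 w ->
  nsq leb (fun x => v x - w x) = nsq leb (fun x => g x - FTX w x).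
Proof.
move=> [lv lg [u [lu cu cF]]] lw.
have lFw := L2_FTX lw.
have iso n : nsq leb (fun x => u n x - w x) = nsq leb (fun x => FTX (u n) x - FTX w x).
  by rewrite -nsq_FTX_B// plancherel//; exact: L12B.
pose a n := Num.sqrt (nsq leb (fun x => u n x - v x)) +
  Num.sqrt (nsq leb (fun x => FTX (u n) x - g x)).
have ca : a n @[n --> \oo] --> (0 : R).
  by rewrite -[X in _ --> X]addr0; apply: cvgD; exact: sqrt_cvg0.
have lim (x y : R) : (forall n, x <= y + a n) -> x <= y.
  move=> H; apply/ler_addgt0Pr => e e0.
  move/cvgrPdist_le : ca => /(_ _ e0)[N _ hN].
  apply: le_trans (H N) _; rewrite lerD2l.
  have := hN N (leqnn N); rewrite /= sub0r normrN; apply: le_trans; exact: ler_norm.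
have sq (x y : R) : 0 <= x -> 0 <= y -> Num.sqrt x = Num.sqrt y -> x = y.
  by move=> x0 y0 h; rewrite -(sqr_sqrtr x0) -(sqr_sqrtr y0) h.
apply: sq; rewrite ?nsq_ge0//; apply/eqP; rewrite eq_le; apply/andP; split; apply: lim => n.
  have h1 := nsq_triangle_sub lv (lu n).2 lw.2.
  have h2 := nsq_triangle_sub (L2_FTX (lu n)) lg lFw.
  move: h1 h2; rewrite iso (nsq_subC v (u n)) /a; abstract_nsq; lra.
have h1 := nsq_triangle_sub (lu n).2 lv lw.2.
have h2 := nsq_triangle_sub lg (L2_FTX (lu n)) lFw.
move: h1 h2; rewrite iso (nsq_subC g (FTX (u n))) /a; abstract_nsq; lra.
Qed.

Definition chi (S : set X) f (x : X) : R[i] := (\1_S x)%:C * f x.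

Lemma sqn_chi S f x : sqn (chi S f x) = \1_S x * sqn (f x).
Proof. by rewrite /chi sqnM sqn_indic. Qed.

Lemma L2_chi S f : measurable S -> L2 leb f -> L2 leb (chi S f).
Proof.
move=> mS lf; apply: L2_mulB => //; first exact: Cmeas_indic.
by move=> x; rewrite sqn_indic indicE lern1 leq_b1.
Qed.

Lemma L12_chi S f : measurable S -> (leb S < +oo)%E -> L2 leb f -> L12 (chi S f).
Proof.
move=> mS fS lf; split; last exact: L2_chi.
by apply: L2_Cinteg_mul => //; exact: L2_indic.
Qed.

Lemma nsq_chi_le S f : measurable S -> L2 leb f -> nsq leb (chi S f) <= nsq leb f.
Proof.
move=> mS lf; apply: le_nsq => //; first exact: L2_chi.
by move=> x; rewrite sqn_chi ler_piMl ?sqn_ge0// indicE lern1 leq_b1.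
Qed.

Lemma nsq_chiD S f : measurable S -> L2 leb f ->
  nsq leb (chi S f) + nsq leb (chi (~` S) f) = nsq leb f.
Proof.
move=> mS lf; have l1 := L2_chi mS lf; have l2 := L2_chi (measurableC mS) lf.
rewrite /nsq -RintegralD ?measurableT//; [|exact: l1.2|exact: l2.2].
apply: eq_Rintegral => x _; rewrite !sqn_chi -mulrDl !indicE in_setC.
by case: (x \in S); rewrite /= ?addr0 ?add0r mul1r.
Qed.

Variables (T Omega : set X).
Hypotheses (mT : measurable T) (fT : (leb T < +oo)%E).
Hypotheses (mO : measurable Omega) (fO : (leb Omega < +oo)%E).

(* leak f bounds the squared defect |D_T B_Omega D_T f - f|^2, and band f bounds
   |D_T B_Omega D_T f|^2. *)
Definition leak f : R :=
  nsq leb (chi (~` Omega) (FTX (chi T f))) + nsq leb (chi (~` T) f).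

Definition band f : R := nsq leb (chi Omega (FTX (chi T f))).

Let mTc : measurable (~` T). Proof. exact: measurableC. Qed.
Let mOc : measurable (~` Omega). Proof. exact: measurableC. Qed.

Let lF f : L2 leb f -> L2 leb (FTX (chi T f)).
Proof. by move=> lf; apply: L2_FTX; exact: L12_chi. Qed.

(** The transform is a contraction. This is the only bound available for packets whose position is
    arbitrary. *)
Lemma leak_le_nsq f : L2 leb f -> leak f <= nsq leb f.
Proof.
move=> lf; rewrite -(nsq_chiD mT lf) lerD2r.
apply: (le_trans (nsq_chi_le mOc (lF lf))).
by apply: nsq_FTX_le; exact: L12_chi.
Qed.

Let FTX_chiD f g x : L2 leb f -> L2 leb g ->
  FTX (chi T (fun x => f x + g x)) x = FTX (chi T f) x + FTX (chi T g) x.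
Proof.
move=> lf lg; rewrite /FTX -FTD; [|exact: (L12_chi mT fT lf).1|exact: (L12_chi mT fT lg).1].
by apply: eq_FT => y; rewrite /chi mulrDr.
Qed.

Lemma leakD_le t f g : 0 < t -> L2 leb f -> L2 leb g ->
  leak (fun x => f x + g x) <= (1 + t) * leak f + (1 + t^-1) * leak g.
Proof.
move=> t0 lf lg; rewrite /leak !mulrDr addrACA; apply: lerD.
  have := nsqD_le t0 (L2_chi mOc (lF lf)) (L2_chi mOc (lF lg)).
  apply: le_trans; rewrite le_eqVlt; apply/orP; left; apply/eqP.
  by apply: eq_nsq => x; rewrite /chi FTX_chiD// mulrDr.
have := nsqD_le t0 (L2_chi mTc lf) (L2_chi mTc lg).
apply: le_trans; rewrite le_eqVlt; apply/orP; left; apply/eqP.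
by apply: eq_nsq => x; rewrite /chi mulrDr.
Qed.

Lemma leakZ c f : L2 leb f -> leak (fun x => c * f x) = sqn c * leak f.
Proof.
move=> lf; rewrite /leak mulrDr -!nsqZ; [|exact: L2_chi|exact/L2_chi/lF].
have E1 x : FTX (chi T (fun x => c * f x)) x = c * FTX (chi T f) x.
  rewrite /FTX -FTZ; last exact: (L12_chi mT fT lf).1.
  by apply: eq_FT => y; rewrite /chi mulrCA.
congr (_ + _); apply: eq_nsq => x; rewrite /chi ?E1; by rewrite mulrCA.
Qed.

Lemma leak0 : leak (cst 0) = 0.
Proof.
have := leakZ 0 (L2_0 leb); rewrite sqn0 mul0r => <-.
by congr leak; apply/funext => x; rewrite mul0r.
Qed.

(** Cauchy-Schwarz by induction: with weight the number [n] of remaining terms, the head gets the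
    factor [1 + n] and the tail [(1 + 1/n) n], which is the same. *)
Lemma leak_sum_le (I : eqType) (s : seq I) (F : I -> X -> R[i]) :
  (forall i, L2 leb (F i)) ->
  leak (fun x => \sum_(i <- s) F i x) <= (size s)%:R * \sum_(i <- s) leak (F i).
Proof.
move=> lFi; elim: s => [|i s IH].
  rewrite big_nil mulr0 (_ : (fun x => _) = cst 0) ?leak0//.
  by apply/funext => x; rewrite big_nil.
rewrite (_ : (fun x => _) = fun x => F i x + \sum_(j <- s) F j x); last first.
  by apply/funext => x; rewrite big_cons.
rewrite big_cons /=; case: s IH => [|k s'] IH.
  rewrite big_nil addr0 mul1r le_eqVlt; apply/orP; left; apply/eqP; congr leak.
  by apply/funext => x; rewrite big_nil addr0.
have n0 : 0 < (size (k :: s'))%:R :> R by rewrite ltr0n.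
have lS := @L2_sum _ _ _ leb _ (k :: s') F lFi.
apply: le_trans (leakD_le n0 (lFi i) lS) _.
have -> : (size (k :: s')).+1%:R = 1 + (size (k :: s'))%:R :> R by rewrite -natr1 addrC.
rewrite [leRHS]mulrDr lerD2l; apply: le_trans (ler_wpM2l _ IH) _.
  by rewrite addr_ge0// invr_ge0 ltW.
by rewrite mulrA mulrDl mul1r mulVf ?gt_eqF// addrC.
Qed.

(** At a fixed frequency the transforms of the truncated functions are, up to conjugation and the
    factor [(2 pi)^(-d/2)], coefficients of one exponential cut off to [T], of squared norm [|T|].
    Bessel bounds their sum pointwise, and integrating over [Omega] gives the area factor. *)
Lemma band_sum_le n (e : 'I_n -> X -> R[i]) : orthonormal_fam leb e ->
  \sum_j band (e j) <= (2 * pi) ^- d * fine (leb T) * fine (leb Omega).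
Proof.
move=> oe; have le := oe.1.
have lFe j := lF (le j).
pose g (x t : X) := (\1_T t)%:C * expi (dot (val x) (val t)) : R[i].
have mg x : Cmeas (g x).
  by apply: CmeasM; [exact: Cmeas_indic|apply: Cmeas_expi; exact: measurable_dot_ls].
have sg x t : sqn (g x t) = \1_T t by rewrite /g sqnM sqn_expi mulr1 sqn_indic.
have lg x : L2 leb (g x).
  by split => //; under eq_fun do rewrite sg; exact: integ_indic.
have ng x : nsq leb (g x) = fine (leb T).
  by rewrite -Rintegral_indic//; apply: eq_Rintegral => t _; rewrite sg.
have E1 j x : sqn (FTX (chi T (e j)) x) = (2 * pi) ^- d * sqn (ip leb (g x) (e j)).
  rewrite /FTX /FT sqnM sqn_real fnorm2; congr (_ * _).
  rewrite -sqn_conj -Cintegral_conj; last first.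
    by apply: Cinteg_FT_integrand; exact: (L12_chi mT fT (le j)).1.
  congr sqn; apply: eq_Cintegral => t.
  rewrite /chi /g !conjcM conjc_real conj_expi opprK; ring.
have c0 : 0 <= (2 * pi) ^- d :> R by rewrite -fnorm2 sqr_ge0.
have lc j := L2_chi mO (lFe j).
rewrite /band /nsq -Rintegral_sum; last by move=> j; exact: (lc j).2.
have -> : (2 * pi) ^- d * fine (leb T) * fine (leb Omega) =
    \int[leb]_x ((2 * pi) ^- d * fine (leb T) * \1_Omega x).
  by rewrite RintegralZl ?measurableT ?Rintegral_indic//; exact: integ_indic.
apply: le_integ.
- by apply: (@integ_sum _ _ _ leb _ _ (fun j x => sqn (chi Omega (FTX (chi T (e j))) x))) => j; exact: (lc j).2.
- by apply: integZl; exact: integ_indic.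
move=> x; under eq_bigr do rewrite sqn_chi E1.
rewrite -mulr_sumr -mulr_sumr mulrC ler_wpM2r ?indicE ?ler0n//.
by rewrite ler_wpM2l// -(ng x); exact: bessel.
Qed.

End time_band.

(** * Defect and norm of the time-band limiting operator *)

Section time_band_operator.
Variables (R : realType) (d : nat) (L : lebesgue_space R d).
Local Notation E := 'rV[R]_d.
Local Notation X := (ls_sort L).
Local Notation leb := (ls_mu L).
Local Notation val := (@ls_val R d L).
Implicit Types f g h v w : X -> R[i].

Lemma is_FT_ex_inv h : L12 h -> exists w, is_FT w h.
Proof.
move=> lh; have [u [lu c1 c2]] := fourier_inversion lh.
exists (fun x => conjc (FTX (fun x => conjc (h x)) x)); split; last by exists u.
  by apply: L2_conj; apply: L2_FTX; exact: L12_conj.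
exact: lh.2.
Qed.

Lemma is_FT_unique v g : is_FT v g -> L12 v -> nsq leb (fun x => g x - FTX v x) = 0.
Proof.
move=> H lv; rewrite -(is_FT_isometry H lv) /nsq /Rintegral integral0_eq// => x _.
by rewrite subrr sqn0.
Qed.

Lemma FTX0 x : FTX (cst 0 : X -> R[i]) x = 0.
Proof.
have c0 : Cinteg leb (cst 0 : X -> R[i]) by exact: Cinteg0.
have e := FTZ 0 (val x) c0; rewrite mul0r in e; apply: etrans e.
by apply: eq_FT => y; rewrite mul0r.
Qed.

Variables (T Omega : set X).
Hypotheses (mT : measurable T) (fT : (leb T < +oo)%E).
Hypotheses (mO : measurable Omega) (fO : (leb Omega < +oo)%E).

Section operator_bounds.
Variables (f g w : X -> R[i]).
Hypotheses (lf : L2 leb f) (Hg : is_FT (chi T f) g) (Hw : is_FT w (chi Omega g)).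

Let lv : L12 (chi T f). Proof. exact: L12_chi. Qed.
Let lFv : L2 leb (FTX (chi T f)). Proof. exact: L2_FTX. Qed.
Let lg : L2 leb g. Proof. by case: Hg. Qed.
Let lw : L2 leb w. Proof. by case: Hw. Qed.

Let sqrt_le (x y : R) : 0 <= y -> Num.sqrt x <= Num.sqrt y -> x <= y.
Proof. by move=> y0; rewrite ler_sqrt. Qed.

(** The representative [g] is fixed only up to a null set, so it is compared in norm with the
    explicit Fourier integral. *)
Let nsq_chi0 : nsq leb (fun x => chi Omega g x - chi Omega (FTX (chi T f)) x) = 0.
Proof.
apply/eqP; rewrite eq_le nsq_ge0 andbT -(is_FT_unique Hg lv).
apply: (@le_trans _ _ (nsq leb (chi Omega (fun x => g x - FTX (chi T f) x)))).
  rewrite le_eqVlt; apply/orP; left; apply/eqP; apply: eq_nsq => x.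
  by rewrite /chi mulrBr.
by apply: nsq_chi_le => //; exact: L2B.
Qed.

(** Off [T] the whole of [f] is lost. On [T] the error is part of [w - chi T f], whose norm by
    isometry is that of the spectrum of [chi T f] outside [Omega]. *)
Lemma operator_defect_le : nsq leb (fun x => chi T w x - f x) <= leak T Omega f.
Proof.
have h1 : nsq leb (fun x => w x - chi T f x) <= nsq leb (chi (~` Omega) (FTX (chi T f))).
  rewrite (is_FT_isometry Hw lv); apply: sqrt_le; first exact: nsq_ge0.
  apply: le_trans (nsq_triangle_sub (L2_chi mO lg) (L2_chi mO lFv) lFv) _.
  rewrite nsq_chi0 sqrtr0 add0r le_eqVlt; apply/orP; left; apply/eqP; congr Num.sqrt.
  apply: eq_nsq => x; rewrite sqnBC /chi -[X in sqn (X - _)]mul1r -mulrBl; congr (sqn (_ * _)).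
  by rewrite !indicE in_setC; case: (x \in Omega); rewrite /= ?subrr ?subr0.
rewrite /leak; have lwv := L2B lw lv.2.
apply: (@le_trans _ _ (nsq leb (chi T (fun x => w x - chi T f x)) + nsq leb (chi (~` T) f))).
  have l1 := L2_chi mT lwv; have l2 := L2_chi (measurableC mT) lf.
  rewrite /nsq -RintegralD ?measurableT//; [|exact: l1.2|exact: l2.2].
  rewrite le_eqVlt; apply/orP; left; apply/eqP; apply: eq_Rintegral => x _.
  rewrite !sqn_chi /chi !indicE in_setC; case: (x \in T) => /=.
    by rewrite !mul1r mul0r addr0.
  by rewrite !mul0r mul1r !add0r sqnN.
rewrite lerD2r; apply: le_trans h1; exact: nsq_chi_le.
Qed.

(** The isometry, used with the zero function as comparison, gives [w] the norm of the spectrum cut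
    off to [Omega]. *)
Lemma operator_norm_le : nsq leb (chi T w) <= band T Omega f.
Proof.
apply: le_trans (nsq_chi_le mT lw) _.
have L0 : L12 (cst 0 : X -> R[i]) by split; [exact: Cinteg0|exact: L2_0].
have := is_FT_isometry Hw L0; under eq_fun do rewrite subr0.
move=> ->; under eq_fun do rewrite FTX0.
apply: sqrt_le; first exact: nsq_ge0.
have l0 := L2_0 leb.
apply: le_trans (nsq_triangle_sub (L2_chi mO lg) (L2_chi mO lFv) l0) _.
rewrite nsq_chi0 sqrtr0 add0r /band; under eq_fun do rewrite subr0.
by [].
Qed.

End operator_bounds.

End time_band_operator.

(** * Passage to the norms and transforms used in the statement *)

Section Lnorm_complex.
Variables (R : realType) (d' : measure_display) (Y : measurableType d').
Variable mu : {measure set Y -> \bar R}.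
Implicit Types f g : Y -> R[i].

Let N2 f : \bar R := ('N[mu]_(2%:E)[(fun x => (Normc.normc (f x))%:E)])%E.

Let N2_pow f : (N2 f `^ 2 = \int[mu]_x (sqn (f x))%:E)%E.
Proof.
rewrite /N2 powR_Lnorm ?pnatr_eq0//; apply: eq_integral => x _.
rewrite gee0_abs ?lee_fin ?normc_ge0// poweR_EFin sqn_normc.
by rewrite -[2]/(2%:R) powR_mulrn// normc_ge0.
Qed.

Lemma Lnorm2_lty f : Cmeas f -> ('N[mu]_(2%:E)[(fun x => (Normc.normc (f x))%:E)] < +oo)%E ->
  L2 mu f.
Proof.
move=> mf; rewrite -/(N2 f) => h; split => //; apply: ge0_integP.
- exact: measurable_sqn.
- by move=> x; exact: sqn_ge0.
rewrite -N2_pow; have : (0 <= N2 f)%E by exact: Lnorm_ge0.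
by case: (N2 f) h => [r| |] // _ _; rewrite poweR_EFin ltry.
Qed.

Lemma Lnorm2E f : L2 mu f ->
  ('N[mu]_(2%:E)[(fun x => (Normc.normc (f x))%:E)] = (Num.sqrt (nsq mu f))%:E)%E.
Proof.
move=> lf; rewrite -/(N2 f).
have := N2_pow f; rewrite (integ_fineK lf.2) -/(nsq mu f).
have : (0 <= N2 f)%E by exact: Lnorm_ge0.
case: (N2 f) => [r| |] //; last by rewrite poweRyr// pnatr_eq0.
rewrite lee_fin poweR_EFin => r0 [] <-.
by rewrite -[2]/(2%:R) powR_mulrn// sqrtr_sqr ger0_norm.
Qed.

Lemma Lnorm1_Cinteg f : Cmeas f ->
  ('N[mu]_(1%:E)[(fun x => (Normc.normc (f x))%:E)] < +oo)%E <-> Cinteg mu f.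
Proof.
move=> mf; rewrite Lnorm1.
have -> : (\int[mu]_x `|(Normc.normc (f x))%:E| = \int[mu]_x (Normc.normc (f x))%:E)%E.
  by apply: eq_integral => x _; rewrite gee0_abs// lee_fin normc_ge0.
split=> [h|cf]; last by apply: integ_lty; exact: Cinteg_normc.
apply: (@Cinteg_le _ _ _ mu _ (fun x => Normc.normc (f x))) => //.
apply: ge0_integP => //; first exact: measurable_normc.
by move=> x; exact: normc_ge0.
Qed.

Lemma Lnorm2_cvg0 (u : nat -> Y -> R[i]) : (forall n, L2 mu (u n)) ->
  ('N[mu]_(2%:E)[(fun x => (Normc.normc (u n x))%:E)] @[n --> \oo] --> 0)%E <->
  nsq mu (u n) @[n --> \oo] --> (0 : R).
Proof.
move=> lu; have E1 : (fun n => 'N[mu]_(2%:E)[(fun x => (Normc.normc (u n x))%:E)])%E =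
    EFin \o (fun n => Num.sqrt (nsq mu (u n))).
  by apply/funext => n; rewrite Lnorm2E.
rewrite E1; split=> [/fine_cvg h|h].
  have h1 : Num.sqrt (nsq mu (u n)) @[n --> \oo] --> (0 : R) by exact: h.
  have -> : (fun n => nsq mu (u n)) =
      (fun n => Num.sqrt (nsq mu (u n)) * Num.sqrt (nsq mu (u n))).
    by apply/funext => n; rewrite -expr2 sqr_sqrtr// nsq_ge0.
  by rewrite -[X in _ --> X](mulr0 0); exact: (cvgM h1 h1).
by apply: cvg_EFin; [exact: nearW|exact: sqrt_cvg0].
Qed.

End Lnorm_complex.

Section frozen_operators.
Variables (R : realType) (d : nat).
Local Notation E := 'rV[R]_d.
Local Notation L := (Leb_space R d).
Local Notation X := (ls_sort L).
Local Notation leb := (ls_mu L).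
Implicit Types f g : E -> R[i].

Lemma normL2_lty f : inL 2 f -> L2 leb (f : X -> R[i]).
Proof. move=> [mf hf]; exact: (@Lnorm2_lty R _ X leb f mf hf). Qed.

Lemma normL2E f : L2 leb (f : X -> R[i]) -> normL 2 f = (Num.sqrt (nsq leb (f : X -> R[i])))%:E.
Proof. move=> lf; exact: (@Lnorm2E R _ X leb f lf). Qed.

Lemma inL2P f : inL 2 f <-> L2 leb (f : X -> R[i]).
Proof.
split; first exact: normL2_lty.
move=> lf; split; first exact: lf.1.
by rewrite (normL2E lf) ltry.
Qed.

Lemma inL1P f : Defs.measurableC f -> inL 1 f <-> Cinteg leb (f : X -> R[i]).
Proof.
move=> mf; have H := @Lnorm1_Cinteg R _ X leb f mf.
split; first by move=> [_ h]; exact: (H.1 h).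
by move=> cf; split; [exact: mf|exact: (H.2 cf)].
Qed.

Lemma L12P f : L12 (f : X -> R[i]) <-> inL 1 f /\ inL 2 f.
Proof.
split=> [[cf lf]|[h1 h2]].
  by split; [exact: ((inL1P lf.1).2 cf)|exact: ((inL2P f).2 lf)].
by split; [exact: ((inL1P h1.1).1 h1)|exact: ((inL2P f).1 h2)].
Qed.

Lemma fourier_integralE f : fourier_integral f = FTX (f : X -> R[i]) :> (E -> R[i]).
Proof. by apply/funext => xi; rewrite /FTX /FT fnormE. Qed.

Lemma is_fourierP f g : is_fourier f g <-> is_FT (f : X -> R[i]) (g : X -> R[i]).
Proof.
split.
  move=> [/inL2P lf /inL2P lg [u [hu c1 c2]]].
  have lu n : L12 (u n : X -> R[i]) by apply/L12P; exact: hu.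
  split; [exact: lf|exact: lg|].
  exists u; split; first exact: lu.
    apply: (proj1 (@Lnorm2_cvg0 R _ X leb (fun n x => u n x - f x) _)); last exact: c1.
    by move=> n; apply: L2B; [exact: (lu n).2|exact: lf].
  apply: (proj1 (@Lnorm2_cvg0 R _ X leb (fun n x => FTX (u n : X -> R[i]) x - g x) _)).
    by move=> n; apply: L2B; [exact: (L2_FTX (lu n))|exact: lg].
  by move: c2; under eq_fun do rewrite fourier_integralE; exact.
move=> [lf lg [u [lu c1 c2]]]; split; [exact/inL2P|exact/inL2P|].
exists u; split; first by move=> n; apply/L12P; exact: lu.
  apply: (proj2 (@Lnorm2_cvg0 R _ X leb (fun n x => u n x - f x) _)); last exact: c1.
  by move=> n; apply: L2B; [exact: (lu n).2|exact: lf].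
under eq_fun do rewrite fourier_integralE.
apply: (proj2 (@Lnorm2_cvg0 R _ X leb (fun n x => FTX (u n : X -> R[i]) x - g x) _)); last exact: c2.
by move=> n; apply: L2B; [exact: (L2_FTX (lu n))|exact: lg].
Qed.

Variables (T Omega : set E).
Hypotheses (mT : Lebesgue_measurable T) (fT : (Leb T < +oo)%E).
Hypotheses (mO : Lebesgue_measurable Omega) (fO : (Leb Omega < +oo)%E).

(** Both choices by [xget] are made from nonempty sets: functions cut off to a set of finite measure
    lie in both L^1 and L^2, so a transform and an inverse transform exist and the default 0 is
    never taken. *)
Lemma time_band_limit_bounds f : L2 leb (f : X -> R[i]) ->
  [/\ L2 leb (time_band_limit T Omega f : X -> R[i]),
      nsq leb (fun x : X => time_band_limit T Omega f x - f x) <=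
        leak (T : set X) (Omega : set X) f &
      nsq leb (time_band_limit T Omega f : X -> R[i]) <= band (T : set X) (Omega : set X) f].
Proof.
move=> lf; pose v : X -> R[i] := chi (T : set X) f.
have lv : L12 v by exact: L12_chi.
have Hg : is_FT v (fourier v : X -> R[i]).
  apply/is_fourierP; apply: (@xgetPex _ (cst 0) [set g | is_fourier v g]).
  by exists (FTX v); apply/is_fourierP; exact: is_FT_L12.
have lh : L12 (chi (Omega : set X) (fourier v)).
  by apply: L12_chi; [exact: mO|exact: fO|case: Hg].
have Hw : is_FT (fourier_inv (chi (Omega : set X) (fourier v)) : X -> R[i])
    (chi (Omega : set X) (fourier v)).
  apply/is_fourierP.
  apply: (@xgetPex _ (cst 0) [set g | is_fourier g (chi (Omega : set X) (fourier v))]).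
  by have [w hw] := is_FT_ex_inv lh; exists w; apply/is_fourierP.
split.
- by apply: L2_chi; [exact: mT|case: Hw].
- exact: (@operator_defect_le R d L T Omega mT fT mO f _ _ lf Hg Hw).
- exact: (@operator_norm_le R d L T Omega mT fT mO f _ _ lf Hg Hw).
Qed.

End frozen_operators.

(** * Existence of the maximum *)

Section almost_fixed.
Variables (R : realType) (d : nat).
Local Notation E := 'rV[R]_d.
Local Notation L := (Leb_space R d).
Local Notation X := (ls_sort L).
Local Notation leb := (ls_mu L).

Lemma orthonormal_famP n (f : 'I_n -> E -> R[i]) :
  Defs.orthonormal f <-> orthonormal_fam leb (f : 'I_n -> X -> R[i]).
Proof.
split=> [[h1 h2]|[h1 h2]]; split.
- by move=> i; exact: ((inL2P _).1 (h1 i)).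
- exact: h2.
- by move=> i; exact: ((inL2P _).2 (h1 i)).
- exact: h2.
Qed.

Lemma normL2_sqr (f : E -> R[i]) : L2 leb (f : X -> R[i]) ->
  (normL 2 f ^+ 2 = (nsq leb (f : X -> R[i]))%:E)%E.
Proof.
move=> lf; rewrite (normL2E lf) -EFin_expe sqr_sqrtr//; exact: nsq_ge0.
Qed.

Lemma nsq_orthonormal (I : eqType) (e : I -> X -> R[i]) i :
  orthonormal_fam leb e -> nsq leb (e i) = 1.
Proof.
by move=> [_ oe]; apply: (@complexI R); rewrite -ipff oe eqxx.
Qed.

Variables (T Omega : set E) (eps : R).
Hypotheses (mT : Lebesgue_measurable T) (fT : (Leb T < +oo)%E).
Hypotheses (mO : Lebesgue_measurable Omega) (fO : (Leb Omega < +oo)%E).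
Hypotheses (eps_gt0 : 0 < eps) (eps_lt1 : eps < 1).

Lemma defect_sqrE (f : E -> R[i]) : L2 leb (f : X -> R[i]) ->
  (normL 2 (time_band_limit T Omega f \- f)%R ^+ 2 =
   (nsq leb (fun x : X => time_band_limit T Omega f x - f x))%:E)%E.
Proof.
move=> lf; have [lP _ _] := time_band_limit_bounds mT fT mO fO lf.
apply: (@normL2_sqr (fun x => time_band_limit T Omega f x - f x)).
exact: (L2B lP lf).
Qed.

Lemma almost_fixed_leak n (e : 'I_n -> X -> R[i]) : orthonormal_fam leb e ->
  (forall i, leak (T : set X) (Omega : set X) (e i) <= eps) ->
  almost_fixed_numbers T Omega eps n.
Proof.
move=> oe he; exists e; split; first by apply/orthonormal_famP.
move=> i; rewrite (defect_sqrE (oe.1 i)) lee_fin.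
by have [_ h _] := time_band_limit_bounds mT fT mO fO (oe.1 i); exact: le_trans h (he i).
Qed.

(** For a unit vector with squared defect at most [eps], the operator image has norm at least
    [1 - sqrt eps]; hence each function uses at least the square of this from the total that
    [band_sum_le] allows. *)
Lemma almost_fixed_bound n : almost_fixed_numbers T Omega eps n ->
  n%:R * (1 - Num.sqrt eps) ^+ 2 <= (2 * pi) ^- d * fine (Leb T) * fine (Leb Omega).
Proof.
move=> [f [/orthonormal_famP oe he]].
apply: le_trans (@band_sum_le R d L T Omega mT fT mO fO n f oe).
rewrite -[n in n%:R]card_ord -sum1_card natr_sum mulr_suml; apply: ler_sum => i _.
rewrite mul1r; have lf := oe.1 i.
have [lP _ hb] := time_band_limit_bounds mT fT mO fO lf.
apply: le_trans hb.
have := he i; rewrite (defect_sqrE lf) lee_fin => hd.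
have tri := nsq_triangle lP (L2B lf lP).
have e1 : nsq leb (fun x : X => time_band_limit T Omega (f i) x +
    (f i x - time_band_limit T Omega (f i) x)) = 1.
  rewrite -(nsq_orthonormal i oe); apply: eq_nsq => x; by rewrite addrC subrK.
move: tri; rewrite e1 sqrtr1 (@nsq_subC R d L (f i)).
have : Num.sqrt (nsq leb (fun x : X => time_band_limit T Omega (f i) x - f i x)) <= Num.sqrt eps.
  by rewrite ler_sqrt// ltW.
have n0 : 0 <= nsq leb (time_band_limit T Omega (f i) : X -> R[i]) by exact: nsq_ge0.
move=> h1 h2; rewrite -[leRHS](sqr_sqrtr n0).
rewrite ler_sqr ?nnegrE ?sqrtr_ge0//.
  by move: h1 h2; move: (Num.sqrt (nsq _ _)) (Num.sqrt (nsq _ _)) (Num.sqrt eps) => a b c; lra.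
by rewrite subr_ge0 -[leRHS]sqrtr1 ler_sqrt ?ltW.
Qed.

Lemma Mminus_exists : exists m, is_Mminus T Omega eps m.
Proof.
set C := (2 * pi) ^- d * fine (Leb T) * fine (Leb Omega).
set q := (1 - Num.sqrt eps) ^+ 2.
have q0 : 0 < q.
  rewrite exprn_gt0// subr_gt0 -[ltRHS]sqrtr1 ltr_sqrt//.
pose P n := `[< almost_fixed_numbers T Omega eps n >].
have P0 : exists n, P n.
  (* The empty family shows that the set of possible numbers is not empty. *)
  exists 0%N; apply/asboolP; exists (fun=> cst 0); split; last by case.
  by split; case.
have ub n : P n -> (n <= (Num.truncn (C / q)).+1)%N.
  move=> /asboolP /almost_fixed_bound; rewrite -/C -/q -ler_pdivlMr// => h.
  by rewrite -(ler_nat R) (le_trans h)// ltW// truncnS_gt.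
case: (ex_maxnP P0 ub) => m /asboolP mP hm; exists m; split => // n nP.
by apply: hm; apply/asboolP.
Qed.

End almost_fixed.

(** * Wave packets and their mixtures *)

Section wave_packets.
Variables (R : realType) (d : nat) (L : lebesgue_space R d).
Local Notation E := 'rV[R]_d.
Local Notation X := (ls_sort L).
Local Notation leb := (ls_mu L).
Local Notation val := (@ls_val R d L).

Definition ucubeX : set X := val @^-1` (@ucube R d).

Lemma measurable_ucubeX : measurable ucubeX.
Proof. by apply: measurable_ls_set; exact: measurable_ucube. Qed.

Lemma leb_ucubeX : leb ucubeX = 1%E. Proof. exact: leb_ucube. Qed.

Lemma leb_ucubeX_lty : (leb ucubeX < +oo)%E. Proof. by rewrite leb_ucubeX ltry. Qed.

Lemma ucubeX_exp (n : 'rV[int]_d) :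
  Cinteg leb (fun u => (\1_ucubeX u)%:C * expi (2 * pi * dot (zr R n) (val u))) /\
  Cintegral leb (fun u => (\1_ucubeX u)%:C * expi (2 * pi * dot (zr R n) (val u))) = (n == 0)%:R.
Proof.
pose f (j : 'I_d) (x : R) := (\1_(`[0, 0 + 1[%classic) x)%:C * expi (2 * pi * (n 0 j)%:~R * x) : R[i].
have [cf Ef] := @Cinteg_prod R d L f (fun j => (Cintegral_exp_period (n 0 j) 0).1).
have E1 : (fun u => (\1_ucubeX u)%:C * expi (2 * pi * dot (zr R n) (val u))) =
    (fun u : X => \prod_j f j (val u 0 j)).
  apply/funext => u; rewrite /f big_split /=; congr (_ * _); last first.
    rewrite -(big_morph _ (@expiD R) (@expi0 R)); congr (expi _).
    by rewrite /dot mulr_sumr; apply: eq_bigr => j _; rewrite mxE mulrA.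
  rewrite -(big_morph _ (@real_complexM R) (erefl _)); congr (_%:C).
  rewrite indicE; have [|nU] := boolP (u \in ucubeX).
    rewrite inE => Uu; rewrite big1// => j _; rewrite indicE mem_set//= in_itv/= add0r.
    exact: (Uu j).
  have [j hj] : exists j, ~ (0 <= val u 0 j < 1).
    by apply/existsNP => H; move: nU; rewrite notin_setE; apply.
  rewrite (bigD1 j)//= indicE memNset ?mul0r//= in_itv/= add0r.
  exact: hj.
rewrite E1; split => //; rewrite Ef.
under eq_bigr do rewrite (Cintegral_exp_period _ _).2.
have [->|n0] := eqVneq n 0; first by rewrite big1// => j _; rewrite mxE eqxx.
have [j hj] : exists j, n 0 j != 0.
  apply/existsP; apply: contraNT n0 => /existsPn H; apply/eqP/rowP => j.
  by rewrite mxE; apply/eqP; have := H j; rewrite negbK.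
by rewrite (bigD1 j)//= (negbTE hj) mul0r.
Qed.

Variables (lam : R) (tau p0 : E).
Hypothesis lam0 : 0 < lam.

Let lamV0 : 0 < lam^-1. Proof. by rewrite invr_gt0. Qed.

Definition cornerX (a : 'rV[int]_d) : E := tau + lam *: zr R a.

(** The spacing [2 pi / lam] lets a whole number of periods of every frequency difference fit in a
    cube of side [lam]. *)
Definition freq (k : 'rV[int]_d) : E := p0 + (2 * pi / lam) *: zr R k.

Definition cubebump (a : 'rV[int]_d) (t : X) : R :=
  Num.sqrt (lam ^- d) * \1_ucubeX (affX lam^-1 (- (lam^-1 *: cornerX a)) t).

Definition packet (i : 'rV[int]_d * 'rV[int]_d) (t : X) : R[i] :=
  (cubebump i.1 t)%:C * expi (dot (freq i.2) (val t)).

Lemma affX_inv x u : affX lam^-1 (- (lam^-1 *: x)) (affX lam x u) = u :> X.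
Proof.
apply: (can_inj (@ls_valK _ _ L)); rewrite !val_affX scalerDr scalerA mulVf ?gt_eqF//.
by rewrite scale1r addrK.
Qed.

Lemma Cintegral_subst (g : X -> R[i]) x : Cinteg leb g ->
  Cintegral leb g = (lam ^+ d)%:C * Cintegral leb (fun u => g (affX lam x u)).
Proof.
move=> cg; rewrite (Cintegral_affX x lam0 cg) mulrA -real_complexM divff ?mul1r//.
by rewrite gt_eqF// exprn_gt0.
Qed.

Lemma Rintegral_subst (g : X -> R) x : integ leb g ->
  \int[leb]_t g t = lam ^+ d * \int[leb]_u g (affX lam x u).
Proof.
move=> cg; rewrite (Rintegral_affX x lam0 cg) mulrA divff ?mul1r//.
by rewrite gt_eqF// exprn_gt0.
Qed.

Let sq2 : Num.sqrt (lam ^- d) ^+ 2 = lam ^- d.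
Proof. by rewrite sqr_sqrtr// invr_ge0 exprn_ge0// ltW. Qed.

Let lamd : lam ^+ d * lam ^- d = 1.
Proof. by rewrite divff// gt_eqF// exprn_gt0. Qed.

Lemma cubebump_affX a u : cubebump a (affX lam (cornerX a) u) = Num.sqrt (lam ^- d) * \1_ucubeX u.
Proof. by rewrite /cubebump affX_inv. Qed.

Lemma integ_cubebump a : integ leb (cubebump a).
Proof.
apply: integZl; apply: (integ_affX _ lamV0).
by apply: integ_indic; [exact: measurable_ucubeX|exact: leb_ucubeX_lty].
Qed.

Lemma cubebump_sqr a t : cubebump a t ^+ 2 = Num.sqrt (lam ^- d) * cubebump a t.
Proof.
rewrite /cubebump exprMn expr2 -mulrA; congr (_ * (_ * _)).
by rewrite indicE expr2 -natrM mulnb andbb.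
Qed.

Lemma sqn_packet i t : sqn (packet i t) = cubebump i.1 t ^+ 2.
Proof. by rewrite /packet sqnM sqn_expi mulr1 sqn_real. Qed.

Lemma L12_packet i : L12 (packet i).
Proof.
have mp : Cmeas (packet i).
  apply: CmeasM; first by apply: Cmeas_real; exact: (integ_measurable (integ_cubebump _)).
  by apply: Cmeas_expi; exact: measurable_dot_ls.
split.
  by apply: Cinteg_expiM; [exact: (Cinteg_real (integ_cubebump _))|exact: measurable_dot_ls].
split => //; under eq_fun do rewrite sqn_packet cubebump_sqr.
by apply: integZl; exact: integ_cubebump.
Qed.

Lemma cubebump_disjoint a b t : a != b -> cubebump a t * cubebump b t = 0.
Proof.
have H c : affX lam^-1 (- (lam^-1 *: cornerX c)) t \in ucubeX ->
    floor_rV (lam^-1 *: (val t - tau)) = c.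
  rewrite inE /ucubeX /= val_affX => Uc; apply/ucube_floor; move: Uc.
  by rewrite /cornerX scalerDr scalerA mulVf ?gt_eqF// scale1r opprD addrA scalerBr.
move=> ab; rewrite /cubebump !indicE.
have [/H ea|] := boolP (_ \in ucubeX); last by rewrite mulr0 mul0r.
have [/H eb|] := boolP (_ \in ucubeX); last by rewrite !mulr0.
by move: ab; rewrite -ea -eb eqxx.
Qed.

(** Packets of different cubes have disjoint supports. In a common cube, rescaling leaves a constant
    times the integral of an integer exponential over the unit cube. *)
Lemma orthonormal_packet : orthonormal_fam leb packet.
Proof.
split; first by move=> i; exact: (L12_packet i).2.
move=> [a k] [b l]; rewrite /ip.
have ii := L2_ip (L12_packet (a, k)).2 (L12_packet (b, l)).2.
have ptE t : packet (a, k) t * conjc (packet (b, l) t) =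
    (cubebump a t * cubebump b t)%:C * expi (dot (freq k - freq l) (val t)).
  by rewrite /packet conjcM conjc_real conj_expi mulrACA -expiD -real_complexM dotBl.
have [ab|ab] := eqVneq a b; last first.
  rewrite xpair_eqE (negbTE ab)/= (eq_Cintegral _ (g := cst 0)); last first.
    by move=> t; rewrite ptE cubebump_disjoint// mul0r.
  by apply: complexP; rewrite /Cintegral /= /Rintegral integral0.
subst b; rewrite (Cintegral_subst (cornerX a) ii).
(* The phase caused by the corner of the cube; it equals 1 on the diagonal, the only place where the
   integral is nonzero. *)
pose ph := expi (2 * pi / lam * dot (zr R (k - l)) (cornerX a)) : R[i].
have fE : freq k - freq l = (2 * pi / lam) *: zr R (k - l).
  rewrite /freq opprD addrACA subrr add0r -scalerBr; congr (_ *: _).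
  by apply/rowP => j; rewrite !mxE intrB.
rewrite (eq_Cintegral _ (g := fun u => ((lam ^- d)%:C * ph) *
    ((\1_ucubeX u)%:C * expi (2 * pi * dot (zr R (k - l)) (val u))))); last first.
  move=> u; rewrite ptE -expr2 cubebump_sqr cubebump_affX mulrA -expr2 sq2 val_affX fE.
  rewrite dotZl dotDr dotZr mulrDr expiD -/ph real_complexM.
  have -> : 2 * pi / lam * (lam * dot (zr R (k - l)) (val u)) = 2 * pi * dot (zr R (k - l)) (val u).
    by rewrite mulrA divfK// gt_eqF.
  by ring.
have [c1 e1] := ucubeX_exp (k - l).
rewrite (CintegralZl _ c1) e1 subr_eq0 xpair_eqE eqxx andTb.
have [kl|kl] := eqVneq k l; last by rewrite !mulr0.
rewrite mulr1 mulrA -real_complexM lamd mul1r /ph kl subrr.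
have -> : zr R (0 : 'rV[int]_d) = 0 by apply/rowP => j; rewrite !mxE.
by rewrite /dot big1 ?mulr0 ?expi0// => j _; rewrite mxE mul0r.
Qed.

Definition cubeFT2 (y : X) : R := sqn (FTX (fun u : X => (\1_ucubeX u)%:C) y).

Lemma integ_cubeFT2 : integ leb cubeFT2.
Proof.
have l : L12 (fun u : X => (\1_ucubeX u)%:C).
  by split; [apply: Cinteg_indic|apply: L2_indic]; first [exact: measurable_ucubeX|exact: leb_ucubeX_lty].
exact: (L2_FTX l).2.
Qed.

Lemma cubeFT2_ge0 y : 0 <= cubeFT2 y. Proof. exact: sqn_ge0. Qed.

(** Modulation shifts the transform and dilation rescales it, while the position of the cube
    contributes a phase lost in the modulus. Hence the frequency leakage depends on the frequency
    index alone. *)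
Lemma sqn_FTX_packet i (xi : X) :
  sqn (FTX (packet i) xi) = lam ^+ d * cubeFT2 (affX lam (- (lam *: freq i.2)) xi).
Proof.
rewrite /FTX /packet FT_modulate; set eta := val xi - freq i.2.
have eE : val (affX lam (- (lam *: freq i.2)) xi) = lam *: eta.
  by rewrite val_affX scalerBr.
rewrite /cubeFT2 /FTX eE /FT.
have cb : Cinteg leb (fun t => (cubebump i.1 t)%:C) by apply: Cinteg_real; exact: integ_cubebump.
rewrite (Cintegral_subst (cornerX i.1) (Cinteg_FT_integrand eta cb)).
rewrite (eq_Cintegral _ (g := fun u => ((Num.sqrt (lam ^- d))%:C * expi (- dot eta (cornerX i.1))) *
    ((\1_ucubeX u)%:C * expi (- dot (lam *: eta) (val u))))); last first.
  move=> u; rewrite cubebump_affX val_affX dotDr dotZr dotZl opprD expiD real_complexM; ring.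
rewrite CintegralZl; last first.
  apply: Cinteg_FT_integrand.
  by apply: Cinteg_indic; [exact: measurable_ucubeX|exact: leb_ucubeX_lty].
rewrite !sqnM sqn_expi !sqn_real sq2.
move: (sqn _) (fnorm R d) => z f; move: lamd; move: (lam ^- d) => B.
move: (lam ^+ d) => A AB; transitivity ((A * B) * (A * (f ^+ 2 * z))); first by ring.
by rewrite AB mul1r.
Qed.

Lemma nsq_chi_packet (T : set X) i : measurable T ->
  ((nsq leb (chi (~` T) (packet i)))%:E = escape T (\1_ucubeX : X -> R) lam (cornerX i.1))%E.
Proof.
move=> mT; have lp := (L12_packet i).2; have lc := L2_chi (measurableC mT) lp.
rewrite /nsq (Rintegral_subst (cornerX i.1) lc.2).
have E1 u : sqn (chi (~` T) (packet i) (affX lam (cornerX i.1) u)) =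
    lam ^- d * (\1_ucubeX u * \1_(~` T) (affX lam (cornerX i.1) u)).
  rewrite sqn_chi sqn_packet cubebump_sqr cubebump_affX mulrA -expr2 sq2; ring.
have ii : integ leb (fun u => \1_ucubeX u * \1_(~` T) (affX lam (cornerX i.1) u) : R).
  have i0 : integ leb (\1_ucubeX : X -> R).
    by apply: integ_indic; [exact: measurable_ucubeX|exact: leb_ucubeX_lty].
  apply: (integ_le _ i0).
    apply: measurable_funM; first exact: (integ_measurable i0).
    have mi : measurable_fun setT (\1_(~` T) : X -> R).
      by apply: measurable_indic; exact: measurableC.
    exact: (measurableT_comp mi (measurable_affX _ lam0)).
  move=> u; rewrite ger0_norm ?indicE ?mulr_ge0//.
  by rewrite ler_piMr// lern1 leq_b1.
under eq_Rintegral do rewrite E1.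
by rewrite RintegralZl ?measurableT// mulrA lamd mul1r /escape (integ_fineK ii).
Qed.

Lemma nsq_chi_FTX_packet (Omega : set X) i : measurable Omega ->
  ((nsq leb (chi (~` Omega) (FTX (packet i))))%:E = escape Omega cubeFT2 lam^-1 (freq i.2))%E.
Proof.
move=> mO; have lp := L2_FTX (L12_packet i); have lc := L2_chi (measurableC mO) lp.
pose y0 := - (lam *: freq i.2).
have ii : integ leb (fun y => cubeFT2 y * \1_(~` Omega) (affX lam^-1 (freq i.2) y)).
  apply: (integ_le _ integ_cubeFT2).
    apply: measurable_funM; first exact: (integ_measurable integ_cubeFT2).
    have mi : measurable_fun setT (\1_(~` Omega) : X -> R).
      by apply: measurable_indic; exact: measurableC.
    exact: (measurableT_comp mi (measurable_affX _ lamV0)).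
  move=> u; rewrite ger0_norm ?mulr_ge0 ?cubeFT2_ge0 ?indicE//.
  by rewrite ler_piMr ?cubeFT2_ge0// lern1 leq_b1.
rewrite /escape (integ_fineK ii); congr (_%:E).
rewrite (Rintegral_subst y0 ii) -RintegralZl ?measurableT//; last first.
  exact: (integ_affX y0 lam0 ii).
apply: eq_Rintegral => xi _; rewrite sqn_chi sqn_FTX_packet.
have -> : affX lam^-1 (freq i.2) (affX lam y0 xi) = xi.
  apply: (can_inj (@ls_valK _ _ L)); rewrite !val_affX scalerDr scalerA mulVf ?gt_eqF//.
  by rewrite scale1r /y0 scalerN scalerA mulVf ?gt_eqF// scale1r subrK.
by rewrite mulrC mulrA.
Qed.

(** The packet cut off to [T] is the packet minus its part outside [T]. Outside [Omega] the two
    transforms contribute [2 del] each, and the time leakage adds a fifth [del]. *)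
Lemma leak_packet (T Omega : set X) (del : R) i :
  measurable T -> (leb T < +oo)%E -> measurable Omega ->
  (escape T (\1_ucubeX : X -> R) lam (cornerX i.1) <= del%:E)%E ->
  (escape Omega cubeFT2 lam^-1 (freq i.2) <= del%:E)%E ->
  leak T Omega (packet i) <= 5 * del.
Proof.
move=> mT fT mO; rewrite -nsq_chi_packet// -nsq_chi_FTX_packet// !lee_fin => h1 h2.
have lp := L12_packet i; have mTc := measurableC mT; have mOc := measurableC mO.
have l1 := L12_chi mT fT lp.2.
have l2 : L12 (chi (~` T) (packet i)).
  rewrite (_ : chi (~` T) (packet i) = fun x => packet i x - chi T (packet i) x).
    exact: L12B.
  apply/funext => x; rewrite /chi -[X in X - _]mul1r -mulrBl; congr (_ * _).
  by rewrite !indicE in_setC; case: (x \in T); rewrite /= ?subrr ?subr0.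
have E1 x : FTX (chi T (packet i)) x = FTX (packet i) x - FTX (chi (~` T) (packet i)) x.
  rewrite -FTX_B//; apply: eq_FT => y; rewrite /chi -[X in X - _]mul1r -mulrBl; congr (_ * _).
  by rewrite !indicE in_setC; case: (y \in T); rewrite /= ?subrr ?subr0.
have k1 := L2_chi mOc (L2_FTX lp); have k2 := L2_chi mOc (L2_FTX l2).
have H : nsq leb (chi (~` Omega) (FTX (chi T (packet i)))) <=
    2 * nsq leb (chi (~` Omega) (FTX (packet i))) +
    2 * nsq leb (chi (~` Omega) (FTX (chi (~` T) (packet i)))).
  rewrite -[X in _ + 2 * X]nsqN; apply: le_trans (nsqD_le2 k1 (L2N k2)).
  rewrite le_eqVlt; apply/orP; left; apply/eqP.
  by apply: eq_nsq => x; rewrite /chi E1 mulrBr.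
have H2 := le_trans (nsq_chi_le mOc (L2_FTX l2)) (nsq_FTX_le l2).
rewrite /leak; apply: le_trans (lerD H h1) _.
have H3 : 2 * nsq leb (chi (~` Omega) (FTX (packet i))) <= 2 * del.
  exact: (ler_wpM2l (ler0n R 2) h2).
have H4 : 2 * nsq leb (chi (~` Omega) (FTX (chi (~` T) (packet i)))) <= 2 * del.
  exact: (ler_wpM2l (ler0n R 2) (le_trans H2 h1)).
have -> : 5 * del = 2 * del + 2 * del + del by ring.
exact: (lerD (lerD H3 H4) (lexx _)).
Qed.

End wave_packets.

(** * Hadamard matrices and mixtures of packets *)

Section hadamard.
Variables (R : realType) (p : nat).
Local Notation J := {ffun 'I_p -> bool}.

Definition hsign (x y : bool) : R := if x && y then -1 else 1.

(** Sylvester's matrix: the entry is the sign of the mod 2 inner product of two bit vectors, so the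
    rows are the Walsh functions. *)
Definition hadamard (c a : J) : R := \prod_i hsign (c i) (a i).

Lemma hadamard_sqr c a : hadamard c a ^+ 2 = 1.
Proof.
rewrite /hadamard -prodrXl big1// => i _.
by rewrite /hsign; case: ifP; rewrite ?sqrrN expr1n.
Qed.

(** The sum over bit vectors factors over the bits, and a bit where [c] and [c'] differ contributes
    the factor [1 - 1]. *)
Lemma hadamard_orthogonal c c' :
  \sum_a hadamard c a * hadamard c' a = (c == c')%:R * 2 ^+ p.
Proof.
under eq_bigr do rewrite /hadamard -big_split /=.
rewrite -(bigA_distr_bigA (fun i b => hsign (c i) b * hsign (c' i) b)).
have E1 i : \sum_b hsign (c i) b * hsign (c' i) b = (c i == c' i)%:R * 2.
  rewrite big_bool /hsign; case: (c i); case: (c' i) => /=;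
    rewrite ?mulrNN ?mulrN ?mulNr ?mulr1 ?mul1r ?mul0r //; ring.
rewrite (eq_bigr _ (fun i _ => E1 i)).
have [->|ne] := eqVneq c c'.
  under eq_bigr do rewrite eqxx mul1r.
  by rewrite prodr_const card_ord mul1r.
have [i hi] : exists i, c i != c' i.
  apply/existsP; apply: contraNT ne => /existsPn H; apply/eqP/ffunP => i.
  by apply/eqP; have := H i; rewrite negbK.
by rewrite (bigD1 i)//= (negbTE hi) !mul0r.
Qed.

End hadamard.

Lemma sum_pair (V : nmodType) (A B : finType) (F : A * B -> V) :
  \sum_p F p = \sum_a \sum_b F (a, b).
Proof. by rewrite pair_bigA; apply: eq_bigr => -[]. Qed.

Section mixing.
Variables (R : realType) (d : nat) (L : lebesgue_space R d).
Local Notation X := (ls_sort L).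
Local Notation leb := (ls_mu L).
Variables (T Omega : set X).
Hypotheses (mT : measurable T) (fT : (leb T < +oo)%E).
Hypotheses (mO : measurable Omega) (fO : (leb Omega < +oo)%E).
Variables (I : eqType) (e : I -> X -> R[i]).
Hypothesis oe : orthonormal_fam leb e.
Variables (p G : nat).
Local Notation J := {ffun 'I_p -> bool}.
Local Notation K := ('I_G * J)%type.
Variables (g : K -> I) (good : pred J) (t del : R).
Hypotheses (ginj : injective g) (t0 : 0 < t) (del0 : 0 <= del).
Hypothesis hgood : forall k, good k.2 -> leak T Omega (e (g k)) <= del.

Let N : R := 2 ^+ p.
Let N0 : 0 < N. Proof. exact: exprn_gt0. Qed.
Let w : R := (Num.sqrt N)^-1.
Let w2 : w ^+ 2 = N^-1. Proof. by rewrite exprVn sqr_sqrtr// ltW. Qed.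

Let cardJ : #|{: J}|%:R = N.
Proof. by rewrite card_ffun card_bool card_ord natrX. Qed.

Let coef (c a : J) : R[i] := (w * hadamard R c a)%:C.

Let sqn_coef c a : sqn (coef c a) = N^-1.
Proof. by rewrite sqn_real exprMn hadamard_sqr mulr1 w2. Qed.

(* All entries of the Hadamard matrix have the same modulus, so each packet contributes
   equally to each mixture. *)
Definition mixed (k : K) (x : X) : R[i] := \sum_(a : J) coef k.2 a * e (g (k.1, a)) x.

Let oeg : orthonormal_fam leb (e \o g).
Proof.
by split=> [k|k l]; [exact: oe.1|rewrite oe.2 (inj_eq ginj)].
Qed.

Let oeJ i : orthonormal_fam leb (fun a : J => e (g (i, a))).
Proof.
split=> [a|a b]; first exact: oe.1.
by rewrite oe.2 (inj_eq ginj) xpair_eqE eqxx.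
Qed.

Let mixedE k x : mixed k x = \sum_(l : K) ((l.1 == k.1)%:R * coef k.2 l.2) * (e \o g) l x.
Proof.
rewrite sum_pair /=.
rewrite (bigD1 k.1)//= [X in _ + X]big1 ?addr0.
  by apply: eq_bigr => a _; rewrite eqxx mul1r.
by move=> i /negbTE ni; rewrite big1// => a _; rewrite ni !mul0r.
Qed.

Lemma orthonormal_mixed : orthonormal_fam leb mixed.
Proof.
split=> [k|k k'].
  by apply: (@L2_sum _ _ _ leb _ _ (fun a x => coef k.2 a * e (g (k.1, a)) x)) => a; apply: L2Z; exact: oe.1.
rewrite [mixed k](_ : _ = fun x => \sum_(l : K) ((l.1 == k.1)%:R * coef k.2 l.2) * (e \o g) l x); last first.
  by apply/funext => x; exact: mixedE.
rewrite [mixed k'](_ : _ = fun x => \sum_(l : K) ((l.1 == k'.1)%:R * coef k'.2 l.2) * (e \o g) l x); last first.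
  by apply/funext => x; exact: mixedE.
rewrite ip_orthonormal_sums//.
rewrite sum_pair /=.
rewrite (bigD1 k.1)//= [X in _ + X]big1 ?addr0; last first.
  by move=> i /negbTE ni; rewrite big1// => a _; rewrite ni !mul0r.
case: k k' => [i c] [i' c']; rewrite eqxx xpair_eqE /=.
have [ii|ii] := eqVneq i i'; last first.
  rewrite big1// => a _; by rewrite !mul0r conjc0 mulr0.
under eq_bigr do rewrite !mul1r conjc_real -real_complexM mulrACA -expr2 w2.
rewrite -(big_morph _ (@real_complexD R) (erefl _)) -mulr_sumr hadamard_orthogonal.
by rewrite mulrCA mulVf ?mulr1 ?gt_eqF//; case: eqP.
Qed.

(** Split into bad part [F false] and good part [F true]. The bad part is bounded by its squared
    norm, which orthonormality makes exactly the share of bad entries. The good part is summed by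
    Cauchy-Schwarz; the factor [N] is harmless because [del] is chosen after [N]. *)
Lemma leak_mixed k : leak T Omega (mixed k) <=
  (1 + t) * (#|[pred a | ~~ good a]|%:R / N) + (1 + t^-1) * (N * del).
Proof.
pose F (b : bool) a x : R[i] := (if good a == b then coef k.2 a else 0) * e (g (k.1, a)) x.
have lF b a : L2 leb (F b a) by apply: L2Z; exact: oe.1.
have -> : mixed k = fun x => \sum_a F false a x + \sum_a F true a x.
  apply/funext => x; rewrite -big_split; apply: eq_bigr => a _ /=.
  by rewrite /F; case: (good a); rewrite /= !mul0r ?addr0 ?add0r.
have lS b : L2 leb (fun x => \sum_a F b a x).
  by apply: (@L2_sum _ _ _ leb _ _ (F b)).
apply: le_trans (leakD_le mT fT mO t0 (lS false) (lS true)) _.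
apply: lerD.
  apply: ler_wpM2l; first by rewrite addr_ge0// ltW.
  apply: le_trans (leak_le_nsq mT fT mO (lS false)) _.
  rewrite (nsq_orthonormal_sum _ (oeJ k.1)) -sum1_card natr_sum mulr_suml [leRHS]big_mkcond /=.
  apply: ler_sum => a _; rewrite inE; case: (good a) => /=.
    by rewrite sqn0.
  by rewrite sqn_coef mul1r.
apply: ler_wpM2l; first by rewrite addr_ge0// invr_ge0 ltW.
apply: le_trans (leak_sum_le mT fT mO _ (lF true)) _.
have -> : (size (index_enum {ffun 'I_p -> bool}))%:R = N.
  by rewrite -cardJ; congr (_%:R); rewrite -sum1_size -sum1_card; exact: eq_bigl.
rewrite ler_pM2l//.
apply: (@le_trans _ _ (\sum_(a : J) N^-1 * del)); last first.
  by rewrite sumr_const -mulr_natl cardJ mulrA mulfV ?gt_eqF// mul1r.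
apply: ler_sum => a _; rewrite leakZ//; last exact: oe.1.
have [ga|nga] := boolP (good a).
  rewrite eqxx sqn_coef ler_wpM2l ?invr_ge0 ?(ltW N0)//.
  exact: (hgood (k := (k.1, a))).
by rewrite /= sqn0 mul0r mulr_ge0// invr_ge0 ltW.
Qed.

End mixing.

(** Supplies the indices of the bad packets, distinct from each other and from all good ones, out of
    an infinite stock. *)
Lemma fresh_seq (I : eqType) (f : nat -> I) (s : seq I) (m : nat) : injective f ->
  exists s' : seq I, [/\ uniq s', size s' = m & forall i, i \in s' -> i \notin s].
Proof.
move=> fi; pose q := [seq f n | n <- iota 0 (m + size s)].
have uq : uniq q by rewrite map_inj_uniq// iota_uniq.
pose q' := [seq i <- q | i \notin s].
have hq : (m <= size q')%N.
  have := count_predC (fun i => i \in s) q; rewrite size_map size_iota => hc.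
  rewrite size_filter -(leq_add2r (size s)) -hc addnC leq_add2l -size_filter.
  apply: uniq_leq_size; first exact: filter_uniq.
  by move=> i; rewrite mem_filter => /andP[].
exists (take m q'); split.
- by apply: take_uniq; exact: filter_uniq.
- by rewrite size_take_min; apply/minn_idPl.
- by move=> i /mem_take; rewrite mem_filter => /andP[].
Qed.

Section mixed_family.
Variables (R : realType) (d : nat) (L : lebesgue_space R d).
Local Notation X := (ls_sort L).
Local Notation leb := (ls_mu L).
Variables (T Omega : set X).
Hypotheses (mT : measurable T) (fT : (leb T < +oo)%E).
Hypotheses (mO : measurable Omega) (fO : (leb Omega < +oo)%E).
Variables (I : eqType) (e : I -> X -> R[i]) (f : nat -> I).
Hypotheses (oe : orthonormal_fam leb e) (finj : injective f).

(** Each full group of [n0] good indices is completed by fresh ones to a block of [2^p], and each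
    block yields [2^p] mixtures; the good indices left after the last full group are dropped. *)
Lemma mixed_family (p n0 : nat) (s : seq I) (t del : R) :
  uniq s -> (forall i, i \in s -> leak T Omega (e i) <= del) -> (0 < n0)%N -> (n0 <= 2 ^ p)%N ->
  0 < t -> 0 <= del ->
  exists F : 'I_(size s %/ n0 * 2 ^ p) -> X -> R[i], orthonormal_fam leb F /\
    forall i, leak T Omega (F i) <=
      (1 + t) * ((2 ^ p - n0)%:R / 2 ^+ p) + (1 + t^-1) * (2 ^+ p * del).
Proof.
move=> us hs n00 n0N t0 del0.
pose J := {ffun 'I_p -> bool}; pose G := (size s %/ n0)%N.
have cJ : #|{: J}| = (2 ^ p)%N by rewrite card_ffun card_bool card_ord.
(* The place of a bit vector within its block: places below [n0] receive good packets, the others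
   fresh ones. *)
pose rk (a : J) : nat := enum_rank a.
have rkN a : (rk a < 2 ^ p)%N by rewrite -cJ; exact: ltn_ord.
have rki : injective rk by move=> a b /ord_inj /enum_rank_inj.
(* A fresh index is reserved for every place of every block, although only the places from [n0] on
   draw from [s']; this keeps the indexing uniform. *)
have [s' [us' ss' hs']] := fresh_seq s (G * 2 ^ p) finj.
pose good : pred J := fun a => (rk a < n0)%N.
pose g (k : 'I_G * J) : I := if good k.2 then nth (f 0%N) s (k.1 * n0 + rk k.2)
  else nth (f 0%N) s' (k.1 * 2 ^ p + rk k.2).
have lt_mul (i : 'I_G) (r m : nat) : (r < m)%N -> (i * m + r < G * m)%N.
  move=> rm; apply: (@leq_trans (i.+1 * m)%N); first by rewrite mulSn addnC ltn_add2r.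
  by rewrite leq_mul2r ltn_ord orbT.
have gs (k : 'I_G * J) : good k.2 -> (k.1 * n0 + rk k.2 < size s)%N.
  by move=> gk; apply: leq_trans (lt_mul k.1 _ _ gk) _; exact: leq_trunc_div.
have gs' (k : 'I_G * J) : (k.1 * 2 ^ p + rk k.2 < size s')%N by rewrite ss'; exact: lt_mul.
have eqdm (i i' : 'I_G) (r r' m : nat) : (r < m)%N -> (r' < m)%N ->
    (i * m + r = i' * m + r')%N -> i = i' /\ r = r'.
  move=> rm r'm E1; have m0 : (0 < m)%N by exact: leq_ltn_trans rm.
  have := congr1 (fun z => z %/ m)%N E1; have := congr1 (fun z => z %% m)%N E1.
  rewrite /= !modnMDl !modn_small// !divnMDl// !divn_small// !addn0 => -> h; split => //.
  exact: ord_inj.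
have ginj : injective g.
  move=> [i a] [i' a']; rewrite /g /=.
  have [ga|nga] := boolP (good a); have [ga'|nga'] := boolP (good a').
  - move/eqP; rewrite nth_uniq//; [|exact: (gs (i, a))|exact: (gs (i', a'))].
    by move=> /eqP /(eqdm _ _ _ _ _ ga ga')[-> /rki ->].
  - move=> E1; have := hs' (nth (f 0%N) s' (i' * 2 ^ p + rk a')).
    rewrite mem_nth; last exact: (gs' (i', a')).
    by move=> /(_ isT); rewrite -E1 mem_nth//; exact: (gs (i, a)).
  - move=> E1; have := hs' (nth (f 0%N) s' (i * 2 ^ p + rk a)).
    rewrite mem_nth; last exact: (gs' (i, a)).
    by move=> /(_ isT); rewrite E1 mem_nth//; exact: (gs (i', a')).
  - move/eqP; rewrite nth_uniq//; [|exact: (gs' (i, a))|exact: (gs' (i', a'))].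
    by move=> /eqP /(eqdm _ _ _ _ _ (rkN a) (rkN a'))[-> /rki ->].
have hg (k : 'I_G * J) : good k.2 -> leak T Omega (e (g k)) <= del.
  by move=> gk; apply: hs; rewrite /g gk mem_nth// gs.
have cK : #|{: 'I_G * J}| = (G * 2 ^ p)%N by rewrite card_prod card_ord cJ.
pose F (i : 'I_(G * 2 ^ p)) := mixed e g (enum_val (cast_ord (esym cK) i)).
have om := orthonormal_mixed oe ginj.
exists F; split.
  split=> [i|i j]; first exact: om.1.
  by rewrite om.2 (inj_eq enum_val_inj) (inj_eq (@cast_ord_inj _ _ _)).
move=> i; apply: le_trans (leak_mixed mT fT mO oe ginj t0 del0 hg _) _.
rewrite lerD2r; apply: ler_wpM2l; first by rewrite addr_ge0// ltW.
rewrite ler_wpM2r ?invr_ge0 ?exprn_ge0// ler_nat.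
have -> : #|[pred a | ~~ good a]| = size [seq rk a | a <- enum [pred a | ~~ good a]].
  by rewrite size_map cardE.
rewrite -[leqRHS](size_iota n0); apply: uniq_leq_size.
  by rewrite map_inj_uniq ?enum_uniq.
move=> z /mapP[a]; rewrite mem_enum inE -leqNgt => na ->.
by rewrite mem_iota na subnKC// rkN.
Qed.

End mixed_family.

(** * Selection of the good packets *)

Section packet_selection.
Variables (R : realType) (d : nat) (L : lebesgue_space R d).
Local Notation E := 'rV[R]_d.
Local Notation X := (ls_sort L).
Local Notation leb := (ls_mu L).
Variables (T Omega : set X).
Hypotheses (mT : measurable T) (fT : (leb T < +oo)%E).
Hypotheses (mO : measurable Omega) (fO : (leb Omega < +oo)%E).

(** Set, position and scale are dilated together. Therefore the cubes can be selected once in [T],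
    independently of [r]. *)
Lemma escape_dilate (w : X -> R) (r s : R) (x : E) : 0 < r ->
  escape (affX r^-1 0 @^-1` T) w (r * s) (r *: x) = escape T w s x.
Proof.
move=> r0; apply: eq_integral => y _; congr (_ * _)%:E.
have -> : affX s x y = affX r^-1 0 (affX (r * s) (r *: x) y) :> X.
  apply: (can_inj (@ls_valK _ _ L)); rewrite !val_affX addr0 -scalerA -scalerDr scalerA.
  by rewrite mulVf ?gt_eqF// scale1r.
by rewrite !indicE; congr (nat_of_bool _)%:R; apply/idP/idP; rewrite !inE.
Qed.

(** The scale [l] and the cubes are fixed by [T]; the frequency lattice is selected anew for every
    [r], at scale [1 / (r l)]. All pairs of a selected cube and a selected frequency are good. *)
Lemma packet_selection (del etaT etaO : R) : 0 < del -> 0 < etaT -> 0 < etaO ->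
  etaT <= fine (leb T) -> etaO <= fine (leb Omega) ->
  exists2 r0 : R, 0 < r0 & forall r : R, r0 <= r ->
    exists lam : R, exists tau : E, exists p0 : E, 0 < lam /\
    exists2 s : seq ('rV[int]_d * 'rV[int]_d), uniq s &
      (fine (leb T) - etaT) * (fine (leb Omega) - etaO) * (2 * pi) ^- d * r ^+ d <= (size s)%:R /\
      forall i, i \in s -> leak (affX r^-1 0 @^-1` T) Omega (@packet R d L lam tau p0 i) <= 5 * del.
Proof.
move=> del0 eT0 eO0 eT eO; have pi2 : 0 < 2 * pi :> R by rewrite mulr_gt0// pi_gt0.
have iU : integ leb (\1_(@ucubeX R d L) : X -> R).
  by apply: integ_indic; [exact: measurable_ucubeX|exact: leb_ucubeX_lty].
have U0 (y : X) : 0 <= \1_(@ucubeX R d L) y :> R by rewrite indicE.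
have [l l0 hl] := lattice_selection mT fT iU U0 ltr01 del0 eT0.
have [th [ks uks [szk hk]]] := hl l l0 (lexx _).
have [s1 s10 hs1] := lattice_selection mO fO (@integ_cubeFT2 R d L) (@cubeFT2_ge0 R d L) pi2 del0 eO0.
(* From this value on, [1 / (r l)] is at most the threshold [s1] of the frequency selection. *)
exists (l * s1)^-1; first by rewrite invr_gt0 mulr_gt0.
move=> r rr; have r0 : 0 < r by apply: lt_le_trans rr; rewrite invr_gt0 mulr_gt0.
pose lam := r * l; have lam0 : 0 < lam by rewrite mulr_gt0.
have lamV0 : 0 < lam^-1 by rewrite invr_gt0.
have lams : lam^-1 <= s1.
  rewrite invf_ple ?posrE// /lam mulrC -ler_pdivrMl//; apply: le_trans rr.
  by rewrite invfM.
have [th' [ks' uks' [szk' hk']]] := hs1 lam^-1 lamV0 lams.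
exists lam; exists (r *: th); exists th'; split => //.
exists [seq (k, k') | k <- ks, k' <- ks'].
  by apply: allpairs_uniq => // -[a b] [a' b'].
split.
  rewrite size_allpairs natrM; apply: le_trans (ler_pM _ _ szk szk').
  (* The cube count carries [l^-d] and the frequency count [(r l / 2 pi)^d], so that [l] cancels. *)
  - rewrite le_eqVlt; apply/orP; left; apply/eqP.
    rewrite mul1r !exprMn exprVn /lam exprMn.
    have nz (z : R) : 0 < z -> z ^+ d != 0 by move=> z0; rewrite gt_eqF// exprn_gt0.
    have n1 := nz 2 (ltr0n R 2); have n2 := nz pi (pi_gt0 R).
    have n3 := nz r r0; have n4 := nz l l0.
    by field; rewrite ?n1 ?n2 ?n3 ?n4.
  - by rewrite divr_ge0 ?subr_ge0// exprn_ge0// mul1r ltW.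
  - by rewrite divr_ge0 ?subr_ge0// exprn_ge0// mulr_ge0// ltW.
move=> _ /allpairsP[[k k'] /= [kin kin' ->]].
have mrT : measurable (affX r^-1 0 @^-1` T : set X).
  by apply: measurable_affX_set => //; rewrite invr_gt0.
have frT : (leb (affX r^-1 0 @^-1` T) < +oo)%E.
  rewrite leb_affX ?invr_gt0// -[leb T](@fineK _) ?ge0_fin_numE// -EFinM.
  by rewrite ltry.
apply: leak_packet => //=.
- have := hk k kin; rewrite mul1r -(escape_dilate _ _ _ r0) scalerDr scalerA -/lam.
  exact.
- exact: (hk' k' kin').
Qed.

End packet_selection.

(** * Choice of the constants and the asymptotic lower bound *)

Section asymptotics.
Variable R : realType.

Lemma exp2n_ge (x : R) : exists p : nat, x <= 2 ^+ p.
Proof.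
exists (Num.truncn x).+1; apply: (@le_trans _ _ (Num.truncn x).+1%:R).
  by rewrite ltW// truncnS_gt.
by rewrite -natrX ler_nat ltnW// ltn_expl.
Qed.

(* With n0 good packets in a block of 2^p, the bad ones contribute a defect just below
   eps, while the gain 2^p / n0 is close to 1 / (1 - eps). *)
Lemma block_size (eps theta : R) : 0 < eps -> eps < 1 -> 0 < theta -> theta <= 1 ->
  exists p n0 : nat, [/\ (0 < n0)%N, (n0 <= 2 ^ p)%N,
    (2 ^ p - n0)%:R / 2 ^+ p < eps &
    (1 - theta) * (1 - eps)^-1 <= 2 ^+ p / n0%:R].
Proof.
move=> e0 e1 th0 th1; have q0 : 0 < 1 - eps by rewrite subr_gt0.
(* Large enough that the rounding error 1 in [n0] is at most the fraction [theta] of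
   [(1 - eps) N]. *)
have [p hp] := exp2n_ge ((theta * (1 - eps))^-1).
pose N : R := 2 ^+ p; have N0 : 0 < N by exact: exprn_gt0.
have x0 : 0 <= (1 - eps) * N by rewrite mulr_ge0// ltW.
(* Truncation plus one lies strictly above [(1 - eps) N], which makes the share of bad places
   strictly smaller than [eps]. *)
pose n0 := (Num.truncn ((1 - eps) * N)).+1.
have n0l : (1 - eps) * N < n0%:R by exact: truncnS_gt.
have n0u : n0%:R <= (1 - eps) * N + 1.
  by rewrite /n0 -natr1 lerD2r; have /andP[] := truncn_itv x0.
have NE : N = (2 ^ p)%:R by rewrite natrX.
have n0N : (n0 <= 2 ^ p)%N.
  rewrite /n0 -(ltr_nat R) -NE; have /andP[h _] := truncn_itv x0.
  apply: le_lt_trans h _; rewrite -[ltRHS]mul1r ltr_pM2r// ltrBlDr ltrDl//.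
exists p; exists n0; split => //.
  by rewrite natrB// -NE -/N ltr_pdivrMr// ltrBlDr; move: n0l; rewrite mulrBl mul1r; lra.
have n00 : 0 < n0%:R :> R by rewrite ltr0n.
rewrite -/N ler_pdivlMr// mulrAC ler_pdivrMr//.
have h1 : 1 <= theta * (1 - eps) * N by rewrite -ler_pdivrMl ?mulr1// mulr_gt0.
have h2 : (1 - theta) * n0%:R <= (1 - theta) * ((1 - eps) * N + 1).
  by rewrite ler_wpM2l// subr_ge0.
apply: le_trans h2 _.
by move: h1; set y := (1 - eps) * N; rewrite -mulrA -/y mulrC [N * _]mulrC -/y => h1; nra.
Qed.

Lemma expr_ge_self (d : nat) (r : R) : (1 <= d)%N -> 1 <= r -> r <= r ^+ d.
Proof.
by case: d => // d _ r1; rewrite exprS ler_peMr ?(le_trans ler01 r1)// exprn_ege1.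
Qed.

End asymptotics.

Section lower_bound.
Variables (R : realType) (d : nat).
Local Notation E := 'rV[R]_d.
Local Notation L := (Leb_space R d).
Local Notation X := (ls_sort L).

(** In positive dimension there are infinitely many packet indices, so fresh ones never run out. *)
Lemma lattice_point_inj (d_ge1 : (1 <= d)%N) :
  injective (fun n : nat => (const_mx n%:Z, 0) : 'rV[int]_d * 'rV[int]_d).
Proof.
case: d d_ge1 => // d' _ m n [] /matrixP /(_ ord0 ord0); rewrite !mxE => h.
by case: h.
Qed.

Variables (T Omega : set E) (eps : R).
Hypothesis d_ge1 : (1 <= d)%N.
Hypotheses (mT : Lebesgue_measurable T) (fT : (Leb T < +oo)%E).
Hypotheses (mO : Lebesgue_measurable Omega) (fO : (Leb Omega < +oo)%E).
Hypotheses (eps_gt0 : 0 < eps) (eps_lt1 : eps < 1).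

Let C : R := (1 - eps)^-1 * (2 * pi) ^- d * fine (Leb T) * fine (Leb Omega).

(** Half of [eta] pays for the losses proportional to [r^d] (cubes, frequencies, block ratio), the
    other half for the incomplete last block, which costs at most [N] functions. *)
Lemma Mminus_lower_bound (eta : R) : 0 < eta ->
  exists2 r0 : R, 0 < r0 & forall r m, r0 <= r -> is_Mminus (dilate r T) Omega eps m ->
    (C - eta) * r ^+ d <= m%:R.
Proof.
move=> eta0; pose a := fine (Leb T); pose b := fine (Leb Omega).
have pi2 : 0 < 2 * pi :> R by rewrite mulr_gt0// pi_gt0.
have q0 : 0 < (1 - eps)^-1 by rewrite invr_gt0 subr_gt0.
have A0 : 0 < (2 * pi) ^- d :> R by rewrite invr_gt0 exprn_gt0.
have a0 : 0 <= a by exact: fine_ge0.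
have b0 : 0 <= b by exact: fine_ge0.
(* If a measure vanishes, [C] is 0 and the left side is nonpositive. *)
have [ab0|abn0] := eqVneq (a * b) 0.
  exists 1 => // r m r1 _; rewrite /C -/a -/b -mulrA ab0 mulr0 sub0r mulNr.
  apply: (@le_trans _ _ 0) => //; rewrite oppr_le0 mulr_ge0 ?(ltW eta0)// exprn_ge0//.
  exact: le_trans r1.
have {}a0 : 0 < a.
  by rewrite lt_neqAle a0 andbT eq_sym; apply: contraNneq abn0 => ->; rewrite mul0r.
have {}b0 : 0 < b.
  by rewrite lt_neqAle b0 andbT eq_sym; apply: contraNneq abn0 => ->; rewrite mulr0.
have C0 : 0 < C by rewrite /C !mulr_gt0.
(* Three losses cost a factor [1 - theta] each. Since [(1 - theta)^3 >= 1 - 3 theta], the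
   requirement [3 theta C <= eta / 2] explains the constant 6. *)
pose theta := Num.min 1 (eta / (6 * C)).
have th0 : 0 < theta by rewrite lt_min ltr01 divr_gt0// mulr_gt0.
have th1 : theta <= 1 by rewrite ge_min lexx.
have thC : 3 * theta * C <= eta / 2.
  have h : theta <= eta / (6 * C) by rewrite ge_min lexx orbT.
  move: h; rewrite ler_pdivlMr ?mulr_gt0//; lra.
have [p [n0 [n00 n0N hbeta hq]]] := block_size eps_gt0 eps_lt1 th0 th1.
set N : R := 2 ^+ p in hbeta hq.
have N0 : 0 < N by exact: exprn_gt0.
set beta := _ / N in hbeta.
have beta0 : 0 <= beta by rewrite divr_ge0// ltW.
(* With [del] below, the leakage is at most [(1 + t) beta + t], hence at most [beta + 2 t = eps]. *)
pose t := (eps - beta) / 2; have t0 : 0 < t by rewrite divr_gt0// subr_gt0.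
pose del := t / ((1 + t^-1) * N).
have t10 : 0 < 1 + t^-1 by rewrite addr_gt0// invr_gt0.
have del0 : 0 < del by rewrite divr_gt0// mulr_gt0.
have d50 : 0 < del / 5 by rewrite divr_gt0.
have eT : theta * a <= a by rewrite ler_piMl// ltW.
have eO : theta * b <= b by rewrite ler_piMl// ltW.
have [r1 r10 hr1] := @packet_selection R d L T Omega mT fT mO fO (del / 5) (theta * a) (theta * b)
  d50 (mulr_gt0 th0 a0) (mulr_gt0 th0 b0) eT eO.
(* The summands ensure the packet selection, [r <= r^d], and [N <= (eta / 2) r^d]. *)
pose r0 := r1 + 1 + 2 * N / eta.
have Ne0 : 0 <= 2 * N / eta by rewrite divr_ge0 ?mulr_ge0// ltW.
exists r0; first by rewrite /r0 -addrA ltr_wpDr// addr_ge0.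
move=> r m rr [_ hmax].
have rr1 : r1 <= r by apply: le_trans rr; rewrite /r0 -addrA lerDl addr_ge0.
have r1' : 1 <= r by apply: le_trans rr; rewrite /r0 addrAC lerDr addr_ge0// ltW.
have rN : 2 * N / eta <= r by apply: le_trans rr; rewrite /r0 lerDr addr_ge0// ltW.
have rgt0 : 0 < r by exact: lt_le_trans r1'.
have [lam [tau [p0 [lam0 [s us [ssz hs]]]]]] := hr1 r rr1.
have mrT : Lebesgue_measurable (dilate r T) by exact: Lebesgue_measurable_dilate.
have frT : (Leb (dilate r T) < +oo)%E.
  by rewrite Leb_dilate// -[Leb T](@fineK _) ?ge0_fin_numE// -EFinM ltry.
have dE : dilate r T = affX r^-1 0 @^-1` (T : set X) :> set X.
  by rewrite dilateE ?gt_eqF.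
have op := @orthonormal_packet R d L lam tau p0 lam0.
have hs' i : i \in s -> leak (dilate r T : set X) (Omega : set X) (@packet R d L lam tau p0 i) <= del.
  by move=> /hs; rewrite dE => /le_trans; apply; rewrite mulrC divfK.
have [F [oF lF]] := @mixed_family R d L (dilate r T) Omega mrT frT mO _ _ _ op
  (lattice_point_inj d_ge1) p n0 s t del us hs' n00 n0N t0 (ltW del0).
have hn : almost_fixed_numbers (dilate r T) Omega eps (size s %/ n0 * 2 ^ p)%N.
  apply: (almost_fixed_leak mrT frT mO fO oF) => i; apply: le_trans (lF i) _.
  rewrite -/N -/beta.
  have -> : (1 + t^-1) * (N * del) = t by rewrite mulrA /del mulrC divfK// gt_eqF// mulr_gt0.
  have beta1 : beta <= 1 by apply: ltW; exact: lt_trans hbeta eps_lt1.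
  have : t * beta <= t by rewrite ler_piMr// ltW.
  by rewrite /t; move: (beta) => B; lra.
have := hmax _ hn; rewrite -(ler_nat R); apply: le_trans.
rewrite natrM natrX -/N.
have hG : (size s)%:R / n0%:R - 1 <= (size s %/ n0)%N%:R :> R.
  rewrite lerBlDr natr1 ler_pdivrMr ?ltr0n// -natrM ler_nat ltnW//.
  exact: ltn_ceil.
apply: le_trans (ler_wpM2r (ltW N0) hG).
have rd : r <= r ^+ d by exact: expr_ge_self.
have Nr : N <= eta / 2 * r ^+ d.
  apply: (@le_trans _ _ (eta / 2 * r)); last by rewrite ler_pM2l// divr_gt0.
  by move: rN; rewrite ler_pdivrMr//; lra.
pose Q := (2 * pi) ^- d * r ^+ d; have Q0 : 0 <= Q by rewrite mulr_ge0 ?(ltW A0)// exprn_ge0// ltW.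
have h1 : (1 - theta) * (1 - eps)^-1 * ((a - theta * a) * (b - theta * b) * Q)
    <= (size s)%:R / n0%:R * N.
  have -> : (size s)%:R / n0%:R * N = N / n0%:R * (size s)%:R by rewrite mulrC mulrA mulrAC.
  apply: ler_pM => //.
  - by rewrite mulr_ge0 ?subr_ge0// ltW.
  - apply: mulr_ge0 => //; apply: mulr_ge0; by rewrite subr_ge0.
  - by rewrite /Q mulrA.
rewrite [leRHS]mulrBl mul1r.
apply: (@le_trans _ _ ((1 - 3 * theta) * C * r ^+ d - eta / 2 * r ^+ d)).
  have : 3 * theta * C * r ^+ d <= eta / 2 * r ^+ d by rewrite ler_wpM2r// exprn_ge0// ltW.
  by move: (C) (r ^+ d) => c rd'; lra.
apply: lerB => //; apply: le_trans h1.
have -> : (1 - theta) * (1 - eps)^-1 * ((a - theta * a) * (b - theta * b) * Q) =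
    (1 - theta) ^+ 3 * (C * r ^+ d) by rewrite /C /Q -/a -/b; ring.
rewrite -mulrA; apply: ler_wpM2r.
  exact: (mulr_ge0 (ltW C0) (exprn_ge0 _ (ltW rgt0))).
by move: th0 th1; nra.
Qed.

End lower_bound.

Theorem mainTheorem1 (R : realType) (d : nat) (T Omega : set 'rV[R]_d)
    (eps : R) (d_ge1 : (1 <= d)%N)
    (mT : Lebesgue_measurable T) (finT : (Leb T < +oo)%E)
    (mOmega : Lebesgue_measurable Omega) (finOmega : (Leb Omega < +oo)%E)
    (eps_gt0 : 0 < eps) (eps_lt1 : eps < 1) :
  exists M : R -> nat,
    (forall r : R, 0 < r -> is_Mminus (dilate r T) Omega eps (M r)) /\
    exists e : R -> R,
      (e r / r ^+ d @[r --> +oo] --> (0 : R)) /\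
      forall r : R, 0 < r ->
        (1 - eps)^-1 * (2 * pi) ^- d * fine (Leb T) * fine (Leb Omega) * r ^+ d
          + e r <= (M r)%:R.
Proof.
have Mex (r : R) : exists m, 0 < r -> is_Mminus (dilate r T) Omega eps m.
  (* For [r <= 0] nothing is claimed and 0 is a default value. *)
  have [r0|r0] := ltP 0 r; last by exists 0%N.
  have mrT : Lebesgue_measurable (dilate r T) by exact: Lebesgue_measurable_dilate.
  have frT : (Leb (dilate r T) < +oo)%E.
    by rewrite Leb_dilate// -[Leb T](@fineK _) ?ge0_fin_numE// -EFinM ltry.
  by have [m hm] := Mminus_exists mrT frT mOmega finOmega eps_gt0 eps_lt1; exists m.
have [M hM] := choice Mex; exists M; split => //.
set C := (1 - eps)^-1 * _ * _ * _.
(* The negative part of the gap makes the inequality hold for every positive [r]; the lower bound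
   shows that it is at least [- eta r^d] for large [r]. *)
exists (fun r => Num.min ((M r)%:R - C * r ^+ d) 0); split; last first.
  by move=> r r0; rewrite -lerBrDl ge_min lexx.
apply/cvgrPdist_le => eta eta0.
have [r0 r00 hr0] := Mminus_lower_bound d_ge1 mT finT mOmega finOmega eps_gt0 eps_lt1 eta0.
near=> r; have rr0 : r0 <= r by near: r; apply: nbhs_pinfty_ge; exact: num_real.
have rgt0 : 0 < r by exact: lt_le_trans rr0.
have rd0 : 0 < r ^+ d by exact: exprn_gt0.
have h := hr0 r (M r) rr0 (hM r rgt0).
rewrite sub0r normrN normrM [`|_^-1|]gtr0_norm ?invr_gt0// ler_pdivrMr//.
rewrite ler0_norm; last by rewrite ge_min lexx orbT.
rewrite lerNl le_min oppr_le0 mulr_ge0 ?(ltW eta0) ?(ltW rd0)// andbT.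
by move: h; rewrite -/C mulrBl; lra.
Unshelve. all: by end_near. Qed.
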